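(* Consider on $[0,+\infty)\times\mathbb{R}^2_x$ the system for $\mathbf{u}=(u_1,\dots,u_6)$, $u_j:[0,\infty)\times\mathbb{R}^2\to\mathbb{C}$, $$\begin{cases}(\partial_t+i\Lambda_1)u_1=0\\ (\partial_t+i\Lambda_2)u_2=0\\ (\partial_t+i\Lambda_3)u_3=0\\ (\partial_t+i\Lambda_1)u_4=u_2\cdot\overline{u_1}\\ (\partial_t+i\Lambda_2)u_5=u_3\cdot\overline{u_2}\\ (\partial_t+i\Lambda_1)u_6=u_5\cdot\overline{u_4}\end{cases}$$ There is an absolute constant $C$ such that for any arbitrarily small $\varepsilon>0$ there exists an initial condition $\mathbf{u}_0$ such that: (i) for every integer $l\le 0$, $\widehat{P_l\mathbf{u}_0}\neq 0$ (i.e. it is not identically zero); (ii) $\|\mathbf{u}_0\|_{L^2}\le C\varepsilon$ (in particular $\ll 1$); (iii) if $\mathbf{u}$ denotes the corresponding global solution of the Cauchy problem with $\mathbf{u}(0)=\mathbf{u}_0$, then $$\lim_{t\to\infty}\|\mathbf{u}(t)\|_{L^2}=+\infty.$$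
   Context: The operators $\Lambda_j$ are the Fourier multipliers on $\mathbb{R}^2$ given by $\widehat{\Lambda_1f}(\xi)=\sqrt{|\xi|^2+1}\,\widehat f(\xi)$, $\widehat{\Lambda_2f}(\xi)=\sqrt{2|\xi|^2+4}\,\widehat f(\xi)$, $\widehat{\Lambda_3f}(\xi)=\sqrt{4|\xi|^2+16}\,\widehat f(\xi)$. The bar is complex conjugation. Fix an even smooth function $\varphi:\mathbb{R}\to[0,1]$ supported in $[-1.2,1.2]$ and equal to $1$ on $[-1.1,1.1]$; for $k\in\mathbb{Z}$ and $x\in\mathbb{R}^2$ put $\varphi_k(x)=\varphi(|x|/2^k)-\varphi(|x|/2^{k-1})$. $P_k$ is the Fourier multiplier operator with symbol $\varphi_k(\xi)$, applied componentwise to vectors. $L^2$ denotes $L^2(\mathbb{R}^2;\mathbb{C}^6)$. *)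

(* Defs.v *)
From HB Require Import structures.
From mathcomp Require Import all_boot all_order all_algebra.
From mathcomp Require Export complex.
From mathcomp Require Import all_classical all_reals all_analysis.

Set Implicit Arguments.
Unset Strict Implicit.
Unset Printing Implicit Defensive.

Import Order.TTheory GRing.Theory Num.Theory.
Import numFieldNormedType.Exports.

Local Open Scope classical_set_scope.
Local Open Scope ring_scope.
Local Open Scope complex_scope.

Notation plane R := (measurableTypeR R * measurableTypeR R)%type.

Definition leb2 {R : realType} : {measure set (plane R) -> \bar R} :=
  ((@lebesgue_measure R) \x (@lebesgue_measure R))%E.

(* The canonical norm of R * R is the sup norm, hence these definitions. *)
Definition dot {R : realType} (x y : plane R) : R :=
  (x.1 : R) * (y.1 : R) + (x.2 : R) * (y.2 : R).
Definition enorm {R : realType} (x : plane R) : R := Num.sqrt (dot x x).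

Definition cmod {R : realType} (z : R[i]) : R :=
  Num.sqrt (complex.Re z ^+ 2 + complex.Im z ^+ 2).

Definition L1 {R : realType} (f : plane R -> R[i]) : Prop :=
  leb2.-integrable setT (EFin \o (fun x => complex.Re (f x))) /\
  leb2.-integrable setT (EFin \o (fun x => complex.Im (f x))).

Definition L2 {R : realType} (f : plane R -> R[i]) : Prop :=
  (fun x => complex.Re (f x)) \in Lfun leb2 2%:E /\
  (fun x => complex.Im (f x)) \in Lfun leb2 2%:E.

Definition L2norm {R : realType} (f : plane R -> R[i]) : \bar R :=
  'N[leb2]_2%:E [EFin \o (fun x => cmod (f x))]%E.

(* The norm of L^2(R^2; C^n), with the Hermitian norm on C^n. *)
Definition L2vnorm {R : realType} n (u : 'I_n -> plane R -> R[i]) : \bar R :=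
  'N[leb2]_2%:E
    [EFin \o (fun x => Num.sqrt (\sum_(j < n) cmod (u j x) ^+ 2))]%E.

Definition cintegral {R : realType} (f : plane R -> R[i]) : R[i] :=
  (\int[leb2]_x complex.Re (f x)) +i* (\int[leb2]_x complex.Im (f x)).

Definition cis {R : realType} (a : R) : R[i] := cos a +i* sin a.

(* The convention e^{-i x.xi}, for which Lambda_1 = sqrt (1 - Laplacian). *)
Definition fourier1 {R : realType} (f : plane R -> R[i]) : plane R -> R[i] :=
  fun xi => cintegral (fun x => cis (- dot x xi) * f x).

(* The graph of the Fourier-Plancherel transform: the L^2-continuous extension
   of [fourier1] from the intersection of L^1 and L^2 to the whole of L^2. *)
Definition is_fourier {R : realType} (f g : plane R -> R[i]) : Prop :=
  [/\ L2 f, L2 g &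
    exists F : nat -> plane R -> R[i],
      [/\ forall n, L1 (F n) /\ L2 (F n),
          L2norm (fun x => F n x - f x) @[n --> \oo] --> 0%E &
          L2norm (fun xi => fourier1 (F n) xi - g xi) @[n --> \oo] --> 0%E]].

(* By Plancherel's theorem [is_fourier] is, up to equality almost everywhere,
   the graph of a bijection of L^2. Outside L^2 both functions return 0. *)
Definition fourier {R : realType} (f : plane R -> R[i]) : plane R -> R[i] :=
  xget (fun=> 0) [set g | is_fourier f g].
Definition ifourier {R : realType} (g : plane R -> R[i]) : plane R -> R[i] :=
  xget (fun=> 0) [set f | is_fourier f g].

Definition symb_mul {R : realType} (m : plane R -> R) (f : plane R -> R[i])
    : plane R -> R[i] :=
  fun xi => (m xi)%:C * fourier f xi.

Definition in_domain {R : realType} (m : plane R -> R) (f : plane R -> R[i])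
    : Prop :=
  L2 f /\ L2 (symb_mul m f).

(* Meaningful when [in_domain m f]. *)
Definition multiplier {R : realType} (m : plane R -> R) (f : plane R -> R[i])
    : plane R -> R[i] :=
  ifourier (symb_mul m f).

Definition lam1 {R : realType} (xi : plane R) : R :=
  Num.sqrt (enorm xi ^+ 2 + 1).
Definition lam2 {R : realType} (xi : plane R) : R :=
  Num.sqrt (2 * enorm xi ^+ 2 + 4).
Definition lam3 {R : realType} (xi : plane R) : R :=
  Num.sqrt (4 * enorm xi ^+ 2 + 16).

Definition is_cutoff {R : realType} (phi : R -> R) : Prop :=
  [/\ (forall x, phi (- x) = phi x),
      (forall (n : nat) x, derivable (derive1n n phi) x 1),
      (forall x, 0 <= phi x <= 1),
      (forall x, 12 / 10 < `|x| -> phi x = 0) &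
      (forall x, `|x| <= 11 / 10 -> phi x = 1)].

Definition phi_ {R : realType} (phi : R -> R) (k : int) (x : plane R) : R :=
  phi (enorm x / 2 ^ k) - phi (enorm x / 2 ^ (k - 1)).

Definition LP {R : realType} (phi : R -> R) (k : int) (f : plane R -> R[i])
    : plane R -> R[i] :=
  multiplier (phi_ phi k) f.

(* [dv] is the derivative at time [t] of the curve [v] : [0, oo) -> L^2
   (one-sided if t = 0). *)
Definition L2_deriv {R : realType} (v : R -> plane R -> R[i]) (t : R)
    (dv : plane R -> R[i]) : Prop :=
  L2norm (fun x => (h^-1)%:C * (v (t + h) x - v t x) - dv x)
    @[h --> within [set h | 0 <= t + h] 0^'] --> 0%E.

(* (d/dt + i Lambda) v = N on [0, oo), where Lambda has symbol [lam], as an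
   equality in L^2 at each time. *)
Definition evol_eq {R : realType} (lam : plane R -> R)
    (v N : R -> plane R -> R[i]) : Prop :=
  forall t, 0 <= t ->
    in_domain lam (v t) /\
    exists dv : plane R -> R[i],
      [/\ L2 dv, L2_deriv v t dv &
          (fun x => dv x + 'i%C * multiplier lam (v t) x) = N t %[ae leb2]].

(* The component u_k, numbered from 1 to 6. *)
Definition cpt {R : realType} (u : R -> 'I_6 -> plane R -> R[i]) (k : nat)
    : R -> plane R -> R[i] :=
  fun t => u t (inord k.-1).

Definition prod_conj {R : realType} (v w : R -> plane R -> R[i])
    : R -> plane R -> R[i] :=
  fun t x => v t x * conjc (w t x).

Definition solution {R : realType} (u0 : 'I_6 -> plane R -> R[i])
    (u : R -> 'I_6 -> plane R -> R[i]) : Prop :=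
  (forall j, u 0 j = u0 j %[ae leb2]) /\
  [/\ evol_eq lam1 (cpt u 1) (fun _ _ => 0),
      evol_eq lam2 (cpt u 2) (fun _ _ => 0) &
      evol_eq lam3 (cpt u 3) (fun _ _ => 0)] /\
  [/\ evol_eq lam1 (cpt u 4) (prod_conj (cpt u 2) (cpt u 1)),
      evol_eq lam2 (cpt u 5) (prod_conj (cpt u 3) (cpt u 2)) &
      evol_eq lam1 (cpt u 6) (prod_conj (cpt u 5) (cpt u 4))].

(* Main.v *)
Require Import Defs.
From HB Require Import structures.
From mathcomp Require Import all_boot all_order all_algebra complex.
From mathcomp Require Import all_classical all_reals all_analysis.
From mathcomp Require Import measurable_realfun ring lra.

(** The system is triangular: [u_1], [u_2], [u_3] are free waves, [u_4] is
    forced by the product of [u_2] and the conjugate of [u_1], and so on. If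
    only the first two components have nonzero data then [u_3], [u_5] and [u_6]
    stay zero, and [u_4] is given by Duhamel's formula. On the Fourier side, at
    the frequency xi, it is an integral over z of

      (integral over s in [0, t] of e^{i s Phi(xi, z)}) * a_2(z) * a_1(xi - z)

    up to a factor of modulus c * eps^2, where a_2 and a_1 describe the data and
    Phi(xi, z) = lam1(xi) + lam1(z - xi) - lam2(z). The resonance is that Phi
    vanishes at the origin, because 1 + 1 = 2, and is quadratic there
    ([phase_le]): at frequencies of size r nothing oscillates before a time of
    order r^{-2}, so the inner integral is of order t ([osc_re_ge]).

    The data are chosen with a spike at zero frequency: their transform is eps
    times (x y)^{-3/8} on the unit square (reflected through 0 for the first
    component, which enters conjugated), and this is square-integrable. As it
    is supported in one quadrant, only frequencies z between 0 and xi
    contribute to xi. At the time t = 1/(8 r^2) the transform of [u_4] is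
    then at least a constant times eps^2 * t * r^2 * r^{-3/2} on the square of
    the frequencies between r/2 and r, and the norm of [u_4] is at least a
    constant times eps^2 * r^{-1/2} = eps^2 * (8 t)^{1/4} ([sq_duhamel_ge]). The
    size of the data only enters through a factor. The spike also meets every
    dyadic shell below the unit one ([LP_flow0]).

    To make this rigorous one needs L^2 theory of the Fourier transform, here
    defined as a closure. Two-sided bounds up to constants are enough:
    [is_fourier_le] comes from Bessel's inequality, proved by inserting the
    Abel factor e^{-e(|x|+|y|)}, whose transform is a Poisson kernel ([bessel]);
    the inverse bound [is_fourier_ge] comes from the inversion theorem
    [is_fourier_inversion], which is proved weakly against indicators of boxes:
    their Poisson integrals are explicit ([parseval_box]), and a pi-lambda
    argument shows that boxes separate functions ([null_of_box_integrals]).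

    The equations are equalities in L^2 with time derivatives in L^2. Explicit
    symbols solve them by a Taylor expansion in time that is uniform in the
    frequency ([evol_of_symbol]), and solutions are unique because the symbols
    are real, which conserves the energy of a difference ([evol_unique]). Hence
    any solution with these data has the explicit fourth component
    ([flow_unique]), and its norm tends to infinity ([growth_cvg]). *)

Set Implicit Arguments.
Unset Strict Implicit.
Unset Printing Implicit Defensive.

Import Order.TTheory GRing.Theory Num.Theory.
Import numFieldNormedType.Exports.

Local Open Scope classical_set_scope.
Local Open Scope ring_scope.
Local Open Scope complex_scope.

(** * The modulus of a complex number *)

(** Unlike [cmod], this is a polynomial in the real and imaginary parts, hence
    within reach of [ring] and [lra]. *)
Definition nsq {R : realType} (z : R[i]) : R :=
  complex.Re z ^+ 2 + complex.Im z ^+ 2.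

Section modulus.
Context {R : realType}.
Implicit Types z w : R[i].

Lemma complexP z w : complex.Re z = complex.Re w ->
  complex.Im z = complex.Im w -> z = w.
Proof. by case: z => a b; case: w => c d /= -> ->. Qed.

Lemma ReD z w : complex.Re (z + w) = complex.Re z + complex.Re w.
Proof. by case: z => a b; case: w. Qed.
Lemma ImD z w : complex.Im (z + w) = complex.Im z + complex.Im w.
Proof. by case: z => a b; case: w. Qed.
Lemma ReN z : complex.Re (- z) = - complex.Re z.
Proof. by case: z. Qed.
Lemma ImN z : complex.Im (- z) = - complex.Im z.
Proof. by case: z. Qed.
Lemma ReM z w : complex.Re (z * w) =
  complex.Re z * complex.Re w - complex.Im z * complex.Im w.
Proof. by case: z => a b; case: w. Qed.
Lemma ImM z w : complex.Im (z * w) =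
  complex.Re z * complex.Im w + complex.Im z * complex.Re w.
Proof. by case: z => a b; case: w. Qed.
Lemma Reconj z : complex.Re (conjc z) = complex.Re z.
Proof. by case: z. Qed.
Lemma Imconj z : complex.Im (conjc z) = - complex.Im z.
Proof. by case: z. Qed.

Lemma nsq_ge0 z : 0 <= nsq z.
Proof. by rewrite addr_ge0 ?sqr_ge0. Qed.
Lemma nsqM z w : nsq (z * w) = nsq z * nsq w.
Proof. by case: z => a b; case: w => c d; rewrite /nsq /=; ring. Qed.
Lemma nsqN z : nsq (- z) = nsq z.
Proof. by case: z => a b; rewrite /nsq /=; ring. Qed.
Lemma nsq_conj z : nsq (conjc z) = nsq z.
Proof. by case: z => a b; rewrite /nsq /=; ring. Qed.
Lemma nsq_cis (a : R) : nsq (cis a) = 1.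
Proof. by rewrite /nsq /= cos2Dsin2. Qed.
Lemma nsq_real (a : R) : nsq a%:C = a ^+ 2.
Proof. by rewrite /nsq /=; ring. Qed.
Lemma nsq0 : nsq (0 : R[i]) = 0.
Proof. by rewrite /nsq /=; ring. Qed.
Lemma nsqD_le z w : nsq (z + w) <= 2 * nsq z + 2 * nsq w.
Proof.
case: z => a b; case: w => c d; rewrite /nsq /=.
by have := sqr_ge0 (a - c); have := sqr_ge0 (b - d); lra.
Qed.
Lemma nsqB_le z w : nsq (z - w) <= 2 * nsq z + 2 * nsq w.
Proof. by have := nsqD_le z (- w); rewrite nsqN. Qed.
Lemma nsq_eq0 z : nsq z = 0 -> z = 0.
Proof.
case: z => a b; rewrite /nsq /= => /eqP.
by rewrite paddr_eq0 ?sqr_ge0// !sqrf_eq0 => /andP[/eqP -> /eqP ->].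
Qed.

Lemma cmod_ge0 z : 0 <= cmod z.
Proof. exact: sqrtr_ge0. Qed.
Lemma cmod_sqr z : cmod z ^+ 2 = nsq z.
Proof. by rewrite sqr_sqrtr ?nsq_ge0. Qed.
Lemma cmodM z w : cmod (z * w) = cmod z * cmod w.
Proof. by rewrite /cmod -[X in Num.sqrt X]/(nsq (z * w)) nsqM sqrtrM ?nsq_ge0. Qed.
Lemma cmod_cis (a : R) : cmod (cis a) = 1.
Proof. by rewrite /cmod -[X in Num.sqrt X]/(nsq (cis a)) nsq_cis sqrtr1. Qed.
Lemma cmod_conj z : cmod (conjc z) = cmod z.
Proof. by rewrite /cmod -[X in Num.sqrt X]/(nsq (conjc z)) nsq_conj. Qed.
Lemma cmod0 : cmod (0 : R[i]) = 0.
Proof. by rewrite /cmod -[X in Num.sqrt X]/(nsq (0 : R[i])) nsq0 sqrtr0. Qed.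
Lemma cmod_real (a : R) : cmod a%:C = `|a|.
Proof. by rewrite /cmod -[X in Num.sqrt X]/(nsq (a%:C)) nsq_real sqrtr_sqr. Qed.
Lemma cmod_le z (a : R) : 0 <= a -> nsq z <= a ^+ 2 -> cmod z <= a.
Proof.
move=> a0 h; rewrite -(@ler_pXn2r _ 2) ?nnegrE ?cmod_ge0//.
by rewrite cmod_sqr.
Qed.
Lemma cmod_ge z (a : R) : 0 <= a -> cmod z <= a -> nsq z <= a ^+ 2.
Proof.
by move=> a0 h; rewrite -cmod_sqr; apply: lerXn2r; rewrite ?nnegrE ?cmod_ge0.
Qed.
Lemma Re_le_cmod z : `|complex.Re z| <= cmod z.
Proof.
rewrite -(@ler_pXn2r _ 2) ?nnegrE ?cmod_ge0// cmod_sqr /nsq real_normK ?num_real//.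
by have := sqr_ge0 (complex.Im z); lra.
Qed.
Lemma Im_le_cmod z : `|complex.Im z| <= cmod z.
Proof.
rewrite -(@ler_pXn2r _ 2) ?nnegrE ?cmod_ge0// cmod_sqr /nsq real_normK ?num_real//.
by have := sqr_ge0 (complex.Re z); lra.
Qed.
Lemma cmod_le_ReIm z : cmod z <= `|complex.Re z| + `|complex.Im z|.
Proof.
apply: cmod_le; first by rewrite addr_ge0.
rewrite /nsq -(real_normK (num_real (complex.Re z))) -(real_normK (num_real (complex.Im z))).
have := mulr_ge0 (normr_ge0 (complex.Re z)) (normr_ge0 (complex.Im z)).
by nra.
Qed.
(** Young's inequality with a free weight [k]: integrated, it gives a form of
    the Cauchy-Schwarz inequality without square roots. *)
Lemma cmodM_le z w (k : R) : 0 < k ->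
  cmod z * cmod w <= (k * nsq z + k^-1 * nsq w) / 2.
Proof.
move=> k0; rewrite -!cmod_sqr.
have kk : k * k^-1 = 1 by rewrite mulfV ?gt_eqF.
have k0' : 0 < k^-1 by rewrite invr_gt0.
have := sqr_ge0 (k * cmod z - cmod w).
move=> /(mulr_ge0 (ltW k0')).
set a := cmod z; set b := cmod w; set l := k^-1 => h.
have -> : (k * a ^+ 2 + l * b ^+ 2) / 2 = a * b + (l * (k * a - b) ^+ 2) / 2.
  have : k * a ^+ 2 = (k * l) * k * a ^+ 2 by rewrite kk mul1r.
  have : a * b = (k * l) * (a * b) by rewrite kk mul1r.
  by move=> -> ->; field.
by rewrite lerDl divr_ge0.
Qed.
End modulus.

(** * Measurable and integrable complex functions *)

Definition cmeas {d} {T : measurableType d} {R : realType} (f : T -> R[i]) :=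
  measurable_fun setT (fun x => complex.Re (f x)) /\
  measurable_fun setT (fun x => complex.Im (f x)).

Definition cintg {d} {T : measurableType d} {R : realType}
    (mu : {measure set T -> \bar R}) (f : T -> R[i]) :=
  mu.-integrable setT (EFin \o (fun x => complex.Re (f x))) /\
  mu.-integrable setT (EFin \o (fun x => complex.Im (f x))).

Definition cint {d} {T : measurableType d} {R : realType}
    (mu : {measure set T -> \bar R}) (f : T -> R[i]) : R[i] :=
  (\int[mu]_x complex.Re (f x)) +i* (\int[mu]_x complex.Im (f x)).

Section complex_measurability.
Context {d} {T : measurableType d} {R : realType}.
Implicit Types f g : T -> R[i].

Lemma cmeas_cst (z : R[i]) : cmeas (fun _ : T => z).
Proof. by split; exact: measurable_cst. Qed.

Lemma cmeasD f g : cmeas f -> cmeas g -> cmeas (fun x => f x + g x).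
Proof.
move=> [f1 f2] [g1 g2]; split.
  by under eq_fun do rewrite ReD; exact: measurable_funD.
by under eq_fun do rewrite ImD; exact: measurable_funD.
Qed.

Lemma cmeasN f : cmeas f -> cmeas (fun x => - f x).
Proof.
move=> [f1 f2]; split.
  by under eq_fun do rewrite ReN; exact: measurable_funN.
by under eq_fun do rewrite ImN; exact: measurable_funN.
Qed.

Lemma cmeasB f g : cmeas f -> cmeas g -> cmeas (fun x => f x - g x).
Proof. by move=> mf mg; apply: cmeasD => //; exact: cmeasN. Qed.

Lemma cmeasM f g : cmeas f -> cmeas g -> cmeas (fun x => f x * g x).
Proof.
move=> [f1 f2] [g1 g2]; split.
  under eq_fun do rewrite ReM; apply: measurable_funB; exact: measurable_funM.
under eq_fun do rewrite ImM; apply: measurable_funD; exact: measurable_funM.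
Qed.

Lemma cmeas_conj f : cmeas f -> cmeas (fun x => conjc (f x)).
Proof.
move=> [f1 f2]; split; first by under eq_fun do rewrite Reconj.
by under eq_fun do rewrite Imconj; exact: measurable_funN.
Qed.

Lemma cmeas_real (h : T -> R) : measurable_fun setT h ->
  cmeas (fun x => (h x)%:C).
Proof. by move=> mh; split => //=; exact: measurable_cst. Qed.

Lemma cmeas_cis (h : T -> R) : measurable_fun setT h ->
  cmeas (fun x => cis (h x)).
Proof.
move=> mh; split => /=; apply: (measurableT_comp _ mh);
  apply: continuous_measurable_fun.
- exact: continuous_cos.
- exact: continuous_sin.
Qed.

Lemma measurable_nsq f : cmeas f -> measurable_fun setT (fun x => nsq (f x)).
Proof.
by move=> [f1 f2]; apply: measurable_funD; exact: measurable_funX.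
Qed.

Lemma measurable_sqrt : measurable_fun [set: R] (@Num.sqrt R).
Proof.
by apply: nondecreasing_measurable => // x y xy; exact: ler_wsqrtr.
Qed.

Lemma measurable_cmod f : cmeas f -> measurable_fun setT (fun x => cmod (f x)).
Proof.
by move=> mf; apply: (measurableT_comp measurable_sqrt); exact: measurable_nsq.
Qed.

Lemma cmeas_comp {d'} {T' : measurableType d'} (h : T' -> T) f :
  measurable_fun setT h -> cmeas f -> cmeas (fun x => f (h x)).
Proof.
by move=> mh [f1 f2]; split; [exact: (measurableT_comp f1 mh)|
  exact: (measurableT_comp f2 mh)].
Qed.

End complex_measurability.

Section complex_integral.
Context {d} {T : measurableType d} {R : realType}.
Variable mu : {measure set T -> \bar R}.
Implicit Types f g : T -> R[i].
Implicit Types h k : T -> R.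

Definition rintg h := mu.-integrable setT (EFin \o h).

Lemma rintg_meas h : rintg h -> measurable_fun setT h.
Proof. by move/measurable_int/measurable_EFinP. Qed.

Lemma rintg_le h k : measurable_fun setT h -> (forall x, `|h x| <= k x) ->
  rintg k -> rintg h.
Proof.
move=> mh hk ik; apply: (le_integrable _ _ _ ik) => //.
  exact/measurable_EFinP.
by move=> x _ /=; rewrite lee_fin (le_trans (hk x))// ler_norm.
Qed.

Lemma rintgD h k : rintg h -> rintg k -> rintg (fun x => h x + k x).
Proof. by move=> ih ik; exact: (integrableD _ ih ik). Qed.

Lemma rintgZ (c : R) h : rintg h -> rintg (fun x => c * h x).
Proof. by move=> ih; exact: (integrableZl _ c ih). Qed.

Lemma rintg_norm h : rintg h -> rintg (fun x => `|h x|).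
Proof. by move=> ih; exact: (integrable_norm ih). Qed.

Lemma rintg0 : rintg (fun=> 0).
Proof. exact: (integrable0 mu setT). Qed.

Lemma rintgP h : rintg h <->
  measurable_fun setT h /\ (\int[mu]_x (`|h x|)%:E < +oo)%E.
Proof.
split=> [/integrableP[mh h1]|[mh h1]].
  by split => //; exact/measurable_EFinP.
by apply/integrableP; split => //; exact/measurable_EFinP.
Qed.

Lemma rintg_fin h : rintg h -> (\int[mu]_x h x)%:E = (\int[mu]_x (h x)%:E)%E.
Proof. by move=> ih; rewrite /Rintegral fineK//; exact: (integrable_fin_num _ ih). Qed.

Lemma rintZ (c : R) h : rintg h ->
  \int[mu]_x (c * h x) = c * \int[mu]_x h x.
Proof. by move=> ih; rewrite RintegralZl. Qed.

Lemma rintD h k : rintg h -> rintg k ->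
  \int[mu]_x (h x + k x) = \int[mu]_x h x + \int[mu]_x k x.
Proof. by move=> ih ik; rewrite RintegralD. Qed.

Lemma cintg_meas f : cintg mu f -> cmeas f.
Proof. by move=> [f1 f2]; split; exact: rintg_meas. Qed.

Lemma cintg_cmod f : cintg mu f -> rintg (fun x => cmod (f x)).
Proof.
move=> [f1 f2].
apply: (@rintg_le _ (fun x => `|complex.Re (f x)| + `|complex.Im (f x)|)).
- by apply: measurable_cmod; exact: cintg_meas.
- by move=> x; rewrite ger0_norm ?cmod_ge0// cmod_le_ReIm.
- by apply: rintgD; exact: rintg_norm.
Qed.

Lemma cintg_le f k : cmeas f -> (forall x, cmod (f x) <= k x) -> rintg k ->
  cintg mu f.
Proof.
move=> [f1 f2] fk ik; split; apply: (@rintg_le _ k) => // x.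
  exact: le_trans (Re_le_cmod _) (fk x).
exact: le_trans (Im_le_cmod _) (fk x).
Qed.

Lemma eq_cint f g : f =1 g -> cint mu f = cint mu g.
Proof. by move=> /funext ->. Qed.

Lemma cint0 : cint mu (fun=> 0) = 0.
Proof.
by rewrite /cint /= /Rintegral integral0.
Qed.

Lemma cintgD f g : cintg mu f -> cintg mu g -> cintg mu (fun x => f x + g x).
Proof.
move=> [f1 f2] [g1 g2]; split.
  by under eq_fun do rewrite ReD; exact: rintgD.
by under eq_fun do rewrite ImD; exact: rintgD.
Qed.

Lemma cintD f g : cintg mu f -> cintg mu g ->
  cint mu (fun x => f x + g x) = cint mu f + cint mu g.
Proof.
move=> [f1 f2] [g1 g2]; apply: complexP; rewrite ?ReD ?ImD /=.
  by rewrite -RintegralD//; apply: eq_Rintegral => x _; rewrite ReD.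
by rewrite -RintegralD//; apply: eq_Rintegral => x _; rewrite ImD.
Qed.

Lemma cintgZ (c : R[i]) f : cintg mu f -> cintg mu (fun x => c * f x).
Proof.
move=> fi; have mf := cintg_meas fi.
apply: (@cintg_le _ (fun x => cmod c * cmod (f x))).
- by apply: cmeasM => //; exact: cmeas_cst.
- by move=> x; rewrite cmodM.
- by apply: rintgZ; exact: cintg_cmod.
Qed.

Lemma cintZ (c : R[i]) f : cintg mu f ->
  cint mu (fun x => c * f x) = c * cint mu f.
Proof.
move=> [f1 f2]; apply: complexP; rewrite ?ReM ?ImM /=.
  rewrite -RintegralZl// -RintegralZl// -RintegralB//; try exact: rintgZ.
  by apply: eq_Rintegral => x _; rewrite ReM.
rewrite -RintegralZl// -RintegralZl// -RintegralD//; try exact: rintgZ.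
by apply: eq_Rintegral => x _; rewrite ImM.
Qed.

Lemma cintgN f : cintg mu f -> cintg mu (fun x => - f x).
Proof.
by move=> fi; under eq_fun do rewrite -mulN1r; exact: cintgZ.
Qed.

Lemma cintN f : cintg mu f -> cint mu (fun x => - f x) = - cint mu f.
Proof.
move=> fi; rewrite -mulN1r -cintZ//.
by apply: eq_cint => x; rewrite mulN1r.
Qed.

Lemma cintgB f g : cintg mu f -> cintg mu g -> cintg mu (fun x => f x - g x).
Proof. by move=> fi gi; apply: cintgD => //; exact: cintgN. Qed.

Lemma cintB f g : cintg mu f -> cintg mu g ->
  cint mu (fun x => f x - g x) = cint mu f - cint mu g.
Proof. by move=> fi gi; rewrite cintD ?cintN//; exact: cintgN. Qed.

Lemma cintg_conj f : cintg mu f -> cintg mu (fun x => conjc (f x)).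
Proof.
move=> fi; apply: (@cintg_le _ (fun x => cmod (f x))).
- by apply: cmeas_conj; exact: cintg_meas.
- by move=> x; rewrite cmod_conj.
- exact: cintg_cmod.
Qed.

Lemma cint_conj f : cintg mu f ->
  cint mu (fun x => conjc (f x)) = conjc (cint mu f).
Proof.
move=> [f1 f2]; apply: complexP; rewrite ?Reconj ?Imconj /=.
  by apply: eq_Rintegral => x _; rewrite Reconj.
rewrite -mulN1r -RintegralZl//.
by apply: eq_Rintegral => x _; rewrite Imconj mulN1r.
Qed.

Lemma le_rint h k : rintg h -> rintg k -> (forall x, h x <= k x) ->
  \int[mu]_x h x <= \int[mu]_x k x.
Proof. by move=> ih ik hk; apply: le_Rintegral. Qed.

(** The real and imaginary parts are bounded separately, hence the factor 2. *)
Lemma cmod_cint f : cintg mu f ->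
  cmod (cint mu f) <= 2 * \int[mu]_x cmod (f x).
Proof.
move=> fi; have [f1 f2] := fi; have fc := cintg_cmod fi.
apply: (le_trans (cmod_le_ReIm _)) => /=.
rewrite mulr_natl mulr2n; apply: lerD.
  apply: (le_trans (le_normr_Rintegral _ _)) => //.
  by apply: le_rint => //; [exact: rintg_norm|move=> x; exact: Re_le_cmod].
apply: (le_trans (le_normr_Rintegral _ _)) => //.
by apply: le_rint => //; [exact: rintg_norm|move=> x; exact: Im_le_cmod].
Qed.

Lemma cintg_cisM (a : T -> R) f : measurable_fun setT a -> cintg mu f ->
  cintg mu (fun x => cis (a x) * f x).
Proof.
move=> ma fi; apply: (@cintg_le _ (fun x => cmod (f x))).
- by apply: cmeasM; [exact: cmeas_cis|exact: cintg_meas].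
- by move=> x; rewrite cmodM cmod_cis mul1r.
- exact: cintg_cmod.
Qed.

Lemma dominated_rint (h_ : nat -> T -> R) h k :
  (forall n, measurable_fun setT (h_ n)) -> rintg k ->
  (forall n x, `|h_ n x| <= k x) ->
  (forall x, h_ n x @[n --> \oo] --> h x) ->
  rintg h /\ \int[mu]_x h_ n x @[n --> \oo] --> \int[mu]_x h x.
Proof.
move=> mh ik hk hh.
have mhl : measurable_fun setT h by exact: (measurable_fun_cvg mh).
have [] := @dominated_convergence _ _ _ mu setT measurableT
  (fun n => EFin \o h_ n) (EFin \o h) (EFin \o k).
- by move=> n; exact/measurable_EFinP.
- exact/measurable_EFinP.
- by apply/aeW => x _; apply: cvg_EFin; [exact: nearW|exact: hh].
- exact: ik.
- by apply/aeW => x n _ /=; rewrite lee_fin.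
move=> ih _ hc; split => //.
rewrite /Rintegral; apply: fine_cvg; rewrite fineK//.
exact: (integrable_fin_num _ ih).
Qed.

End complex_integral.

(** * Fubini's theorem and reflections on the plane *)

Section complex_Fubini.
Context {d1} {d2} {T1 : measurableType d1} {T2 : measurableType d2}
  {R : realType}.
Variable m1 : {sigma_finite_measure set T1 -> \bar R}.
Variable m2 : {sigma_finite_measure set T2 -> \bar R}.

Lemma rFubini (h : T1 * T2 -> R) :
  (m1 \x m2)%E.-integrable setT (EFin \o h) ->
  (forall x, rintg m2 (fun y => h (x, y))) ->
  (forall y, rintg m1 (fun x => h (x, y))) ->
  rintg m1 (fun x => \int[m2]_y h (x, y)) /\
  \int[m1]_x \int[m2]_y h (x, y) = \int[m2]_y \int[m1]_x h (x, y).
Proof.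
move=> ih i1 i2; split.
  have := integrable_fubini_F ih; rewrite /rintg; congr integrable.
  by apply/funext => x; rewrite /fubini_F /= rintg_fin.
rewrite {1 3}/Rintegral.
under eq_integral do rewrite rintg_fin//.
under [in RHS]eq_integral do rewrite rintg_fin//.
by congr fine; exact: (Fubini ih).
Qed.

Lemma cFubini (k : T1 * T2 -> R[i]) : cmeas k ->
  (\int[m1]_x \int[m2]_y (cmod (k (x, y)))%:E < +oo)%E ->
  (forall x, cintg m2 (fun y => k (x, y))) ->
  (forall y, cintg m1 (fun x => k (x, y))) ->
  cintg m1 (fun x => cint m2 (fun y => k (x, y))) /\
  cint m1 (fun x => cint m2 (fun y => k (x, y))) =
  cint m2 (fun y => cint m1 (fun x => k (x, y))).
Proof.
move=> mk kfin i1 i2.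
have ic : (m1 \x m2)%E.-integrable setT (EFin \o (fun z => cmod (k z))).
  apply/integrable12ltyP; first exact/measurable_EFinP/measurable_cmod.
  under eq_integral => x _ do under eq_integral => y _ do
    rewrite /= ger0_norm ?cmod_ge0//.
  exact: kfin.
have [mk1 mk2] := mk.
have iR : (m1 \x m2)%E.-integrable setT (EFin \o (fun z => complex.Re (k z))).
  by apply: (rintg_le mk1 _ ic) => z; exact: Re_le_cmod.
have iI : (m1 \x m2)%E.-integrable setT (EFin \o (fun z => complex.Im (k z))).
  by apply: (rintg_le mk2 _ ic) => z; exact: Im_le_cmod.
have [R1 R2] := rFubini iR (fun x => (i1 x).1) (fun y => (i2 y).1).
have [I1 I2] := rFubini iI (fun x => (i1 x).2) (fun y => (i2 y).2).
by split; [split|apply: complexP].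
Qed.

End complex_Fubini.

Section plane_measure.
Context {R : realType}.

Lemma leb2_box (A B : set (measurableTypeR R)) : measurable A -> measurable B ->
  leb2 (A `*` B) = (lebesgue_measure A * lebesgue_measure B)%E.
Proof. exact: product_measure1E. Qed.

(** A name for [leb2] on which the sigma-finite structure asked for by
    Fubini's theorem can be declared. *)
Definition sleb2 : set (plane R) -> \bar R := @leb2 R.

Lemma sleb2_sigma_finite : sigma_finite setT sleb2.
Proof.
have /sigma_finiteP[F [TF ndF Foo]] :=
  @sigma_finiteT _ _ _ (@lebesgue_measure R).
exists (fun n => F n `*` F n).
  rewrite -setXTT TF predeqE => -[x y]; split.
    move=> [/= [n _ Fnx] [k _ Gky]]; exists (maxn n k) => //; split.
    - by move: x Fnx; exact/subsetPset/ndF/leq_maxl.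
    - by move: y Gky; exact/subsetPset/ndF/leq_maxr.
  by move=> [n _ []/= ? ?]; split; exists n.
move=> k; have [? ?] := Foo k.
split; first exact: measurableX.
by rewrite /sleb2 leb2_box// lte_mul_pinfty// ge0_fin_numE.
Qed.

HB.instance Definition _ := Measure.on sleb2.
HB.instance Definition _ :=
  @Measure_isSigmaFinite.Build _ (plane R) R sleb2 sleb2_sigma_finite.

Lemma leb2_Tonelli (k : plane R * plane R -> R) :
  measurable_fun setT k -> (forall z, 0 <= k z) ->
  (\int[leb2]_x \int[leb2]_y (k (x, y))%:E =
   \int[leb2]_y \int[leb2]_x (k (x, y))%:E)%E.
Proof.
move=> mk k0; apply: (@fubini_tonelli _ _ _ _ _ sleb2 sleb2 (EFin \o k)).
  exact/measurable_EFinP.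
by move=> z; rewrite lee_fin.
Qed.

Lemma leb2_Fubini (k : plane R * plane R -> R[i]) : cmeas k ->
  (\int[leb2]_x \int[leb2]_y (cmod (k (x, y)))%:E < +oo)%E ->
  (forall x, cintg leb2 (fun y => k (x, y))) ->
  (forall y, cintg leb2 (fun x => k (x, y))) ->
  cintg leb2 (fun x => cint leb2 (fun y => k (x, y))) /\
  cint leb2 (fun x => cint leb2 (fun y => k (x, y))) =
  cint leb2 (fun y => cint leb2 (fun x => k (x, y))).
Proof. exact: (@cFubini _ _ _ _ _ sleb2 sleb2). Qed.

Lemma measurable_pfst : measurable_fun setT (fun x : plane R => (x.1 : R)).
Proof. exact: measurable_fst. Qed.
Lemma measurable_psnd : measurable_fun setT (fun x : plane R => (x.2 : R)).
Proof. exact: measurable_snd. Qed.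

Lemma leb2_tensor (h1 h2 : R -> R) :
  measurable_fun setT h1 -> measurable_fun setT h2 ->
  (forall x, 0 <= h1 x) -> (forall x, 0 <= h2 x) ->
  (\int[leb2]_x (h1 x.1 * h2 x.2)%:E =
   (\int[lebesgue_measure]_x (h1 x)%:E) * (\int[lebesgue_measure]_x (h2 x)%:E))%E.
Proof.
move=> mh1 mh2 h10 h20.
rewrite [LHS](@fubini_tonelli1 _ _ (measurableTypeR R) (measurableTypeR R) _ lebesgue_measure lebesgue_measure
  (fun x => (h1 x.1 * h2 x.2)%:E)).
- rewrite /fubini_F /=.
  under eq_integral => x _.
    under eq_integral => y _ do rewrite EFinM.
    rewrite ge0_integralZl//; first over.
    + exact/measurable_EFinP.
    + by move=> y _; rewrite lee_fin.
    + by rewrite lee_fin.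
  rewrite ge0_integralZr//.
  + exact/measurable_EFinP.
  + by move=> x _; rewrite lee_fin.
  + by apply: integral_ge0 => x _; rewrite lee_fin.
- apply/measurable_EFinP; apply: measurable_funM.
    exact: (measurableT_comp mh1 measurable_pfst).
  exact: (measurableT_comp mh2 measurable_psnd).
- by move=> x; rewrite lee_fin mulr_ge0.
Qed.

(** The point reflection that exchanges 0 and [b]. Reflecting twice gives all
    translations, so that its invariance under [leb2] covers both changes of
    variables of a convolution. *)
Definition prefl (b x : plane R) : plane R := ((b.1 : R) - x.1, (b.2 : R) - x.2).

Lemma measurable_refl1 (b : R) :
  measurable_fun setT (fun x : measurableTypeR R => b - x : measurableTypeR R).
Proof. by apply: measurable_funB => //; exact: measurable_cst. Qed.

Lemma measurable_prefl b : measurable_fun setT (prefl b).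
Proof.
apply/measurable_fun_pairP; split.
  exact: (measurableT_comp (measurable_refl1 b.1) measurable_pfst).
exact: (measurableT_comp (measurable_refl1 b.2) measurable_psnd).
Qed.

(** Lebesgue measure is determined by the lengths of the half-open intervals,
    and the reflection of ]u, v] is an interval of the same length. *)
Lemma lebesgue_refl (b : R) (A : set (measurableTypeR R)) : measurable A ->
  lebesgue_measure ((fun x : R => b - x) @^-1` A) = lebesgue_measure A.
Proof.
move=> mA; have mm := measurable_refl1 b.
rewrite -[LHS]/(pushforward lebesgue_measure
  (fun x : measurableTypeR R => b - x : measurableTypeR R) A).
apply/esym/lebesgue_measure_unique => //= _ [[u v]] _ <-.
rewrite /pushforward (_ : _ @^-1` _ = `[b - v, b - u[%classic).
  rewrite !lebesgue_measure_itv/= !lte_fin ltrD2l ltrN2.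
  by case: ifP => // _; congr (_%:E); ring.
by apply/seteqP; split => x /=; rewrite !in_itv /=; lra.
Qed.

Lemma rint_refl1 (b : R) (h : R -> R) : rintg lebesgue_measure h ->
  rintg lebesgue_measure (fun x => h (b - x)) /\
  \int[lebesgue_measure]_x h (b - x) = \int[lebesgue_measure]_x h x.
Proof.
move=> ih; have mm := measurable_refl1 b.
have E (k : R -> \bar R) : (\int[lebesgue_measure]_x k x =
    \int[pushforward lebesgue_measure
      (fun x : measurableTypeR R => (b - x)%R : measurableTypeR R)]_x k x)%E.
  by apply: eq_measure_integral => A mA _; rewrite /= /pushforward lebesgue_refl.
have mh := rintg_meas ih.
have mn : measurable_fun setT (fun x => (`|h x|)%:E).
  by apply/measurable_EFinP; exact: measurableT_comp.
have i2 : rintg lebesgue_measure (fun x => h (b - x)).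
  apply/rintgP; split; first exact: (measurableT_comp mh mm).
  have /rintgP[_] := ih; rewrite E ge0_integral_pushforward//.
split => //; rewrite /Rintegral [in RHS]E.
by rewrite integral_pushforward//; exact/measurable_EFinP.
Qed.

(** A product measure is determined by its values on rectangles. *)
Lemma leb2_refl b (A : set (plane R)) : measurable A ->
  leb2 (prefl b @^-1` A) = leb2 A.
Proof.
move=> mA; have mm := measurable_prefl b.
rewrite -[LHS]/(pushforward leb2 (prefl b) A).
apply/esym/(@product_measure_unique _ _ (measurableTypeR R) (measurableTypeR R)
  R lebesgue_measure lebesgue_measure) => // U V mU mV.
rewrite [LHS](_ : _ = leb2
  (((fun x : R => (b.1 : R) - x) @^-1` U) `*`
   ((fun x : R => (b.2 : R) - x) @^-1` V)))//.
rewrite leb2_box ?lebesgue_refl//.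
  by rewrite -[X in measurable X]setTI; exact: measurable_refl1.
by rewrite -[X in measurable X]setTI; exact: measurable_refl1.
Qed.

Lemma integral_reflE b (h : plane R -> \bar R) :
  (\int[leb2]_x h x = \int[pushforward leb2 (prefl b)]_x h x)%E.
Proof.
have mm := measurable_prefl b.
by apply: eq_measure_integral => A mA _; rewrite /= /pushforward leb2_refl.
Qed.

Lemma integral_refl b (h : plane R -> R) : measurable_fun setT h ->
  (forall x, 0 <= h x) ->
  (\int[leb2]_x (h (prefl b x))%:E = \int[leb2]_x (h x)%:E)%E.
Proof.
move=> mh h0; have mm := measurable_prefl b.
rewrite [RHS](integral_reflE b).
rewrite ge0_integral_pushforward//; first exact/measurable_EFinP.
by move=> y _; rewrite lee_fin.
Qed.

Lemma rint_refl b (h : plane R -> R) : rintg leb2 h ->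
  rintg leb2 (fun x => h (prefl b x)) /\
  \int[leb2]_x (h (prefl b x)) = \int[leb2]_x (h x).
Proof.
move=> ih; have mm := measurable_prefl b.
have mh := rintg_meas ih.
have mn : measurable_fun setT (fun x => `|h x|) by exact: measurableT_comp.
have i2 : rintg leb2 (fun x => h (prefl b x)).
  apply/rintgP; split; first exact: measurableT_comp.
  rewrite (@integral_refl b (fun x => `|h x|))//.
  by have /rintgP[] := ih.
split => //; rewrite /Rintegral [in RHS](integral_reflE b).
by rewrite integral_pushforward//; exact/measurable_EFinP.
Qed.

Lemma cint_refl b (f : plane R -> R[i]) : cintg leb2 f ->
  cintg leb2 (fun x => f (prefl b x)) /\
  cint leb2 (fun x => f (prefl b x)) = cint leb2 f.
Proof.
move=> [/(rint_refl b)[f1 e1] /(rint_refl b)[f2 e2]].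
by split; [split|apply: complexP].
Qed.

End plane_measure.

(** * Square-integrable functions of the plane *)

Section square_integrable.
Context {R : realType}.
Implicit Types f g : plane R -> R[i].

(** [L2] and [L2norm] through the single integrand [nsq], which combines
    better with [ring] than two memberships and a square root. *)
Definition l2 f := cmeas f /\ rintg leb2 (fun x => nsq (f x)).

Definition sq f : R := \int[leb2]_x nsq (f x).

Lemma sq_ge0 f : 0 <= sq f.
Proof. by apply: Rintegral_ge0 => x _; exact: nsq_ge0. Qed.

Lemma l2_fin f : l2 f -> (\int[leb2]_x (nsq (f x))%:E = (sq f)%:E)%E.
Proof. by move=> [_ h]; rewrite /sq rintg_fin. Qed.

Lemma l2P f : l2 f <-> cmeas f /\ (\int[leb2]_x (nsq (f x))%:E < +oo)%E.
Proof.
split=> [h|[mf h]].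
  by split; [exact: h.1|rewrite l2_fin// ltry].
split => //; apply/rintgP; split; first exact: measurable_nsq.
by under eq_integral do rewrite ger0_norm ?nsq_ge0//.
Qed.

Lemma l2_le f (h : plane R -> R) : cmeas f -> (forall x, nsq (f x) <= h x) ->
  rintg leb2 h -> l2 f.
Proof.
move=> mf fh ih; split => //; apply: (rintg_le (measurable_nsq mf) _ ih).
by move=> x; rewrite ger0_norm ?nsq_ge0.
Qed.

Lemma Lfun2P (h : plane R -> R) : h \in Lfun leb2 2%:E <->
  measurable_fun setT h /\ rintg leb2 (fun x => h x ^+ 2).
Proof.
split=> [hl|[mh ih]].
  by split; [move: hl; rewrite inE => /andP[]; rewrite inE|
             exact: Lfun2_integrable_sqr].
rewrite inE; apply/andP; split; first by rewrite inE.
rewrite inE /= /finite_norm unlock poweR_lty//.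
have /rintgP[_ hfin] := ih.
rewrite (eq_integral (fun x => (`|h x ^+ 2|)%:E))// => x _ /=.
by rewrite powR_mulrn// normrX.
Qed.

Lemma L2P f : L2 f <-> l2 f.
Proof.
split=> [[/Lfun2P[m1 i1] /Lfun2P[m2 i2]]|[[m1 m2] i]].
  by split; [split|exact: rintgD].
split; apply/Lfun2P; split => //; apply: (rintg_le _ _ i).
- exact: measurable_funX.
- move=> x; rewrite ger0_norm ?sqr_ge0// /nsq.
  by have := sqr_ge0 (complex.Im (f x)); lra.
- exact: measurable_funX.
- move=> x; rewrite ger0_norm ?sqr_ge0// /nsq.
  by have := sqr_ge0 (complex.Re (f x)); lra.
Qed.

Lemma L2normE f : l2 f -> L2norm f = (Num.sqrt (sq f))%:E.
Proof.
move=> lf; rewrite /L2norm unlock.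
rewrite (eq_integral (fun x => (nsq (f x))%:E)).
  by rewrite l2_fin// poweR_EFin powR12_sqrt// sq_ge0.
move=> x _ /=.
by rewrite powR_mulrn// ger0_norm ?cmod_ge0// cmod_sqr.
Qed.

Lemma L2norm_cvg0 {I : Type} (F : set_system I) {FF : Filter F}
    (f_ : I -> plane R -> R[i]) : (forall i, l2 (f_ i)) ->
  (L2norm (f_ i) @[i --> F] --> 0%E) <-> (sq (f_ i) @[i --> F] --> (0 : R)).
Proof.
move=> lf; under eq_fun do rewrite L2normE//; split=> h.
  have h1 : Num.sqrt (sq (f_ i)) @[i --> F] --> (0 : R) by exact: (fine_cvg h).
  rewrite (_ : (fun i => sq (f_ i)) =
    (fun i => Num.sqrt (sq (f_ i)) * Num.sqrt (sq (f_ i)))); last first.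
    by apply/funext => i; rewrite -expr2 sqr_sqrtr ?sq_ge0.
  by rewrite -[X in _ --> X](mulr0 0); exact: cvgM.
apply: cvg_EFin; first exact: nearW.
rewrite /comp /= -[X in _ --> X](sqrtr0 R).
exact: (cvg_comp _ _ h (@sqrt_continuous R 0)).
Qed.

Lemma l2D f g : l2 f -> l2 g -> l2 (fun x => f x + g x).
Proof.
move=> [mf fi] [mg gi].
apply: (@l2_le _ (fun x => 2 * nsq (f x) + 2 * nsq (g x))).
- exact: cmeasD.
- by move=> x; exact: nsqD_le.
- by apply: rintgD; exact: rintgZ.
Qed.

Lemma l2N f : l2 f -> l2 (fun x => - f x).
Proof.
by move=> [mf fi]; split; [exact: cmeasN|under eq_fun do rewrite nsqN].
Qed.

Lemma l2B f g : l2 f -> l2 g -> l2 (fun x => f x - g x).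
Proof. by move=> lf lg; apply: l2D => //; exact: l2N. Qed.

Lemma l2_conj f : l2 f -> l2 (fun x => conjc (f x)).
Proof.
by move=> [mf fi]; split; [exact: cmeas_conj|under eq_fun do rewrite nsq_conj].
Qed.

Lemma l2M (m : plane R -> R[i]) (M : R) f : cmeas m ->
  (forall x, nsq (m x) <= M) -> l2 f -> l2 (fun x => m x * f x).
Proof.
move=> mm mM [mf fi]; apply: (@l2_le _ (fun x => M * nsq (f x))).
- exact: cmeasM.
- by move=> x; rewrite nsqM ler_wpM2r ?nsq_ge0.
- exact: rintgZ.
Qed.

Lemma l2Z (c : R[i]) f : l2 f -> l2 (fun x => c * f x).
Proof. by apply: (@l2M (fun=> c) (nsq c)) => //; exact: cmeas_cst. Qed.

Lemma l20 : l2 (fun=> 0).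
Proof.
split; first exact: cmeas_cst.
by under eq_fun do rewrite nsq0; exact: rintg0.
Qed.

Lemma sqN f : sq (fun x => - f x) = sq f.
Proof. by rewrite /sq; under eq_Rintegral do rewrite nsqN. Qed.

Lemma sq_conj f : sq (fun x => conjc (f x)) = sq f.
Proof. by rewrite /sq; under eq_Rintegral do rewrite nsq_conj. Qed.

Lemma sqZ (c : R[i]) f : l2 f -> sq (fun x => c * f x) = nsq c * sq f.
Proof.
by move=> [_ fi]; rewrite /sq; under eq_Rintegral do rewrite nsqM; rewrite RintegralZl.
Qed.

Lemma sq0 : sq (fun=> 0) = 0.
Proof. by rewrite /sq /Rintegral; under eq_integral do rewrite nsq0; rewrite integral0. Qed.

Lemma sqD_le f g : l2 f -> l2 g ->
  sq (fun x => f x + g x) <= 2 * sq f + 2 * sq g.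
Proof.
move=> lf lg; have [_ fi] := lf; have [_ gi] := lg; have [_ fgi] := l2D lf lg.
rewrite /sq -(rintZ 2 fi) -(rintZ 2 gi) -(rintD (rintgZ 2 fi) (rintgZ 2 gi)).
apply: le_rint => //; first by apply: rintgD; exact: rintgZ.
by move=> x; exact: nsqD_le.
Qed.

Lemma sqB_le f g : l2 f -> l2 g ->
  sq (fun x => f x - g x) <= 2 * sq f + 2 * sq g.
Proof. by move=> lf lg; rewrite -(sqN g); apply: sqD_le => //; exact: l2N. Qed.

(** Young's inequality integrated. The free parameter [k] replaces the square
    roots of the Cauchy-Schwarz inequality: optimising over it would give them
    back. *)
Lemma cintgM_l2 f g : l2 f -> l2 g -> cintg leb2 (fun x => f x * g x) /\
  forall k, 0 < k -> cmod (cint leb2 (fun x => f x * g x)) <=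
    k * sq f + k^-1 * sq g.
Proof.
move=> lf lg; have [mf fi] := lf; have [mg gi] := lg.
have key k : 0 < k -> rintg leb2 (fun x => (k * nsq (f x) + k^-1 * nsq (g x)) / 2).
  move=> k0; under eq_fun do rewrite mulrC.
  by apply: rintgZ; apply: rintgD; exact: rintgZ.
have ifg : cintg leb2 (fun x => f x * g x).
  apply: (cintg_le _ _ (key 1 ltr01)); first exact: cmeasM.
  by move=> x; rewrite cmodM; exact: cmodM_le.
split => // k k0; apply: (le_trans (cmod_cint ifg)).
rewrite /sq -(rintZ k fi) -(rintZ k^-1 gi).
rewrite -(rintD (rintgZ k fi) (rintgZ k^-1 gi)) -(rintZ 2 (cintg_cmod ifg)).
apply: le_rint.
- by apply: rintgZ; exact: cintg_cmod.
- by apply: rintgD; exact: rintgZ.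
- by move=> x; rewrite cmodM mulrC -ler_pdivlMr//; exact: cmodM_le.
Qed.

(** In [cintgM_l2] choose first [k] so large that the contribution of [g] is
    below [e / 2], and then [n] so that the other one is. *)
Lemma cint_cvg_l2 (F_ : nat -> plane R -> R[i]) f g :
  (forall n, l2 (F_ n)) -> l2 f -> l2 g ->
  sq (fun x => F_ n x - f x) @[n --> \oo] --> (0 : R) ->
  cmod (cint leb2 (fun x => F_ n x * g x) - cint leb2 (fun x => f x * g x))
    @[n --> \oo] --> (0 : R).
Proof.
move=> lF lf lg h.
apply/cvgrPdist_le => e e0.
have [k [k0 ke]] : exists k, 0 < k /\ k^-1 * sq g <= e / 2.
  exists (2 * (sq g + 1) / e); split.
    by rewrite divr_gt0// mulr_gt0// ltr_wpDl ?sq_ge0.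
  rewrite invf_div mulrAC ler_pdivrMr ?mulr_gt0 ?ltr_wpDl ?sq_ge0//.
  have -> : e / 2 * (2 * (sq g + 1)) = e * (sq g + 1) by field.
  by rewrite ler_pM2l// lerDl.
move/cvgrPdist_le : h => /(_ (e / 2 / k)) /(_ _)[|N _ hN].
  by rewrite !divr_gt0.
exists N => // n Nn; rewrite sub0r normrN ger0_norm ?cmod_ge0//.
have lFf : l2 (fun x => F_ n x - f x) by exact: l2B.
rewrite -cintB; [|exact: (cintgM_l2 (lF n) lg).1|exact: (cintgM_l2 lf lg).1].
rewrite (@eq_cint _ _ _ _ _ (fun x => (F_ n x - f x) * g x)); last first.
  by move=> x; rewrite mulrBl.
apply: (le_trans ((cintgM_l2 lFf lg).2 k k0)).
have := hN n Nn; rewrite sub0r normrN ger0_norm ?sq_ge0//.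
rewrite ler_pdivlMr// => h1; rewrite [e in leRHS]splitr lerD//.
by rewrite mulrC.
Qed.

Lemma cmod_lim_unique (z_ : nat -> R[i]) a b :
  cmod (z_ n - a) @[n --> \oo] --> (0 : R) ->
  cmod (z_ n - b) @[n --> \oo] --> (0 : R) -> a = b.
Proof.
move=> ha hb; apply/eqP; rewrite -subr_eq0; apply/eqP/nsq_eq0/eqP.
rewrite eq_le nsq_ge0 andbT.
have h : 2 * (cmod (z_ n - b) * cmod (z_ n - b)) +
    2 * (cmod (z_ n - a) * cmod (z_ n - a)) @[n --> \oo] --> (0 : R).
  have -> : (0 : R) = 2 * (0 * 0) + 2 * (0 * 0) by ring.
  by apply: cvgD; apply: cvgM; try exact: cvg_cst; exact: cvgM.
rewrite (_ : 0 = lim ((2 * (cmod (z_ n - b) * cmod (z_ n - b)) +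
    2 * (cmod (z_ n - a) * cmod (z_ n - a))) @[n --> \oo])).
  apply: limr_ge; first by apply/cvg_ex; exists 0.
  apply: nearW => n; rewrite -!expr2 !cmod_sqr.
  have -> : a - b = (z_ n - b) - (z_ n - a) by ring.
  exact: nsqB_le.
by apply/esym/cvg_lim.
Qed.

Lemma ae_sq f g : (f = g %[ae leb2]) -> cmeas f -> cmeas g -> sq f = sq g.
Proof.
move=> fg mf mg; rewrite /sq /Rintegral; congr fine.
apply: ae_eq_integral => //.
- by apply/measurable_EFinP; exact: measurable_nsq.
- by apply/measurable_EFinP; exact: measurable_nsq.
- by apply: filterS fg => x h _ /=; rewrite h.
Qed.

Lemma ae_sqB f g : l2 f -> l2 g -> (f = g %[ae leb2]) <->
  sq (fun x => f x - g x) = 0.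
Proof.
move=> lf lg; have lfg := l2B lf lg; split=> [fg|h].
  rewrite -sq0; apply: ae_sq; [|exact: lfg.1|exact: cmeas_cst].
  by apply: filterS fg => x h _; rewrite h// subrr.
have mfg : measurable_fun setT (fun x => (nsq (f x - g x))%:E).
  by apply/measurable_EFinP; apply: measurable_nsq; exact: lfg.1.
have /(ae_eq_integral_abs leb2 measurableT mfg) :
    (\int[leb2]_x `|(nsq (f x - g x))%:E| = 0)%E.
  under eq_integral do rewrite gee0_abs ?lee_fin ?nsq_ge0//.
  by rewrite l2_fin// h.
apply: filterS => x /(_ I) /= /eqP; rewrite eqe => /eqP /nsq_eq0 h0 _.
by apply/eqP; rewrite -subr_eq0; apply/eqP.
Qed.
End square_integrable.

(** * The Poisson kernel of the line *)

Section derivative_tools.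
Context {R : realType}.
Implicit Types (f g : R -> R) (x : R).

Lemma is_derive_fcomp f g x df dg : is_derive (g x) 1 f df ->
  is_derive x 1 g dg -> is_derive x 1 (fun y => f (g y)) (df * dg).
Proof. by move=> hf hg; exact: is_derive1_comp. Qed.

Lemma is_derive_lin (c : R) x : is_derive x 1 (fun y => c * y) c.
Proof.
have := @is_deriveZ _ _ _ id c x 1 1 (is_derive_id x 1).
by rewrite /GRing.scale /= mulr1.
Qed.

Lemma is_derive_fM f g x df dg : is_derive x 1 f df -> is_derive x 1 g dg ->
  is_derive x 1 (fun y => f y * g y) (f x * dg + g x * df).
Proof. by move=> hf hg; exact: is_deriveM. Qed.

Lemma is_derive_fD f g x df dg : is_derive x 1 f df -> is_derive x 1 g dg ->
  is_derive x 1 (fun y => f y + g y) (df + dg).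
Proof. by move=> hf hg; exact: is_deriveD. Qed.

Lemma is_derive_fZ (c : R) f x df : is_derive x 1 f df ->
  is_derive x 1 (fun y => c * f y) (c * df).
Proof. by move=> hf; exact: (is_deriveZ c hf). Qed.

Lemma is_derive_fN f x df : is_derive x 1 f df ->
  is_derive x 1 (fun y => - f y) (- df).
Proof.
move=> /(is_derive_fZ (-1)); rewrite mulN1r.
by under eq_fun do rewrite mulN1r.
Qed.

Lemma is_derive_congr f g x df dg : is_derive x 1 f df -> f =1 g -> df = dg ->
  is_derive x 1 g dg.
Proof. by move=> hf /funext <- <-. Qed.

Lemma is_derive_continuous f x df : is_derive x 1 f df -> {for x, continuous f}.
Proof. by move=> [h _]; apply/differentiable_continuous/derivable1_diffP. Qed.

End derivative_tools.

Section Poisson_kernel.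
Context {R : realType}.
Notation mu := (@lebesgue_measure R).
Implicit Types e x t : R.

(** The Abel regulariser of divergent integrals. It is chosen among all
    summability kernels because its transform, the Poisson kernel below, is a
    rational function with primitive [atan]. *)
Definition abel e t : R := expR (- (e * `|t|)).

Definition poisson e x : R := 2 * e / (e ^+ 2 + x ^+ 2).

Lemma abel_ge0 e t : 0 <= abel e t.
Proof. exact: expR_ge0. Qed.

Lemma abel_le1 e t : 0 <= e -> abel e t <= 1.
Proof. by move=> e0; rewrite /abel expR_le1 oppr_le0 mulr_ge0. Qed.

Lemma abel_continuous e : continuous (abel e).
Proof.
move=> t; rewrite /abel; under eq_fun do rewrite -mulNr.
apply: (cvg_comp (fun t => (- e) * `|t|) expR); last exact: continuous_expR.
by apply: cvgM; [exact: cvg_cst|exact: (@norm_continuous _ R^o t)].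
Qed.

Lemma abelN e t : abel e (- t) = abel e t.
Proof. by rewrite /abel normrN. Qed.

Lemma poisson_ge0 e x : 0 < e -> 0 <= poisson e x.
Proof.
by move=> e0; rewrite divr_ge0 ?mulr_ge0 ?(ltW e0)// addr_ge0 ?sqr_ge0.
Qed.

Lemma poisson_den e x : 0 < e -> 0 < e ^+ 2 + x ^+ 2.
Proof. by move=> e0; rewrite ltr_pwDl ?sqr_ge0// exprn_gt0. Qed.

Lemma poisson_continuous e : 0 < e -> continuous (poisson e).
Proof.
move=> e0 t; rewrite /continuous_at /poisson.
apply: cvgM; first exact: cvg_cst.
apply: (cvg_comp (fun x => e ^+ 2 + x ^+ 2) GRing.inv); last first.
  by apply: inv_continuous; rewrite gt_eqF ?poisson_den.
apply: cvgD; first exact: cvg_cst.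
exact: exprn_continuous.
Qed.

Lemma cvg_expRN_pinfty e : 0 < e -> expR (- (e * t)) @[t --> +oo] --> 0.
Proof.
move=> e0; have h : e * t @[t --> +oo] --> +oo.
  by under eq_fun do rewrite mulrC; apply: gt0_cvgMly.
exact: (cvg_comp _ _ h (@cvgr_expR R)).
Qed.

Let prim e x t : R :=
  expR (- (e * t)) *
   (- e^-1 + (e ^+ 2 + x ^+ 2)^-1 * (x * sin (x * t) + (- e) * cos (x * t))).

Let is_derive_prim e x t : 0 < e ->
  is_derive t 1 (prim e x) (expR (- (e * t)) * (1 + cos (x * t))).
Proof.
move=> e0; have en0 : e != 0 by rewrite gt_eqF.
have dn0 : e ^+ 2 + x ^+ 2 != 0 by rewrite gt_eqF ?poisson_den.
have h1 := is_derive_fcomp (is_derive_expR _) (is_derive_fN (is_derive_lin e t)).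
have h2 := is_derive_fcomp (is_derive_sin _) (is_derive_lin x t).
have h3 := is_derive_fcomp (is_derive_cos _) (is_derive_lin x t).
have h4 := is_derive_fZ (e ^+ 2 + x ^+ 2)^-1
  (is_derive_fD (is_derive_fZ x h2) (is_derive_fZ (- e) h3)).
have h5 := is_derive_fD (is_derive_cst (- e^-1) t 1) h4.
apply: (is_derive_congr (is_derive_fM h1 h5)) => //=.
field; rewrite ?en0 ?dn0 //=.
Qed.

Let prim_cvg e x : 0 < e -> prim e x t @[t --> +oo] --> 0.
Proof.
move=> e0.
pose K := `|- e^-1| + `|(e ^+ 2 + x ^+ 2)^-1| * (`|x| + `|- e|).
have hK t : `|prim e x t| <= expR (- (e * t)) * K.
  rewrite /prim normrM (ger0_norm (expR_ge0 _)) ler_wpM2l ?expR_ge0//.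
  rewrite (le_trans (ler_normD _ _))// lerD2l normrM ler_wpM2l//.
  rewrite (le_trans (ler_normD _ _))// !normrM lerD// ler_piMr//.
    by rewrite ler_norml sin_geN1 sin_le1.
  by rewrite ler_norml cos_geN1 cos_le1.
apply/norm_cvg0P; apply: (@squeeze_cvgr _ _ _ _ (fun=> 0) (fun t => expR (- (e * t)) * K)).
- by apply: nearW => t; rewrite normr_ge0 hK.
- exact: cvg_cst.
- by rewrite -[X in _ --> X](mul0r K); apply: cvgM; [exact: cvg_expRN_pinfty|exact: cvg_cst].
Qed.

(** The summand 1 makes the integrand nonnegative, so that the fundamental
    theorem on a half-line applies before integrability is known; it is
    removed afterwards by the case [x = 0]. *)
Lemma integral_abel1cos e x : 0 < e ->
  (\int[mu]_t (abel e t * (1 + cos (x * t)))%:E =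
   (2 / e + poisson e x)%:E)%E.
Proof.
move=> e0.
have cc : continuous (fun t => abel e t * (1 + cos (x * t))).
  move=> t; apply: cvgM; first exact: abel_continuous.
  apply: cvgD; first exact: cvg_cst.
  apply: (cvg_comp (fun t => x * t) cos _ (@continuous_cos R _)).
  by apply: cvgM; [exact: cvg_cst|exact: cvg_id].
have c0 t : 0 <= abel e t * (1 + cos (x * t)).
  by rewrite mulr_ge0 ?abel_ge0// -lerBlDl sub0r cos_geN1.
rewrite ge0_symfun_integralT//; last first.
  by move=> t /=; rewrite abelN mulrN cosN.
rewrite -set_itvcy (@ge0_continuous_FTC2y _ _ (prim e x) _ 0)//.
- rewrite sub0e -EFinN -EFinM /prim /poisson; congr (_%:E).
  rewrite !mulr0 oppr0 expR0 sin0 cos0 mul1r mulr0 add0r mulr1.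
  have en0 : e != 0 by rewrite gt_eqF.
  have dn0 : e ^+ 2 + x ^+ 2 != 0 by rewrite gt_eqF ?poisson_den.
  field; rewrite ?en0 ?dn0 //=.
- exact: continuous_subspaceT.
- exact: prim_cvg.
- apply: cvg_at_right_filter.
  exact: (is_derive_continuous (@is_derive_prim e x 0 e0)).
- move=> t; rewrite in_itv /= andbT => t0.
  rewrite derive1E (@derive_val _ _ _ _ _ _ _ (@is_derive_prim e x t e0)).
  by rewrite /abel gtr0_norm.
Qed.

Lemma integrable_abel e : 0 < e -> rintg mu (abel e).
Proof.
move=> e0; apply/rintgP; split.
  by apply: continuous_measurable_fun; exact: abel_continuous.
have h : (\int[mu]_t (abel e t * 2)%:E = (2 / e + poisson e 0)%:E)%E.
  rewrite -integral_abel1cos//; apply: eq_integral => t _.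
  by rewrite mul0r cos0.
apply: (@le_lt_trans _ _ ((2 / e + poisson e 0)%:E)); last exact: ltry.
rewrite -h; apply: ge0_le_integral => //.
- by apply/measurable_EFinP; apply: measurableT_comp => //;
    apply: continuous_measurable_fun; exact: abel_continuous.
- apply/measurable_EFinP; apply: measurable_funM; last exact: measurable_cst.
  by apply: continuous_measurable_fun; exact: abel_continuous.
- move=> t _; rewrite lee_fin ger0_norm ?abel_ge0//.
  by have := abel_ge0 e t; lra.
Qed.

Lemma rintg_abelM e (h : R -> R) : 0 < e -> measurable_fun setT h ->
  (forall t, `|h t| <= 1) -> rintg mu (fun t => abel e t * h t).
Proof.
move=> e0 mh h1; apply: (rintg_le _ _ (integrable_abel e0)).
  by apply: measurable_funM => //; exact: rintg_meas (integrable_abel e0).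
by move=> t; rewrite normrM ger0_norm ?abel_ge0// ler_piMr ?abel_ge0.
Qed.

Lemma measurable_cosl x : measurable_fun setT (fun t : R => cos (x * t)).
Proof.
by apply: continuous_measurable_fun => t;
  exact: (is_derive_continuous (is_derive_fcomp (is_derive_cos _) (is_derive_lin x t))).
Qed.

Lemma measurable_sinl x : measurable_fun setT (fun t : R => sin (x * t)).
Proof.
by apply: continuous_measurable_fun => t;
  exact: (is_derive_continuous (is_derive_fcomp (is_derive_sin _) (is_derive_lin x t))).
Qed.

Lemma rintg_abelcos e x : 0 < e -> rintg mu (fun t => abel e t * cos (x * t)).
Proof.
move=> e0; apply: rintg_abelM => //; first exact: measurable_cosl.
by move=> t; rewrite ler_norml cos_geN1 cos_le1.
Qed.

Lemma rintg_abelsin e x : 0 < e -> rintg mu (fun t => abel e t * sin (x * t)).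
Proof.
move=> e0; apply: rintg_abelM => //; first exact: measurable_sinl.
by move=> t; rewrite ler_norml sin_geN1 sin_le1.
Qed.

Let rint_abel1cos e x : 0 < e ->
  \int[mu]_t abel e t + \int[mu]_t (abel e t * cos (x * t)) =
  2 / e + poisson e x.
Proof.
move=> e0; rewrite -(rintD (integrable_abel e0) (@rintg_abelcos e x e0)).
apply: EFin_inj; rewrite -integral_abel1cos// rintg_fin; last first.
  by apply: rintgD; [exact: integrable_abel|exact: rintg_abelcos].
by apply: eq_integral => t _; rewrite mulrDr mulr1.
Qed.

Lemma rint_abel e : 0 < e -> \int[mu]_t abel e t = 2 / e.
Proof.
move=> e0; have en0 : e != 0 by rewrite gt_eqF.
have := @rint_abel1cos e 0 e0; under eq_Rintegral do rewrite -[abel e _]mulr1.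
under [X in _ + X]eq_Rintegral do rewrite mul0r cos0.
under eq_Rintegral do rewrite mulr1.
rewrite /poisson; set I := Rintegral _ _ _ => h.
apply: (@mulfI _ 2) => //; rewrite mulr_natl mulr2n h; field.
by rewrite en0.
Qed.

Lemma rint_abelcos e x : 0 < e ->
  \int[mu]_t (abel e t * cos (x * t)) = poisson e x.
Proof.
by move=> e0; have := @rint_abel1cos e x e0; rewrite rint_abel// => /addrI.
Qed.

Lemma rint_abelsin e x : 0 < e ->
  \int[mu]_t (abel e t * sin (x * t)) = 0.
Proof.
move=> e0; have [_] := rint_refl1 0 (@rintg_abelsin e x e0).
under eq_Rintegral do rewrite sub0r abelN mulrN sinN mulrN -mulN1r.
by rewrite rintZ; [lra|exact: rintg_abelsin].
Qed.

End Poisson_kernel.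

(** * The mass of the Poisson kernel *)

Section Poisson_mass.
Context {R : realType}.
Notation mu := (@lebesgue_measure R).
Implicit Types e x t a b : R.

Lemma measurable_poisson e x : 0 < e ->
  measurable_fun setT (fun y : R => poisson e (y - x)).
Proof.
move=> e0; apply: (measurableT_comp (f := poisson e)).
  by apply: continuous_measurable_fun; exact: poisson_continuous.
by apply: measurable_funB => //; exact: measurable_cst.
Qed.

Lemma is_derive_atan_poisson e x (y : R) : 0 < e ->
  is_derive y 1 (fun s => 2 * atan (e^-1 * (s + - x))) (poisson e (y - x)).
Proof.
move=> e0; have en0 : e != 0 by rewrite gt_eqF.
have hid : is_derive y (1 : R) id (1 : R) by exact: is_derive_id.
have h1 := is_derive_fD hid (is_derive_cst (- x) y 1).
have h2 := is_derive_fcomp (is_derive1_atan _) (is_derive_fZ e^-1 h1).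
apply: (is_derive_congr (is_derive_fZ 2 h2)) => //=.
have d1 : 1 + (e^-1 * (y - x)) ^+ 2 != 0 by rewrite gt_eqF// ltr_pwDl ?sqr_ge0.
have d2 : e ^+ 2 + (y - x) ^+ 2 != 0 by rewrite gt_eqF ?poisson_den.
rewrite /poisson.
have -> : 1 + (e^-1 * (y - x)) ^+ 2 = (e ^+ 2 + (y - x) ^+ 2) / e ^+ 2.
  by field.
by field; rewrite en0 d2.
Qed.

Lemma integral_poisson_itv e x a b : 0 < e -> a < b ->
  (\int[mu]_(y in `[a, b]) (poisson e (y - x))%:E =
   (2 * (atan ((b - x) / e) - atan ((a - x) / e)))%:E)%E.
Proof.
move=> e0 ab; have dF y := is_derive_atan_poisson x y e0.
have cF : continuous (fun y => 2 * atan (e^-1 * (y + - x))).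
  by move=> y; exact: (is_derive_continuous (dF y)).
rewrite (@continuous_FTC2 _ _ (fun y => 2 * atan (e^-1 * (y + - x))))//.
- by rewrite -EFinB (mulrC _ (b - x)) (mulrC _ (a - x)) mulrBr.
- apply: continuous_subspaceT => y.
  apply: (cvg_comp (fun y => y - x) (poisson e)).
    have hid : is_derive y (1 : R) id (1 : R) by exact: is_derive_id.
    exact: (is_derive_continuous (is_derive_fD hid (is_derive_cst (- x) y 1))).
  exact: poisson_continuous.
- split.
  + by move=> y _; have [] := dF y.
  + by apply: cvg_at_right_filter; exact: cF.
  + by apply: cvg_at_left_filter; exact: cF.
- by move=> y _; rewrite derive1E (@derive_val _ _ _ _ _ _ _ (dF y)).
Qed.

(** The Poisson integral of the indicator of ]a, b]. It is explicit, so that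
    its limit can be read off. *)
Definition poisson_box e a b x : R := 2 * (atan ((b - x) / e) - atan ((a - x) / e)).

Lemma poisson_box_le e a b x : `|poisson_box e a b x| <= 2 * pi.
Proof.
rewrite /poisson_box normrM ger0_norm// ler_pM2l// ler_norml.
have := @atan_gtNpi2 R ((b - x) / e); have := @atan_ltpi2 R ((b - x) / e).
have := @atan_gtNpi2 R ((a - x) / e); have := @atan_ltpi2 R ((a - x) / e).
by lra.
Qed.

Lemma poissonN e x : poisson e (- x) = poisson e x.
Proof. by rewrite /poisson sqrrN. Qed.

Lemma integral_poisson0 e : 0 < e ->
  (\int[mu]_y (poisson e y)%:E = (2 * pi)%:E)%E.
Proof.
move=> e0.
rewrite ge0_symfun_integralT; last 3 first.
- by move=> x; exact: poisson_ge0.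
- exact: poisson_continuous.
- by move=> x /=; rewrite poissonN.
have dF (y : R) : is_derive y 1 (fun y => 2 * atan (e^-1 * y)) (poisson e y).
  have := is_derive_atan_poisson 0 y e0; rewrite subr0.
  by under eq_fun do rewrite subr0.
rewrite -set_itvcy (@ge0_continuous_FTC2y _ _ (fun y => 2 * atan (e^-1 * y)) _ (2 * (pi / 2)))//.
- by rewrite mulr0 atan0 mulr0 sube0 -EFinM; congr (_%:E); field.
- by move=> y _; exact: poisson_ge0.
- by apply: continuous_subspaceT; exact: poisson_continuous.
- apply: cvgM; first exact: cvg_cst.
  have en : 0 < e^-1 by rewrite invr_gt0.
  have h : e^-1 * y @[y --> +oo] --> +oo.
    by under eq_fun do rewrite mulrC; apply: gt0_cvgMly.
  exact: (cvg_comp _ _ h (@cvgy_atan R)).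
- by apply: cvg_at_right_filter; exact: (is_derive_continuous (dF 0)).
- by move=> y _; rewrite derive1E (@derive_val _ _ _ _ _ _ _ (dF y)).
Qed.

Lemma rint_poisson e x : 0 < e ->
  rintg mu (fun y => poisson e (y - x)) /\
  \int[mu]_y poisson e (y - x) = 2 * pi.
Proof.
move=> e0.
have i0 : rintg mu (poisson e).
  apply/rintgP; split.
    by apply: continuous_measurable_fun; exact: poisson_continuous.
  under eq_integral do rewrite ger0_norm ?poisson_ge0//.
  by rewrite integral_poisson0// ltry.
have [i1 e1] := rint_refl1 x i0.
rewrite (_ : (fun y => poisson e (y - x)) = (fun y => poisson e (x - y))).
  by split => //; rewrite e1; apply: EFin_inj; rewrite rintg_fin// integral_poisson0.
by apply/funext => y; rewrite -poissonN opprB.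
Qed.

Lemma rint_poisson_box e a b x : 0 < e -> a < b ->
  rintg mu (fun y => \1_(`]a, b]) y * poisson e (y - x)) /\
  \int[mu]_y (\1_(`]a, b]) y * poisson e (y - x)) = poisson_box e a b x.
Proof.
move=> e0 ab; have [ip _] := rint_poisson x e0.
have ib : rintg mu (fun y => \1_(`]a, b]) y * poisson e (y - x)).
  apply: (rintg_le _ _ ip).
    by apply: measurable_funM; [exact: measurable_indic|exact: measurable_poisson].
  move=> y; rewrite normrM (ger0_norm (poisson_ge0 _ e0)) indicE.
  by case: (_ \in _); rewrite ?normr1 ?normr0 ?mul1r ?mul0r ?poisson_ge0.
split => //; apply: EFin_inj; rewrite rintg_fin// /poisson_box.
rewrite -integral_poisson_itv// -integral_itv_obnd_cbnd; last first.
  by apply/measurable_EFinP; apply: measurable_funTS; exact: measurable_poisson.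
rewrite [RHS]integral_mkcond; apply: eq_integral => y _.
by rewrite patchE indicE; case: (_ \in _); rewrite ?mul1r ?mul0r.
Qed.

Lemma poisson_box_cvg a b x :
  poisson_box n.+1%:R^-1 a b x @[n --> \oo] -->
  pi * (Num.sg (b - x) - Num.sg (a - x)).
Proof.
have pos (c : R) : 0 < c -> 2 * atan (c / n.+1%:R^-1) @[n --> \oo] --> (pi : R).
  move=> c0; have -> : (pi : R) = 2 * (pi / 2) by field.
  apply: cvgM; first exact: cvg_cst.
  have h : c / n.+1%:R^-1 @[n --> \oo] --> +oo.
    under eq_fun do rewrite invrK mulrC.
    have h1 : (n.+1%:R : R) @[n --> \oo] --> (+oo%R : set_system R).
      by rewrite (cvg_shiftS (fun n => n%:R : R)); exact: cvgr_idn.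
    have h2 : y * c @[y --> (+oo%R : set_system R)] --> (+oo%R : set_system R).
      by apply: gt0_cvgMly.
    exact: (cvg_comp _ _ h1 h2).
  exact: (cvg_comp _ _ h (@cvgy_atan R)).
have key (c : R) : 2 * atan (c / n.+1%:R^-1) @[n --> \oo] --> pi * Num.sg c.
  case: (sgrP c) => [->|c0|c0].
  - under eq_fun do rewrite mul0r atan0 mulr0.
    by rewrite mulr0; exact: cvg_cst.
  - by rewrite mulr1; exact: pos.
  - rewrite mulrN1 -mulN1r.
    rewrite (_ : (fun n => _) = (fun n : nat => -1 * (2 * atan (- c / n.+1%:R^-1)))).
      by apply: cvgM; [exact: cvg_cst|apply: pos; rewrite oppr_gt0].
    by apply/funext => n; rewrite [- c / _]mulNr atanN; ring.
rewrite /poisson_box; under eq_fun do rewrite mulrBr.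
by rewrite mulrBr; apply: cvgB; exact: key.
Qed.

Section tensor.
Implicit Types h : R -> R.

(** Every planar integral that has to be computed is of this form: kernels,
    boxes and the data are products of functions of one variable. *)
Lemma leb2_tensor_rint h1 h2 : rintg mu h1 -> rintg mu h2 ->
  rintg leb2 (fun x : plane R => h1 x.1 * h2 x.2) /\
  \int[leb2]_x (h1 x.1 * h2 x.2) = (\int[mu]_x h1 x) * (\int[mu]_x h2 x).
Proof.
move=> i1 i2.
have m1 := rintg_meas i1; have m2 := rintg_meas i2.
have ih : rintg leb2 (fun x : plane R => h1 x.1 * h2 x.2).
  apply/rintgP; split.
    apply: measurable_funM.
      exact: (measurableT_comp m1 measurable_pfst).
    exact: (measurableT_comp m2 measurable_psnd).
  under eq_integral do rewrite normrM.
  rewrite (@leb2_tensor _ (fun x => `|h1 x|) (fun x => `|h2 x|))//; last 2 first.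
  - exact: measurableT_comp.
  - exact: measurableT_comp.
  have /rintgP[_ f1] := i1; have /rintgP[_ f2] := i2.
  rewrite lte_mul_pinfty//; first by apply: integral_ge0 => x _; rewrite lee_fin.
  by rewrite ge0_fin_numE//; apply: integral_ge0 => x _; rewrite lee_fin.
split => //.
rewrite {1}/Rintegral.
rewrite -[X in fine X]/(\int[mu \x mu]_x (h1 x.1 * h2 x.2)%:E)%E.
rewrite -(@integral12_prod_meas1 _ _ (measurableTypeR R) (measurableTypeR R) R mu mu _ ih).
rewrite mulrC -rintZ//; congr fine; apply: eq_integral => x _.
by rewrite /fubini_F /= mulrC -rintZ// rintg_fin//; exact: rintgZ.
Qed.
End tensor.
End Poisson_mass.

(** * The Fourier integral *)

(** Tonelli gives the measurability for each of the positive and negative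
    parts; the real-valued integral is [fine] of their difference. *)
Lemma measurable_rint_section {d1 d2} {T1 : measurableType d1}
    {T2 : measurableType d2} {R : realType}
    (m2 : {sigma_finite_measure set T2 -> \bar R}) (h : T1 * T2 -> R) :
  measurable_fun setT h ->
  measurable_fun setT (fun x => \int[m2]_y h (x, y)).
Proof.
move=> mh; apply: (measurableT_comp (f := fine)) => //.
pose hE := fun z => (h z)%:E.
have mhE : measurable_fun setT hE by exact/measurable_EFinP.
rewrite (_ : (fun x => _) = (fun x => \int[m2]_y (hE^\+ (x, y)) -
    \int[m2]_y (hE^\- (x, y)))%E); last first.
  apply/funext => x; rewrite [LHS]integralE.
  by congr (_ - _)%E; apply: eq_integral => y _; rewrite ?funeposE ?funenegE.
apply: emeasurable_funB.
- apply: (@measurable_fun_fubini_tonelli_F _ _ _ _ _ m2 hE^\+%E).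
    exact: measurable_funepos.
  by move=> z; exact: funepos_ge0.
- apply: (@measurable_fun_fubini_tonelli_F _ _ _ _ _ m2 hE^\-%E).
    exact: measurable_funeneg.
  by move=> z; exact: funeneg_ge0.
Qed.

Section fourier1_basics.
Context {R : realType}.
Implicit Types (f g h : plane R -> R[i]) (x y xi : plane R).

Lemma cmeas_cint_section (k : plane R * plane R -> R[i]) : cmeas k ->
  cmeas (fun x => cint leb2 (fun y => k (x, y))).
Proof.
move=> [k1 k2]; split.
  exact: (@measurable_rint_section _ _ _ _ _ sleb2 _ k1).
exact: (@measurable_rint_section _ _ _ _ _ sleb2 _ k2).
Qed.

Lemma dotC x y : dot x y = dot y x.
Proof. by rewrite /dot mulrC [X in _ + X]mulrC. Qed.

Lemma cisD (a b : R) : cis (a + b) = cis a * cis b.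
Proof.
by apply: complexP; rewrite ?ReM ?ImM /= ?cosD ?sinD; ring.
Qed.

Lemma conj_cis (a : R) : conjc (cis a) = cis (- a).
Proof. by apply: complexP; rewrite /= ?cosN ?sinN. Qed.

Lemma cis0 : cis (0 : R) = 1.
Proof. by apply: complexP; rewrite /= ?cos0 ?sin0. Qed.

Lemma measurable_dot {d} {T : measurableType d} (u v : T -> plane R) :
  measurable_fun setT u -> measurable_fun setT v ->
  measurable_fun setT (fun t => dot (u t) (v t)).
Proof.
move=> mu mv; apply: measurable_funD; apply: measurable_funM.
- exact: (measurableT_comp measurable_pfst mu).
- exact: (measurableT_comp measurable_pfst mv).
- exact: (measurableT_comp measurable_psnd mu).
- exact: (measurableT_comp measurable_psnd mv).
Qed.

Lemma measurable_dotl x : measurable_fun setT (fun y => dot x y).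
Proof. by apply: measurable_dot; [exact: measurable_cst|exact: measurable_id]. Qed.

Lemma cintg_fourier f xi : cintg leb2 f ->
  cintg leb2 (fun x => cis (- dot x xi) * f x).
Proof.
move=> fi; apply: cintg_cisM => //; apply: measurable_funN.
by apply: measurable_dot; [exact: measurable_id|exact: measurable_cst].
Qed.

Lemma cmod_fourier1 f xi : cintg leb2 f ->
  cmod (fourier1 f xi) <= 2 * \int[leb2]_x cmod (f x).
Proof.
move=> fi; apply: (le_trans (cmod_cint (cintg_fourier xi fi))).
rewrite ler_pM2l// le_eqVlt; apply/orP; left; apply/eqP.
by apply: eq_Rintegral => x _; rewrite cmodM cmod_cis mul1r.
Qed.

Lemma cmeas_ker f : cmeas f ->
  cmeas (fun z : plane R * plane R => cis (- dot z.2 z.1) * f z.2).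
Proof.
move=> mf; apply: cmeasM.
  apply: cmeas_cis; apply: measurable_funN.
  by apply: measurable_dot; [exact: measurable_snd|exact: measurable_fst].
by apply: cmeas_comp => //; exact: measurable_snd.
Qed.

Lemma cmeas_fourier1 f : cmeas f -> cmeas (fourier1 f).
Proof. by move=> mf; exact: (cmeas_cint_section (cmeas_ker mf)). Qed.

(** Fubini's theorem for the kernel [cis (- dot x xi)], which is symmetric in
    its two arguments. Bessel's inequality, Parseval's identity and duality
    are all instances or limits of this formula. *)
Lemma multiplication_formula f h : cintg leb2 f -> cintg leb2 h ->
  cint leb2 (fun xi => fourier1 f xi * h xi) =
  cint leb2 (fun x => f x * fourier1 h x).
Proof.
move=> fi hi; have mf := cintg_meas fi; have mh := cintg_meas hi.
pose k := fun z : plane R * plane R => (cis (- dot z.2 z.1) * f z.2) * h z.1.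
have mk : cmeas k.
  apply: cmeasM; first exact: cmeas_ker.
  by apply: cmeas_comp => //; exact: measurable_fst.
have ck (z : plane R * plane R) : cmod (k z) = cmod (h z.1) * cmod (f z.2).
  by rewrite /k !cmodM cmod_cis mul1r mulrC.
have i1 xi : cintg leb2 (fun x => k (xi, x)).
  by rewrite /k /=; under eq_fun do rewrite mulrC; apply: cintgZ; exact: cintg_fourier.
have i2 x : cintg leb2 (fun xi => k (xi, x)).
  rewrite /k /=; under eq_fun do rewrite -mulrA mulrCA dotC.
  by apply: cintgZ; exact: cintg_fourier.
have fin : (\int[leb2]_xi \int[leb2]_x (cmod (k (xi, x)))%:E < +oo)%E.
  have /rintgP[mcf fcf] := cintg_cmod fi; have /rintgP[mch fch] := cintg_cmod hi.
  under eq_integral => xi _.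
    under eq_integral => x _ do rewrite ck /= EFinM.
    rewrite ge0_integralZl//; first over.
    + exact/measurable_EFinP.
    + by move=> x _; rewrite lee_fin cmod_ge0.
    + by rewrite lee_fin cmod_ge0.
  rewrite ge0_integralZr//; last 3 first.
  - exact/measurable_EFinP.
  - by move=> x _; rewrite lee_fin cmod_ge0.
  - by apply: integral_ge0 => x _; rewrite lee_fin cmod_ge0.
  under eq_integral do rewrite -[cmod _]ger0_norm ?cmod_ge0//.
  under [X in (_ * X)%E]eq_integral do rewrite -[cmod _]ger0_norm ?cmod_ge0//.
  rewrite lte_mul_pinfty//; first by apply: integral_ge0 => x _; rewrite lee_fin.
  by rewrite ge0_fin_numE//; apply: integral_ge0 => x _; rewrite lee_fin.
have [_ E] := leb2_Fubini mk fin i1 i2.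
rewrite (_ : cint leb2 (fun xi => fourier1 f xi * h xi) =
  cint leb2 (fun xi => cint leb2 (fun x => k (xi, x)))); last first.
  apply: eq_cint => xi; rewrite mulrC -cintZ; last exact: cintg_fourier.
  by apply: eq_cint => x; rewrite /k /= mulrC.
rewrite E; apply: eq_cint => x.
rewrite -[X in _ = _ * X]/(cint leb2 (fun y => cis (- dot y x) * h y)).
rewrite -cintZ; last exact: cintg_fourier.
by apply: eq_cint => xi; rewrite /k /= dotC; ring.
Qed.

Definition abel2 (e : R) (x : plane R) : R := abel e x.1 * abel e x.2.
Definition poisson2 (e : R) (x : plane R) : R := poisson e x.1 * poisson e x.2.

Lemma rintg_abel2 e : 0 < e -> rintg leb2 (abel2 e).
Proof.
by move=> e0; have [] := leb2_tensor_rint (integrable_abel e0) (integrable_abel e0).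
Qed.

Lemma abel2_ge0 e x : 0 <= abel2 e x.
Proof. by rewrite mulr_ge0 ?abel_ge0. Qed.

Lemma abel2_le1 e x : 0 <= e -> abel2 e x <= 1.
Proof. by move=> e0; rewrite mulr_ile1 ?abel_ge0 ?abel_le1. Qed.

Lemma cintg_abel2 e : 0 < e -> cintg leb2 (fun x => (abel2 e x)%:C).
Proof.
move=> e0; apply: (cintg_le _ _ (rintg_abel2 e0)).
  by apply: cmeas_real; exact: rintg_meas (rintg_abel2 e0).
by move=> x; rewrite cmod_real ger0_norm ?abel2_ge0.
Qed.

Lemma cintg_abel2M (u : plane R -> R[i]) (M e : R) : 0 < e -> cmeas u ->
  (forall xi, cmod (u xi) <= M) -> cintg leb2 (fun xi => u xi * (abel2 e xi)%:C).
Proof.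
move=> e0 mu uM; apply: (cintg_le _ _ (rintgZ M (rintg_abel2 e0))).
  by apply: cmeasM => //; apply: cmeas_real; exact: rintg_meas (rintg_abel2 e0).
move=> xi; rewrite cmodM cmod_real ger0_norm ?abel2_ge0//.
by rewrite ler_wpM2r ?abel2_ge0.
Qed.

Lemma cint_abel2 e x : 0 < e ->
  cint leb2 (fun xi => cis (dot x xi) * (abel2 e xi)%:C) = (poisson2 e x)%:C.
Proof.
move=> e0.
have cc := leb2_tensor_rint (@rintg_abelcos R e x.1 e0) (@rintg_abelcos R e x.2 e0).
have ss := leb2_tensor_rint (@rintg_abelsin R e x.1 e0) (@rintg_abelsin R e x.2 e0).
have cs := leb2_tensor_rint (@rintg_abelcos R e x.1 e0) (@rintg_abelsin R e x.2 e0).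
have sc := leb2_tensor_rint (@rintg_abelsin R e x.1 e0) (@rintg_abelcos R e x.2 e0).
apply: complexP => /=.
  transitivity (\int[leb2]_xi
    ((abel e xi.1 * cos (x.1 * xi.1)) * (abel e xi.2 * cos (x.2 * xi.2)) +
     - 1 * ((abel e xi.1 * sin (x.1 * xi.1)) * (abel e xi.2 * sin (x.2 * xi.2))))).
    by apply: eq_Rintegral => xi _; rewrite /dot cosD /abel2; ring.
  rewrite (rintD cc.1 (rintgZ (-1) ss.1)) (rintZ (-1) ss.1) cc.2 ss.2.
  by rewrite !rint_abelcos// !rint_abelsin// /poisson2; ring.
transitivity (\int[leb2]_xi
    ((abel e xi.1 * cos (x.1 * xi.1)) * (abel e xi.2 * sin (x.2 * xi.2)) +
     (abel e xi.1 * sin (x.1 * xi.1)) * (abel e xi.2 * cos (x.2 * xi.2)))).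
  by apply: eq_Rintegral => xi _; rewrite /dot sinD /abel2; ring.
rewrite (rintD cs.1 sc.1) cs.2 sc.2.
by rewrite !rint_abelsin//; ring.
Qed.

(** The Abel means of the inverse transform are Poisson integrals: the
    multiplication formula moves the transform onto the Abel factor, where it
    is explicit. *)
Lemma abel_mean f e x : cintg leb2 f -> 0 < e ->
  cint leb2 (fun xi => fourier1 f xi * (cis (dot x xi) * (abel2 e xi)%:C)) =
  cint leb2 (fun y => f y * (poisson2 e (prefl x y))%:C).
Proof.
move=> fi e0; rewrite multiplication_formula//; last first.
  apply: cintg_cisM; last exact: cintg_abel2.
  exact: measurable_dotl.
apply: eq_cint => y; congr (_ * _); rewrite -cint_abel2//.
apply: eq_cint => xi; rewrite mulrA -cisD; congr (cis _ * _).
by rewrite /dot /prefl /=; ring.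
Qed.

End fourier1_basics.

(** * Bessel's inequality *)

Lemma fatou_le {d} {T : measurableType d} {R : realType}
    (mu : {measure set T -> \bar R}) (h_ : nat -> T -> R) (h : T -> R) (M : R) :
  (forall n, measurable_fun setT (h_ n)) -> (forall n x, 0 <= h_ n x) ->
  (forall x, h_ n x @[n --> \oo] --> h x) ->
  (forall n, (\int[mu]_x (h_ n x)%:E <= M%:E)%E) ->
  (\int[mu]_x (h x)%:E <= M%:E)%E.
Proof.
move=> mh h0 hc hM.
have mhE n : measurable_fun setT (fun x => (h_ n x)%:E) by exact/measurable_EFinP.
have hE0 n x : setT x -> (0 <= (h_ n x)%:E)%E by move=> _; rewrite lee_fin.
have := fatou mu measurableT mhE hE0.
rewrite (_ : (\int[mu]_x limn_einf _ = \int[mu]_x (h x)%:E)%E); last first.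
  apply: eq_integral => x _.
  have hx : (h_ n x)%:E @[n --> \oo] --> (h x)%:E.
    by apply: cvg_EFin; [exact: nearW|exact: hc].
  by rewrite (cvg_limn_einf_sup hx).1.
move=> /le_trans; apply; rewrite limn_einf_lim.
apply: lime_le; first exact: is_cvg_einfs.
apply: nearW => n; apply: le_trans (hM n).
by apply: ereal_inf_lbound; exists n => /=.
Qed.

Section conjugation.
Context {R : realType}.
Implicit Types z w : R[i].

Lemma conjM z w : conjc (z * w) = conjc z * conjc w.
Proof. by apply: complexP; rewrite ?Reconj ?Imconj ?ReM ?ImM ?Reconj ?Imconj; ring. Qed.
Lemma conjK z : conjc (conjc z) = z.
Proof. by apply: complexP; rewrite !(Reconj, Imconj) ?opprK. Qed.
Lemma conj_real (a : R) : conjc a%:C = a%:C :> R[i].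
Proof. by apply: complexP; rewrite /= ?oppr0. Qed.

End conjugation.

Section Bessel.
Context {R : realType}.
Implicit Types (f : plane R -> R[i]) (x y xi : plane R).

Lemma leb2_Tonelli_rint (k : plane R * plane R -> R) :
  measurable_fun setT k -> (forall z, 0 <= k z) ->
  (forall x, rintg leb2 (fun y => k (x, y))) ->
  (forall y, rintg leb2 (fun x => k (x, y))) ->
  rintg leb2 (fun y => \int[leb2]_x k (x, y)) ->
  rintg leb2 (fun x => \int[leb2]_y k (x, y)) /\
  \int[leb2]_x \int[leb2]_y k (x, y) = \int[leb2]_y \int[leb2]_x k (x, y).
Proof.
move=> mk k0 i1 i2 i21.
have T := leb2_Tonelli mk k0.
have E1 x : ((\int[leb2]_y k (x, y))%:E = \int[leb2]_y (k (x, y))%:E)%E.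
  exact: rintg_fin.
have E2 y : ((\int[leb2]_x k (x, y))%:E = \int[leb2]_x (k (x, y))%:E)%E.
  exact: rintg_fin.
have Eq : (\int[leb2]_x (\int[leb2]_y k (x, y))%:E =
           \int[leb2]_y (\int[leb2]_x k (x, y))%:E)%E.
  rewrite (eq_integral _ _ (fun x _ => E1 x)).
  by rewrite [RHS](eq_integral _ _ (fun x _ => E2 x)).
split; last by rewrite {1 3}/Rintegral Eq.
apply/rintgP; split.
  exact: (@measurable_rint_section _ _ _ _ _ sleb2 _ mk).
under eq_integral do rewrite ger0_norm ?Rintegral_ge0//.
rewrite Eq; have /rintgP[_] := i21.
by under eq_integral do rewrite ger0_norm ?Rintegral_ge0//.
Qed.

(** The constant of Plancherel's theorem in dimension 2. *)
Definition c2pi : R := (2 * pi) ^+ 2.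

Lemma c2pi_gt0 : 0 < c2pi.
Proof. by rewrite exprn_gt0// mulr_gt0// pi_gt0. Qed.

Lemma poisson2_ge0 e x : 0 < e -> 0 <= poisson2 e x.
Proof. by move=> e0; rewrite mulr_ge0 ?poisson_ge0. Qed.

Lemma rint_poisson2l e (y : plane R) : 0 < e ->
  rintg leb2 (fun x => poisson2 e (prefl x y)) /\
  \int[leb2]_x poisson2 e (prefl x y) = c2pi.
Proof.
move=> e0; have [i1 e1] := rint_poisson y.1 e0; have [i2 e2] := rint_poisson y.2 e0.
by have [] := leb2_tensor_rint i1 i2; rewrite e1 e2 -expr2.
Qed.

Lemma poisson2C e x y : poisson2 e (prefl x y) = poisson2 e (prefl y x).
Proof. by rewrite /poisson2 /prefl /= -poissonN opprB -[in X in _ * X]poissonN opprB. Qed.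

Lemma rint_poisson2r e (x : plane R) : 0 < e ->
  rintg leb2 (fun y => poisson2 e (prefl x y)) /\
  \int[leb2]_y poisson2 e (prefl x y) = c2pi.
Proof.
move=> e0; have := rint_poisson2l x e0.
rewrite (_ : (fun y => poisson2 e (prefl x y)) = (fun y => poisson2 e (prefl y x)))//.
by apply/funext => y; exact: poisson2C.
Qed.

Lemma poisson_le e (t : R) : 0 < e -> poisson e t <= 2 / e.
Proof.
move=> e0; rewrite /poisson ler_pdivrMr ?poisson_den//.
rewrite (_ : 2 / e * (e ^+ 2 + t ^+ 2) = 2 * e + 2 / e * t ^+ 2); last first.
  by field; rewrite gt_eqF.
by rewrite lerDl mulr_ge0 ?sqr_ge0// divr_ge0// ltW.
Qed.

Lemma poisson2_le e x : 0 < e -> poisson2 e x <= (2 / e) * (2 / e).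
Proof. by move=> e0; apply: ler_pM; rewrite ?poisson_ge0 ?poisson_le. Qed.

Lemma measurable_poisson2 e : 0 < e ->
  measurable_fun setT (fun z : plane R * plane R => poisson2 e (prefl z.1 z.2)).
Proof.
move=> e0; have mp : measurable_fun setT (poisson e : R -> R).
  by apply: continuous_measurable_fun; exact: poisson_continuous.
apply: measurable_funM; apply: (measurableT_comp mp); apply: measurable_funB.
- exact: (measurableT_comp measurable_pfst measurable_fst).
- exact: (measurableT_comp measurable_pfst measurable_snd).
- exact: (measurableT_comp measurable_psnd measurable_fst).
- exact: (measurableT_comp measurable_psnd measurable_snd).
Qed.

Lemma rintg_poisson2M e x (h : plane R -> R) : 0 < e -> rintg leb2 h ->
  rintg leb2 (fun y => poisson2 e (prefl x y) * h y).
Proof.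
move=> e0 ih; apply: (rintg_le _ _ (rintgZ ((2 / e) * (2 / e)) (rintg_norm ih))).
  apply: measurable_funM; last exact: rintg_meas ih.
  exact: rintg_meas (rint_poisson2r x e0).1.
move=> y; rewrite normrM ger0_norm ?poisson2_ge0//.
by rewrite ler_wpM2r// poisson2_le.
Qed.

(** The left side is the pairing of [f] with its own Poisson integral
    (multiplication formula). Bounding the product of two values of [f] by the
    half sum of their squares and integrating out one variable of the kernel,
    whose mass is [c2pi], gives the right side. *)
Lemma bessel_abel f e : cintg leb2 f -> l2 f -> 0 < e ->
  rintg leb2 (fun xi => abel2 e xi * nsq (fourier1 f xi)) /\
  \int[leb2]_xi (abel2 e xi * nsq (fourier1 f xi)) <= c2pi * sq f.
Proof.
move=> fi lf e0; have [mf nfi] := lf.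
have mT := cmeas_fourier1 mf.
pose M := 2 * \int[leb2]_x cmod (f x).
have TM xi : cmod (fourier1 f xi) <= M by exact: cmod_fourier1.
have M0 : 0 <= M by exact: le_trans (cmod_ge0 _) (TM (0, 0)).
pose h xi := conjc (fourier1 f xi) * (abel2 e xi)%:C.
have hi : cintg leb2 h.
  apply: (@cintg_abel2M R _ M e e0 (cmeas_conj mT)) => xi.
  by rewrite cmod_conj.
have inf : rintg leb2 (fun xi => abel2 e xi * nsq (fourier1 f xi)).
  apply: (rintg_le _ _ (rintgZ (M ^+ 2) (rintg_abel2 e0))).
    apply: measurable_funM; last exact: measurable_nsq.
    exact: rintg_meas (rintg_abel2 e0).
  move=> xi; rewrite ger0_norm; last first.
    by apply: mulr_ge0; [exact: abel2_ge0|exact: nsq_ge0].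
  by rewrite mulrC ler_wpM2r ?abel2_ge0// cmod_ge.
split => //.
pose A x := cint leb2 (fun y => f y * (poisson2 e (prefl x y))%:C).
have Th x : fourier1 h x = conjc (A x).
  rewrite /A -abel_mean// -cint_conj; last first.
    under eq_fun do rewrite mulrCA; apply: (cintg_cisM (measurable_dotl x)).
    exact: (cintg_abel2M e0 mT TM).
  apply: eq_cint => xi; rewrite /h !conjM conj_cis conj_real dotC.
  ring.
have Hi : cintg leb2 (fun xi => fourier1 f xi * h xi).
  apply: (cintg_le _ _ (rintgZ M (cintg_cmod hi))).
    by apply: cmeasM => //; exact: cintg_meas hi.
  by move=> xi; rewrite cmodM ler_wpM2r ?cmod_ge0.
have E1 : \int[leb2]_xi (abel2 e xi * nsq (fourier1 f xi)) =
    complex.Re (cint leb2 (fun x => f x * fourier1 h x)).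
  rewrite -multiplication_formula//; apply: eq_Rintegral => xi _.
  by rewrite /h; move: (fourier1 f xi) => [a b] /=; rewrite /nsq /=; ring.
rewrite E1 /=.
pose P x y := poisson2 e (prefl x y).
pose g x := \int[leb2]_y (P x y * nsq (f y)).
have [ig Eg] : rintg leb2 g /\ \int[leb2]_x g x = c2pi * sq f.
  pose k z : R := poisson2 e (prefl z.1 z.2) * nsq (f z.2).
  have k2 y : rintg leb2 (fun x => k (x, y)).
    by rewrite /k /=; under eq_fun do rewrite mulrC; apply: rintgZ;
       exact: (rint_poisson2l y e0).1.
  have k21 y : \int[leb2]_x k (x, y) = c2pi * nsq (f y).
    rewrite /k /=; under eq_Rintegral do rewrite mulrC.
    by rewrite rintZ ?(rint_poisson2l y e0).2 1?mulrC//; exact: (rint_poisson2l y e0).1.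
  have [] := @leb2_Tonelli_rint k.
  - apply: measurable_funM; first exact: measurable_poisson2.
    by apply: (measurableT_comp (measurable_nsq mf)); exact: measurable_snd.
  - by move=> z; apply: mulr_ge0; [exact: poisson2_ge0|exact: nsq_ge0].
  - by move=> x; exact: rintg_poisson2M.
  - exact: k2.
  - by under eq_fun do rewrite k21; exact: rintgZ.
  move=> ig ->; split => //.
  by under eq_Rintegral do rewrite k21; rewrite rintZ.
have iA x : cintg leb2 (fun y => f y * (P x y)%:C).
  apply: (cintg_le _ _ (rintg_poisson2M x e0 (cintg_cmod fi))).
    apply: cmeasM => //; apply: cmeas_real.
    exact: rintg_meas (rint_poisson2r x e0).1.
  by move=> y; rewrite cmodM cmod_real ger0_norm ?poisson2_ge0// mulrC.
have key x : complex.Re (f x * fourier1 h x) <=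
    2^-1 * (c2pi * nsq (f x)) + 2^-1 * g x.
  rewrite Th -(cint_conj (iA x)) -(cintZ (f x) (cintg_conj (iA x))).
  have [iP eP] := rint_poisson2r x e0.
  rewrite -eP /g [_ * nsq (f x)]mulrC -(rintZ (nsq (f x)) iP).
  have i1 := rintgZ (nsq (f x)) iP.
  have i2 := rintg_poisson2M x e0 nfi.
  rewrite -(rintZ 2^-1 i1) -(rintZ 2^-1 i2).
  rewrite -(rintD (rintgZ 2^-1 i1) (rintgZ 2^-1 i2)) /=.
  apply: le_rint.
  - by have [] := cintgZ (f x) (cintg_conj (iA x)).
  - by apply: rintgD; exact: rintgZ.
  move=> y; rewrite -/(P x y).
  have Pg : 0 <= P x y by exact: poisson2_ge0.
  rewrite (_ : complex.Re _ = P x y *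
     (complex.Re (f x) * complex.Re (f y) + complex.Im (f x) * complex.Im (f y))); last first.
    by case: (f x) => a b; case: (f y) => c d /=; ring.
  have -> : 2^-1 * (nsq (f x) * P x y) + 2^-1 * (P x y * nsq (f y)) =
     P x y * (2^-1 * nsq (f x) + 2^-1 * nsq (f y)) by ring.
  apply: ler_wpM2l => //; rewrite /nsq.
  have := sqr_ge0 (complex.Re (f x) - complex.Re (f y)).
  have := sqr_ge0 (complex.Im (f x) - complex.Im (f y)).
  by lra.
have i1 := rintgZ 2^-1 (rintgZ c2pi nfi); have i2 := rintgZ 2^-1 ig.
apply: (@le_trans _ _ (\int[leb2]_x (2^-1 * (c2pi * nsq (f x)) + 2^-1 * g x))).
  apply: le_rint => //; last exact: rintgD.
  have iTh : cintg leb2 (fun x => f x * fourier1 h x); last by have [] := iTh.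
  apply: (cintg_le _ _ (rintgZ (2 * \int[leb2]_x cmod (h x)) (cintg_cmod fi))).
    by apply: cmeasM => //; apply: cmeas_fourier1; exact: cintg_meas hi.
  by move=> x; rewrite cmodM mulrC ler_wpM2r ?cmod_ge0 ?cmod_fourier1.
rewrite (rintD i1 i2) (rintZ 2^-1 (rintgZ c2pi nfi)) (rintZ 2^-1 ig).
by rewrite (rintZ c2pi nfi) Eg -/(sq f); lra.
Qed.

Lemma abel2_cvg xi : abel2 n.+1%:R^-1 xi @[n --> \oo] --> (1 : R).
Proof.
have key t : abel n.+1%:R^-1 t @[n --> \oo] --> (1 : R).
  have h0 : n.+1%:R^-1 * - `|t| @[n --> \oo] --> (0 : R).
    have := cvgM (@cvg_harmonic R) (cvg_cst (- `|t|)).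
    by rewrite mul0r; exact.
  rewrite (_ : (fun n => abel n.+1%:R^-1 t) =
      expR \o (fun n => n.+1%:R^-1 * - `|t|)); last first.
    by apply/funext => n; rewrite /= /abel mulrN.
  by have := cvg_comp _ _ h0 (@continuous_expR R 0); rewrite expR0; exact.
have := cvgM (key xi.1) (key xi.2); rewrite mulr1; exact.
Qed.

(** Remove the Abel factor of [bessel_abel] by Fatou's lemma. *)
Lemma bessel f : cintg leb2 f -> l2 f ->
  l2 (fourier1 f) /\ sq (fourier1 f) <= c2pi * sq f.
Proof.
move=> fi lf; have [mf nfi] := lf; have mT := cmeas_fourier1 mf.
have e0 n : 0 < n.+1%:R^-1 :> R by [].
have F : (\int[leb2]_xi (nsq (fourier1 f xi))%:E <= (c2pi * sq f)%:E)%E.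
  apply: (@fatou_le _ _ _ _ (fun n xi => abel2 n.+1%:R^-1 xi * nsq (fourier1 f xi))).
  - by move=> n; exact: rintg_meas (bessel_abel fi lf (e0 n)).1.
  - by move=> n xi; apply: mulr_ge0; [exact: abel2_ge0|exact: nsq_ge0].
  - move=> xi.
    have key2 := abel2_cvg xi.
    have := cvgM key2 (cvg_cst (nsq (fourier1 f xi))); rewrite mul1r; exact.
  - move=> n; have [i1 l1] := bessel_abel fi lf (e0 n).
    by rewrite -rintg_fin// lee_fin.
have lT : l2 (fourier1 f).
  by apply/l2P; split => //; apply: (le_lt_trans F); exact: ltry.
by split => //; rewrite -lee_fin -l2_fin.
Qed.

End Bessel.

(** * Completeness of L^2 *)

Section completeness.
Context {R : realType}.
Implicit Types (g : plane R -> R[i]) (x : plane R).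

Lemma cauchy_lim (u : nat -> R) (w : R) : 0 <= w ->
  (forall k m, (k <= m)%N -> (u m - u k) ^+ 2 <= 2^-1 ^+ k * w) ->
  u n @[n --> \oo] --> lim (u n @[n --> \oo]).
Proof.
move=> w0 hu; apply: (@cauchy_cvg R).
apply: cauchy_exP => e e0.
have h : 2^-1 ^+ n * w @[n --> \oo] --> (0 : R).
  rewrite -(mul0r w); apply: cvgM; last exact: cvg_cst.
  by apply: cvg_expr; rewrite ger0_norm// invf_lt1// ltr1n.
have e20 : 0 < e ^+ 2 by rewrite exprn_gt0.
move/cvgrPdist_lt : h => /(_ _ e20)[N _ hN].
exists (u N), N => // m /= Nm; rewrite /ball /= distrC.
rewrite -(@ltr_pXn2r _ 2) ?nnegrE ?(ltW e0)// real_normK ?num_real//.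
apply: (le_lt_trans (hu _ _ Nm)).
have := hN N (leqnn N); rewrite /= sub0r normrN ger0_norm//.
by rewrite mulr_ge0// exprn_ge0.
Qed.

(** Summing increments with weights 2 ^ j makes the tail small, by the
    inequality of Cauchy and Schwarz against the geometric sequence. *)
Lemma dyadic_sum (z_ : nat -> R[i]) k m : (k <= m)%N ->
  nsq (z_ m - z_ k) <=
  2 * 2^-1 ^+ k * \sum_(k <= j < m) 2 ^+ j * nsq (z_ j.+1 - z_ j).
Proof.
move=> km; rewrite -(subnK km); move: (m - k)%N => n; clear m km.
elim: n k => [|n IH] k.
  by rewrite add0n subrr nsq0 big_geq// mulr0.
rewrite addSnnS; have {}IH := IH k.+1.
rewrite big_ltn ?ltn_addl//.
rewrite (_ : z_ (n + k.+1)%N - z_ k =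
  (z_ k.+1 - z_ k) + (z_ (n + k.+1)%N - z_ k.+1)); last by ring.
apply: (le_trans (nsqD_le _ _)); rewrite [leRHS]mulrDr; apply: lerD.
  rewrite mulrA -[_ * 2 ^+ k]mulrA -exprMn mulVf// expr1n mulr1 //.
apply: (le_trans (ler_wpM2l _ IH)) => //.
by rewrite exprS !mulrA [2 * 2]mulrC -!mulrA [2 * (2^-1 * _)]mulrA mulfV// mul1r.
Qed.

Lemma geometric_le (C : R) n : 0 <= C ->
  \sum_(0 <= j < n) C * 4^-1 ^+ j <= 2 * C.
Proof.
move=> C0; have q0 k : 0 <= C * 4^-1 ^+ k by rewrite mulr_ge0// exprn_ge0.
suff : \sum_(0 <= j < n) C * 4^-1 ^+ j <= 2 * C - 2 * (C * 4^-1 ^+ n).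
  by have := q0 n; lra.
elim: n => [|n IH]; first by rewrite big_geq// expr0; lra.
rewrite big_nat_recr//=; apply: (le_trans (lerD IH (lexx _))).
by rewrite exprSr; have := q0 n; lra.
Qed.

(** A sequence whose increments decay geometrically converges: the weighted
    sum [W] of the squared increments is integrable, hence finite almost
    everywhere, and bounds both the pointwise Cauchy modulus and the squared
    remainder. Off the set where [W] is finite the sequence is replaced by 0. *)
Lemma l2_complete (g_ : nat -> plane R -> R[i]) (C : R) : 0 <= C ->
  (forall n, l2 (g_ n)) ->
  (forall n, sq (fun x => g_ n.+1 x - g_ n x) <= C * 8^-1 ^+ n) ->
  exists g, l2 g /\ sq (fun x => g_ n x - g x) @[n --> \oo] --> (0 : R).
Proof.
move=> C0 lg hg.
pose dn j x := 2 ^+ j * nsq (g_ j.+1 x - g_ j x).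
have ld j : l2 (fun x => g_ j.+1 x - g_ j x) by exact: l2B.
have dn0 j x : 0 <= dn j x by rewrite mulr_ge0 ?nsq_ge0// exprn_ge0.
have mdn j : measurable_fun setT (fun x => (dn j x)%:E).
  apply/measurable_EFinP; apply: measurable_funM; first exact: measurable_cst.
  by apply: measurable_nsq; exact: (ld j).1.
have dnE0 j x : setT x -> (0 <= (dn j x)%:E)%E by move=> _; rewrite lee_fin.
pose W x : \bar R := (\sum_(0 <= j <oo) (dn j x)%:E)%E.
have mW : measurable_fun setT W.
  apply: (@ge0_emeasurable_sum _ _ _ setT (fun j x => (dn j x)%:E) xpredT).
    by move=> k x Dx _; exact: dnE0.
  by move=> k _.
have W0 x : (0 <= W x)%E by apply: nneseries_ge0 => n _ _; rewrite lee_fin.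
have IW : (\int[leb2]_x W x <= (2 * C)%:E)%E.
  rewrite /W integral_nneseries//.
  apply: lime_le.
    by apply: is_cvg_nneseries => n _ _; apply: integral_ge0 => x _; exact: dnE0.
  apply: nearW => n.
  apply: (@le_trans _ _ (\sum_(0 <= j < n) (C * 4^-1 ^+ j)%:E)%E); last first.
    by rewrite sumEFin lee_fin geometric_le.
  apply: lee_sum => j _; rewrite /dn.
  have [_ dj] := ld j.
  rewrite -rintg_fin; last exact: rintgZ.
  rewrite rintZ// lee_fin.
  apply: (@le_trans _ _ (2 ^+ j * (C * 8^-1 ^+ j))).
    by rewrite ler_wpM2l ?exprn_ge0//; exact: hg.
  rewrite mulrCA -exprMn; apply: ler_wpM2l => //.
  by rewrite (_ : 2 * 8^-1 = 4^-1 :> R)//; field.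
(* the complement is null because W is integrable *)
pose A := [set x | (W x < +oo)%E].
have mA : measurable A.
  have := @emeasurable_fun_infty_o _ _ _ setT W measurableT mW +oo%E.
  by rewrite setTI.
pose h_ n x := (\1_A x : R)%:C * g_ n x.
have lh n : l2 (h_ n).
  apply: (@l2M _ _ 1) => //; first by apply: cmeas_real; exact: measurable_indic.
  by move=> x; rewrite nsq_real indicE; case: (_ \in _); rewrite ?expr1n ?expr0n.
have Wfin x : A x -> forall k m, (k <= m)%N ->
    nsq (g_ m x - g_ k x) <= 2^-1 ^+ k * (2 * fine (W x)).
  move=> Ax k m km; apply: (le_trans (dyadic_sum (fun n => g_ n x) km)).
  rewrite mulrCA -mulrA; apply: ler_wpM2l => //.
  apply: ler_wpM2l; first by rewrite exprn_ge0.
  rewrite -lee_fin fineK; last by rewrite ge0_fin_numE.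
  rewrite -sumEFin; apply: (@le_trans _ _ (\sum_(0 <= j < m) (dn j x)%:E)%E).
    rewrite (big_cat_nat (leq0n k) km)/= leeDr//.
    by apply: sume_ge0 => j _; rewrite lee_fin.
  by apply: nneseries_lim_ge => n _ _; rewrite lee_fin.
have hC x k m : (k <= m)%N -> nsq (h_ m x - h_ k x) <= 2^-1 ^+ k * (2 * fine (W x)).
  move=> km; rewrite /h_ -mulrBr nsqM nsq_real indicE.
  have [Ax|nA] := boolP (x \in A).
    by rewrite expr1n mul1r; apply: Wfin => //; exact/set_mem.
  by rewrite expr0n mul0r !mulr_ge0 ?exprn_ge0 ?fine_ge0.
have w0 x : 0 <= 2 * fine (W x) by rewrite mulr_ge0 ?fine_ge0.
pose g x : R[i] := lim (complex.Re (h_ n x) @[n --> \oo]) +i*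
                   lim (complex.Im (h_ n x) @[n --> \oo]).
have cR x : complex.Re (h_ n x) @[n --> \oo] --> complex.Re (g x).
  apply: (cauchy_lim (w0 x)) => k m km; apply: le_trans (hC x k m km).
  by rewrite /nsq ReD ReN lerDl sqr_ge0.
have cI x : complex.Im (h_ n x) @[n --> \oo] --> complex.Im (g x).
  apply: (cauchy_lim (w0 x)) => k m km; apply: le_trans (hC x k m km).
  by rewrite /nsq ImD ImN lerDr sqr_ge0.
have mg : cmeas g.
  split.
    by apply: (@measurable_fun_cvg _ _ _ _ (fun n x => complex.Re (h_ n x))) => [n|x _];
      [exact: (lh n).1.1|exact: cR].
  by apply: (@measurable_fun_cvg _ _ _ _ (fun n x => complex.Im (h_ n x))) => [n|x _];
    [exact: (lh n).1.2|exact: cI].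
have gW x k : A x -> nsq (g_ k x - g x) <= 2^-1 ^+ k * (2 * fine (W x)).
  move=> Ax.
  have hE n : h_ n x = g_ n x by rewrite /h_ indicE mem_set// mul1r.
  have c1 : complex.Re (g_ k x) - complex.Re (h_ n x) @[n --> \oo] -->
      complex.Re (g_ k x) - complex.Re (g x) by exact: cvgB (cvg_cst _) (cR x).
  have c2 : complex.Im (g_ k x) - complex.Im (h_ n x) @[n --> \oo] -->
      complex.Im (g_ k x) - complex.Im (g x) by exact: cvgB (cvg_cst _) (cI x).
  have hc : (complex.Re (g_ k x) - complex.Re (h_ n x)) *
            (complex.Re (g_ k x) - complex.Re (h_ n x)) +
            (complex.Im (g_ k x) - complex.Im (h_ n x)) *
            (complex.Im (g_ k x) - complex.Im (h_ n x)) @[n --> \oo] -->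
      (complex.Re (g_ k x) - complex.Re (g x)) *
      (complex.Re (g_ k x) - complex.Re (g x)) +
      (complex.Im (g_ k x) - complex.Im (g x)) *
      (complex.Im (g_ k x) - complex.Im (g x)).
    by exact: cvgD (cvgM c1 c1) (cvgM c2 c2).
  rewrite {1}/nsq ReD ReN ImD ImN !expr2 -(cvg_lim _ hc)//.
  apply: limr_le; first by apply/cvg_ex; eexists; exact: hc.
  exists k => // n /= kn; apply: le_trans (Wfin x Ax k n kn).
  by rewrite hE -nsqN opprB /nsq ReD ReN ImD ImN !expr2.
have bnd k : (\int[leb2]_x (nsq (g_ k x - g x))%:E <= (2^-1 ^+ k * (4 * C))%:E)%E.
  apply: (@le_trans _ _ (\int[leb2]_x ((2^-1 ^+ k * 2)%:E * W x))%E).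
    apply: ge0_le_integral => //.
    - by move=> x _; rewrite lee_fin nsq_ge0.
    - apply/measurable_EFinP; apply: measurable_nsq; apply: cmeasB => //.
      exact: (lg k).1.
    - exact: measurable_funeM.
    - move=> x _; have [Ax|nA] := pselect (A x).
        rewrite -[W x]fineK; last by rewrite ge0_fin_numE.
        by rewrite -EFinM lee_fin -mulrA; exact: gW.
      have -> : W x = +oo%E by apply/eqP; rewrite eq_le leey /= leNgt; apply/negP.
      by rewrite gt0_muley ?leey// lte_fin mulr_gt0// exprn_gt0.
  rewrite ge0_integralZl//.
  apply: (le_trans (lee_wpmul2l _ IW)); first by rewrite lee_fin mulr_ge0// exprn_ge0.
  by rewrite -EFinM lee_fin; set q := _ ^+ k; lra.
have lgg k : l2 (fun x => g_ k x - g x).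
  apply/l2P; split; first by apply: cmeasB => //; exact: (lg k).1.
  by apply: (le_lt_trans (bnd k)); exact: ltry.
exists g; split.
  rewrite (_ : g = fun x => g_ 0%N x - (g_ 0%N x - g x)); first exact: l2B.
  by apply/funext => x; ring.
apply: (@squeeze_cvgr _ _ _ _ (fun=> 0) (fun k => 2^-1 ^+ k * (4 * C))).
- apply: nearW => k; rewrite sq_ge0 /=.
  by rewrite -lee_fin -l2_fin.
- exact: cvg_cst.
- rewrite -(mul0r (4 * C)); apply: cvgM; last exact: cvg_cst.
  by apply: cvg_expr; rewrite ger0_norm// invf_lt1// ltr1n.
Qed.

End completeness.

(** * The graph of the Fourier-Plancherel transform *)

Section fourier_graph.
Context {R : realType}.
Implicit Types (f g : plane R -> R[i]) (x y xi : plane R).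

Lemma fourier1_lin f g (c : R[i]) xi : cintg leb2 f -> cintg leb2 g ->
  fourier1 (fun x => f x + c * g x) xi = fourier1 f xi + c * fourier1 g xi.
Proof.
move=> fi gi.
have i1 := cintg_fourier xi fi; have i2 := cintg_fourier xi gi.
rewrite -[RHS]/(cint _ _ + c * cint _ _) -(cintZ c i2) -(cintD i1 (cintgZ c i2)).
by apply: eq_cint => x; ring.
Qed.

(** The defining approximation in terms of [sq]: the norms occurring in it are
    finite by Bessel's inequality. *)
Lemma is_fourierP f g : is_fourier f g <-> [/\ l2 f, l2 g &
  exists F : nat -> plane R -> R[i], [/\ forall n, cintg leb2 (F n) /\ l2 (F n),
    sq (fun x => F n x - f x) @[n --> \oo] --> (0 : R) &
    sq (fun xi => fourier1 (F n) xi - g xi) @[n --> \oo] --> (0 : R)]].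
Proof.
split=> [[/L2P lf /L2P lg [F [hF h1 h2]]]|[lf lg [F [hF h1 h2]]]].
  have lF n : l2 (F n) by apply/L2P; exact: (hF n).2.
  have lT n : l2 (fourier1 (F n)) by exact: (bessel (hF n).1 (lF n)).1.
  split => //; exists F; split.
  - by move=> n; split; [exact: (hF n).1|exact: lF].
  - by apply/L2norm_cvg0 => // n; exact: l2B.
  - by apply/L2norm_cvg0 => // n; exact: l2B.
have lF n : l2 (F n) by exact: (hF n).2.
have lT n : l2 (fourier1 (F n)) by exact: (bessel (hF n).1 (lF n)).1.
split; [exact/L2P|exact/L2P|exists F; split].
- by move=> n; split; [exact: (hF n).1|exact/L2P].
- by apply/L2norm_cvg0 => // n; exact: l2B.
- by apply/L2norm_cvg0 => // n; exact: l2B.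
Qed.

Lemma is_fourier_l2 f g : is_fourier f g -> l2 f /\ l2 g.
Proof. by move=> /is_fourierP[]. Qed.

Lemma is_fourier_L1 f : cintg leb2 f -> l2 f -> is_fourier f (fourier1 f).
Proof.
move=> fi lf; have [lT _] := bessel fi lf; apply/is_fourierP; split => //.
exists (fun=> f); split => //.
  by under eq_fun do under eq_fun do rewrite subrr; rewrite sq0; exact: cvg_cst.
by under eq_fun do under eq_fun do rewrite subrr; rewrite sq0; exact: cvg_cst.
Qed.

Lemma sq_cvg0D (u_ v_ w_ : nat -> plane R -> R[i]) (K : R) :
  (forall n, l2 (u_ n)) -> (forall n, l2 (v_ n)) ->
  (forall n, sq (w_ n) <= K * sq (u_ n) + K * sq (v_ n)) ->
  sq (u_ n) @[n --> \oo] --> (0 : R) -> sq (v_ n) @[n --> \oo] --> (0 : R) ->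
  sq (w_ n) @[n --> \oo] --> (0 : R).
Proof.
move=> lu lv hw hu hv.
apply: (@squeeze_cvgr _ _ _ _ (fun=> 0) (fun n => K * sq (u_ n) + K * sq (v_ n))).
- by apply: nearW => n; rewrite sq_ge0 hw.
- exact: cvg_cst.
- rewrite -[0 in X in _ --> X](_ : K * 0 + K * 0 = 0); last by ring.
  by apply: cvgD; apply: cvgM => //; exact: cvg_cst.
Qed.

Lemma is_fourier_lin f g f' g' (c : R[i]) : is_fourier f g -> is_fourier f' g' ->
  is_fourier (fun x => f x + c * f' x) (fun xi => g xi + c * g' xi).
Proof.
move=> /is_fourierP[lf lg [F [hF F1 F2]]] /is_fourierP[lf' lg' [F' [hF' F1' F2']]].
have lT n : l2 (fourier1 (F n)) by exact: (bessel (hF n).1 (hF n).2).1.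
have lT' n : l2 (fourier1 (F' n)) by exact: (bessel (hF' n).1 (hF' n).2).1.
have bound (p q : plane R -> R[i]) : l2 p -> l2 q ->
    sq (fun x => p x + c * q x) <= (2 + 2 * nsq c) * sq p + (2 + 2 * nsq c) * sq q.
  move=> lp lq; apply: (le_trans (sqD_le lp (l2Z c lq))); rewrite sqZ//.
  have := mulr_ge0 (nsq_ge0 c) (sq_ge0 p); have := sq_ge0 q; have := sq_ge0 p.
  by have := mulr_ge0 (nsq_ge0 c) (sq_ge0 q); lra.
apply/is_fourierP; split.
- by apply: l2D => //; exact: l2Z.
- by apply: l2D => //; exact: l2Z.
exists (fun n x => F n x + c * F' n x); split.
- move=> n; have [a1 a2] := hF n; have [b1 b2] := hF' n.
  by split; [apply: cintgD => //; exact: cintgZ|apply: l2D => //; exact: l2Z].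
- apply: (@sq_cvg0D (fun n x => F n x - f x) (fun n x => F' n x - f' x) _
    (2 + 2 * nsq c)) => //.
  + by move=> n; apply: l2B => //; exact: (hF n).2.
  + by move=> n; apply: l2B => //; exact: (hF' n).2.
  + move=> n; rewrite (_ : (fun x => _) =
      fun x => (F n x - f x) + c * (F' n x - f' x)).
      by apply: bound; apply: l2B => //; [exact: (hF n).2|exact: (hF' n).2].
    by apply/funext => x; ring.
- apply: (@sq_cvg0D (fun n x => fourier1 (F n) x - g x)
    (fun n x => fourier1 (F' n) x - g' x) _ (2 + 2 * nsq c)) => //.
  + by move=> n; exact: l2B.
  + by move=> n; exact: l2B.
  + move=> n; rewrite (_ : (fun x => _) =
      fun x => (fourier1 (F n) x - g x) + c * (fourier1 (F' n) x - g' x)).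
      by apply: bound; exact: l2B.
    apply/funext => x; rewrite fourier1_lin; [ring|exact: (hF n).1|exact: (hF' n).1].
Qed.

Lemma is_fourierB f g f' g' : is_fourier f g -> is_fourier f' g' ->
  is_fourier (fun x => f x - f' x) (fun xi => g xi - g' xi).
Proof.
move=> h h'; have := is_fourier_lin (-1) h h'.
by under eq_fun do rewrite mulN1r; under [X in is_fourier _ X -> _]eq_fun do rewrite mulN1r.
Qed.

Lemma fourier1_0 : fourier1 (fun=> 0) = (fun=> 0) :> (plane R -> R[i]).
Proof.
apply/funext => xi; rewrite -[LHS]/(cint leb2 (fun x => cis (- dot x xi) * 0)).
by rewrite (@eq_cint _ _ _ _ _ (fun=> 0)) ?cint0// => x; rewrite mulr0.
Qed.

Lemma cintg0 : cintg leb2 (fun _ : plane R => (0 : R[i])).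
Proof. by split; exact: rintg0. Qed.

Lemma is_fourier0 : is_fourier (fun _ : plane R => (0 : R[i])) (fun=> 0).
Proof. by have := is_fourier_L1 cintg0 l20; rewrite fourier1_0. Qed.

Lemma is_fourierZ (c : R[i]) f g : is_fourier f g ->
  is_fourier (fun x => c * f x) (fun xi => c * g xi).
Proof.
move=> h; have := is_fourier_lin c is_fourier0 h.
by under eq_fun do rewrite add0r; under [X in is_fourier _ X -> _]eq_fun do rewrite add0r.
Qed.

Lemma is_fourier_ae f g f' g' : is_fourier f g -> l2 f' -> l2 g' ->
  (f = f' %[ae leb2]) -> (g = g' %[ae leb2]) -> is_fourier f' g'.
Proof.
move=> /is_fourierP[lf lg [F [hF F1 F2]]] lf' lg' ef eg.
have lT n : l2 (fourier1 (F n)) by exact: (bessel (hF n).1 (hF n).2).1.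
apply/is_fourierP; split => //; exists F; split => //.
  rewrite (_ : (fun n => _) = (fun n => sq (fun x => F n x - f x)))//.
  apply/funext => n; apply: ae_sq.
  - by apply: filterS ef => x h _; rewrite h.
  - by apply: cmeasB; [exact: (hF n).2.1|exact: lf'.1].
  - by apply: cmeasB; [exact: (hF n).2.1|exact: lf.1].
rewrite (_ : (fun n => _) = (fun n => sq (fun x => fourier1 (F n) x - g x)))//.
apply/funext => n; apply: ae_sq.
- by apply: filterS eg => x h _; rewrite h.
- by apply: cmeasB; [exact: (lT n).1|exact: lg'.1].
- by apply: cmeasB; [exact: (lT n).1|exact: lg.1].
Qed.

(** Bessel's inequality passes to the closure; each of the two limits costs a
    factor 2 through [nsqD_le]. *)
Lemma is_fourier_le f g : is_fourier f g -> sq g <= 4 * c2pi * sq f.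
Proof.
move=> /is_fourierP[lf lg [F [hF F1 F2]]].
have lT n : l2 (fourier1 (F n)) by exact: (bessel (hF n).1 (hF n).2).1.
have h n : sq g <= 2 * sq (fun xi => fourier1 (F n) xi - g xi) +
    4 * c2pi * sq (fun x => F n x - f x) + 4 * c2pi * sq f.
  have e1 : sq g <= 2 * sq (fun xi => fourier1 (F n) xi - g xi) +
      2 * sq (fourier1 (F n)).
    rewrite -(sqN (fun xi => _ - _)) (_ : g = fun xi =>
      - (fourier1 (F n) xi - g xi) + fourier1 (F n) xi); last first.
      by apply/funext => xi; ring.
    rewrite (_ : (fun xi => - (fourier1 (F n) xi - _)) =
      fun xi => - (fourier1 (F n) xi - g xi)); last by apply/funext => xi; ring.
    by apply: sqD_le => //; apply: l2N; exact: l2B.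
  have e2 := (bessel (hF n).1 (hF n).2).2.
  have e3 : sq (F n) <= 2 * sq (fun x => F n x - f x) + 2 * sq f.
    rewrite {1}(_ : F n = fun x => (F n x - f x) + f x); last first.
      by apply/funext => x; ring.
    by apply: sqD_le => //; apply: l2B => //; exact: (hF n).2.
  have := ler_wpM2l (ltW (@c2pi_gt0 R)) e3; lra.
have hc : 2 * sq (fun xi => fourier1 (F n) xi - g xi) +
    4 * c2pi * sq (fun x => F n x - f x) + 4 * c2pi * sq f @[n --> \oo] -->
    2 * 0 + 4 * c2pi * 0 + 4 * c2pi * sq f.
  by apply: cvgD; [apply: cvgD; apply: cvgM => //; exact: cvg_cst|exact: cvg_cst].
rewrite (_ : 4 * c2pi * sq f = 2 * 0 + 4 * c2pi * 0 + 4 * c2pi * sq f); last by ring.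
rewrite -(cvg_lim _ hc)//; apply: limr_ge; last exact: nearW.
by apply/cvg_ex; eexists; exact: hc.
Qed.

Lemma is_fourier_fun f g g' : is_fourier f g -> is_fourier f g' ->
  g = g' %[ae leb2].
Proof.
move=> h h'; have [_ lg] := is_fourier_l2 h; have [_ lg'] := is_fourier_l2 h'.
apply/ae_sqB => //; apply/eqP; rewrite eq_le sq_ge0 andbT.
apply: (le_trans (is_fourier_le (is_fourierB h h'))).
rewrite (_ : (fun x => f x - f x) = fun=> 0) ?sq0 ?mulr0//.
by apply/funext => x; rewrite subrr.
Qed.

(** The multiplication formula, extended from the integrable functions to the
    closure in one argument after the other. *)
Lemma is_fourier_duality f g f' g' : is_fourier f g -> is_fourier f' g' ->
  cint leb2 (fun x => g x * f' x) = cint leb2 (fun x => f x * g' x).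
Proof.
move=> h h'.
have [lf lg] := is_fourier_l2 h; have [lf' lg'] := is_fourier_l2 h'.
have /is_fourierP[_ _ [F [hF F1 F2]]] := h.
have /is_fourierP[_ _ [F' [hF' F1' F2']]] := h'.
have lT n : l2 (fourier1 (F n)) by exact: (bessel (hF n).1 (hF n).2).1.
have lT' n : l2 (fourier1 (F' n)) by exact: (bessel (hF' n).1 (hF' n).2).1.
(* for integrable [F n], both sides are limits along [F' m] *)
have E1 n : cint leb2 (fun x => fourier1 (F n) x * f' x) =
            cint leb2 (fun x => F n x * g' x).
  apply: (@cmod_lim_unique _ (fun m => cint leb2 (fun x => F' m x * fourier1 (F n) x))).
    rewrite (_ : cint leb2 (fun x => fourier1 (F n) x * f' x) =
      cint leb2 (fun x => f' x * fourier1 (F n) x)).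
      exact: (cint_cvg_l2 (fun m => (hF' m).2) lf' (lT n) F1').
    by apply: eq_cint => x; rewrite mulrC.
  rewrite (_ : cint leb2 (fun x => F n x * g' x) = cint leb2 (fun x => g' x * F n x)).
    have E m : cint leb2 (fun x => F' m x * fourier1 (F n) x) =
               cint leb2 (fun x => fourier1 (F' m) x * F n x).
      by rewrite (multiplication_formula (hF' m).1 (hF n).1).
    by under eq_fun do rewrite E; exact: (cint_cvg_l2 lT' lg' (hF n).2 F2').
  by apply: eq_cint => x; rewrite mulrC.
apply: (@cmod_lim_unique _ (fun n => cint leb2 (fun x => fourier1 (F n) x * f' x))).
  exact: (cint_cvg_l2 lT lg lf' F2).
by under eq_fun do rewrite E1; exact: (cint_cvg_l2 (fun n => (hF n).2) lf lg' F1).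
Qed.

Definition box (a b : plane R) : set (plane R) := `]a.1, b.1]%classic `*` `]a.2, b.2]%classic.

Lemma measurable_box a b : measurable (box a b).
Proof. by apply: measurableX; exact: measurable_itv. Qed.

Lemma indic_box a b x :
  \1_(box a b) x = \1_(`]a.1, b.1]) (x.1 : R) * \1_(`]a.2, b.2]) (x.2 : R) :> R.
Proof. by rewrite !indicE /box in_setX; case: (_ \in _); rewrite ?mul1r ?mul0r. Qed.

Lemma rintg_indic_box a b : rintg leb2 (\1_(box a b) : plane R -> R).
Proof.
have h (u v : R) : rintg (@lebesgue_measure R) (\1_(`]u, v])).
  exact: integrable_indic_itv.
have [+ _] := leb2_tensor_rint (h a.1 b.1) (h a.2 b.2).
rewrite (_ : (\1_(box a b) : plane R -> R) =
  fun x => \1_(`]a.1, b.1]) (x.1 : R) * \1_(`]a.2, b.2]) (x.2 : R))//.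
by apply/funext => x; rewrite indic_box.
Qed.

Definition cindic (A : set (plane R)) : plane R -> R[i] := fun x => (\1_A x)%:C.

Lemma cmeas_cindic A : measurable A -> cmeas (cindic A).
Proof. by move=> mA; apply: cmeas_real; exact: measurable_indic. Qed.

Lemma nsq_cindic A x : nsq (cindic A x) = \1_A x.
Proof. by rewrite nsq_real indicE; case: (_ \in _); rewrite ?expr1n ?expr0n. Qed.

Lemma l2_box a b : l2 (cindic (box a b)).
Proof.
split; first by apply: cmeas_cindic; exact: measurable_box.
by under eq_fun do rewrite nsq_cindic; exact: rintg_indic_box.
Qed.

Lemma cintg_box a b : cintg leb2 (cindic (box a b)).
Proof.
apply: (cintg_le _ _ (rintg_indic_box a b)).
  by apply: cmeas_cindic; exact: measurable_box.
by move=> x; rewrite cmod_real indicE ger0_norm.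
Qed.

(** Truncate to large boxes, along a sequence for which the truncation error
    decays geometrically: by Bessel's inequality the transforms then satisfy
    the hypothesis of [l2_complete]. *)
Lemma is_fourier_exists f : l2 f -> exists g, is_fourier f g.
Proof.
move=> lf; have [mf nfi] := lf.
pose B n := box (- n%:R, - n%:R) (n%:R, n%:R).
pose t n x := cindic (B n) x * f x.
have ct n : cintg leb2 (t n) by exact: (cintgM_l2 (l2_box _ _) lf).1.
have lt n : l2 (t n).
  apply: (@l2M _ _ 1) => //; first by apply: cmeas_cindic; exact: measurable_box.
  by move=> x; rewrite nsq_cindic indicE; case: (_ \in _).
have tf : sq (fun x => t n x - f x) @[n --> \oo] --> (0 : R).
  have E n x : nsq (t n x - f x) = (1 - \1_(B n) x) * nsq (f x).
    rewrite /t (_ : _ - _ = (cindic (B n) x - 1) * f x); last by ring.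
    rewrite nsqM; congr (_ * _); rewrite /nsq /= indicE; case: (_ \in _) => /=; ring.
  have i01 n x : 0 <= 1 - (\1_(B n) x : R) <= 1.
    by rewrite indicE; case: (_ \in _) => /=; rewrite ?subrr ?subr0 ?lexx ?ler01.
  have [] := @dominated_rint _ _ _ leb2 (fun n x => nsq (t n x - f x)) (fun=> 0)
      (fun x => nsq (f x)).
  - by move=> n; apply: measurable_nsq; exact: (l2B (lt n) lf).1.
  - exact: nfi.
  - move=> n x; rewrite ger0_norm ?nsq_ge0// E.
    by have /andP[_ h] := i01 n x; apply: ler_piMl => //; exact: nsq_ge0.
  - move=> x; apply: cvg_near_cst; near=> n.
    rewrite E indicE mem_set ?subrr ?mul0r//.
    have h1 : `|x.1 : R| < n%:R by near: n; exact: nbhs_infty_gtr.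
    have h2 : `|x.2 : R| < n%:R by near: n; exact: nbhs_infty_gtr.
    move: h1 h2; rewrite !ltr_norml => /andP[a1 a2] /andP[b1 b2].
    by split => /=; rewrite in_itv /= ?a1 ?b1 /= ltW.
  - by rewrite [in X in _ -> X -> _]/Rintegral integral0.
have /choice[N hN] k : exists n, sq (fun x => t n x - f x) <= 8^-1 ^+ k.
  have e0 : 0 < 8^-1 ^+ k :> R by rewrite exprn_gt0.
  move/cvgrPdist_le : tf => /(_ _ e0)[n _ hn]; exists n.
  by have := hn n (leqnn n); rewrite /= sub0r normrN ger0_norm ?sq_ge0.
pose u k := t (N k).
have lT k : l2 (fourier1 (u k)) by exact: (bessel (ct _) (lt _)).1.
have lu k : l2 (fun x => u k x - f x) by exact: (l2B (lt _) lf).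
have inc k : sq (fun xi => fourier1 (u k.+1) xi - fourier1 (u k) xi) <=
    4 * c2pi * 8^-1 ^+ k.
  rewrite (_ : (fun xi => _) = fourier1 (fun x => u k.+1 x + -1 * u k x)); last first.
    by apply/funext => xi; rewrite fourier1_lin ?mulN1r//; exact: ct.
  have h : (fun x => u k.+1 x + -1 * u k x) = (fun x => (u k.+1 x - f x) - (u k x - f x)).
    by apply/funext => x; ring.
  have h1 : cintg leb2 (fun x => u k.+1 x + -1 * u k x).
    by apply: cintgD; [exact: ct|apply: cintgZ; exact: ct].
  have h2 : l2 (fun x => u k.+1 x + -1 * u k x) by rewrite h; exact: l2B.
  apply: (le_trans (bessel h1 h2).2).
  rewrite [leRHS](_ : _ = c2pi * (4 * 8^-1 ^+ k)); last by ring.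
  apply: ler_wpM2l; first exact: ltW (@c2pi_gt0 R).
  rewrite h; apply: (le_trans (sqB_le (lu k.+1) (lu k))).
  have := hN k; have := hN k.+1; rewrite exprS.
  have : 0 <= 8^-1 ^+ k :> R by rewrite exprn_ge0.
  by rewrite -/(u k) -/(u k.+1); lra.
have [g [lg gc]] := l2_complete (mulr_ge0 (ler0n _ 4) (ltW (@c2pi_gt0 R))) lT inc.
exists g; apply/is_fourierP; split => //; exists u; split => //.
  by move=> k; split; [exact: ct|exact: lt].
apply: (@squeeze_cvgr _ _ _ _ (fun=> 0) (fun k => 8^-1 ^+ k)).
- by apply: nearW => k; rewrite sq_ge0 /=; exact: hN.
- exact: cvg_cst.
- by apply: cvg_expr; rewrite ger0_norm// invf_lt1// ltr1n.
Unshelve. all: by end_near. Qed.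

End fourier_graph.

(** * Functions whose integrals over boxes vanish *)

Section vanishing_integrals.
Context {R : realType}.
Implicit Types (h : plane R -> R).

(** The sets [S] for which the integral over [D] and the preimage of [S]
    vanishes form a Dynkin class. *)
Lemma dynkin_zero {d} {T : measurableType d} (G : set (set T))
    (phi : plane R -> T) (D : set (plane R)) h :
  @measurable _ T = <<s G >> -> setI_closed G -> measurable_fun setT phi ->
  measurable D -> leb2.-integrable D (EFin \o h) ->
  \int[leb2]_(x in D) h x = 0 ->
  (forall S, G S -> \int[leb2]_(x in D `&` phi @^-1` S) h x = 0) ->
  forall S, measurable S -> \int[leb2]_(x in D `&` phi @^-1` S) h x = 0.
Proof.
move=> GE GI mphi mD ih h0 hG.
have mpre S : measurable S -> measurable (D `&` phi @^-1` S).
  move=> mS; apply: measurableI => //.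
  by rewrite -[X in measurable X]setTI; exact: mphi.
move=> S; rewrite {1}GE.
apply: (@dynkin_induction _ _ G
  (fun S => \int[leb2]_(x in D `&` phi @^-1` S) h x = 0) GE GI).
- by rewrite preimage_setT setIT.
- by move=> A GA; exact: hG.
- move=> A mA hA.
  have := @Rintegral_setU _ _ _ leb2 (D `&` phi @^-1` A) (D `&` phi @^-1` (~` A)) h
    (mpre _ mA) (mpre _ (measurableC mA)).
  rewrite -setIUr -preimage_setU setUv preimage_setT setIT hA h0 add0r => <-//.
  by apply/disj_setPS => x [[_ /= xA] [_ /= nxA]].
- move=> F mF tF hF.
  have ihF n : leb2.-integrable (D `&` phi @^-1` F n) (EFin \o h).
    by apply: (@integrableS _ _ _ leb2 D) => //; exact: mpre.
  have E : D `&` phi @^-1` (\bigcup_k F k) = \bigcup_k (D `&` phi @^-1` F k).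
    by rewrite preimage_bigcup setI_bigcupr.
  rewrite E /Rintegral (@integral_bigcup _ _ _ leb2 (fun k => D `&` phi @^-1` F k)).
  + rewrite eseries0// => n _ _.
    have := hF n; rewrite /Rintegral => hn.
    by rewrite -[LHS]fineK ?hn//; exact: (integrable_fin_num (mpre _ (mF n)) (ihF n)).
  + apply/trivIsetP => i j _ _ ij; rewrite setIACA setIid -preimage_setI.
    by move/trivIsetP : tF => /(_ i j Logic.I Logic.I ij) ->; rewrite preimage_set0 setI0.
  + by move=> k; exact: mpre.
  + rewrite -E; apply: (@integrableS _ _ _ leb2 D) => //; apply: mpre.
    exact: bigcup_measurable.
Qed.

(** Fix a large square [D0] and enlarge the class of test sets in three steps,
    each by the pi-lambda theorem: a measurable first side, then a measurable
    second side, then any measurable set. The density of the zero measure is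
    zero. *)
Lemma null_of_box_integrals h :
  (forall I J : set (measurableTypeR R), ocitv I -> ocitv J ->
    leb2.-integrable (I `*` J) (EFin \o h) /\ \int[leb2]_(x in I `*` J) h x = 0) ->
  h = (fun=> 0) %[ae leb2].
Proof.
move=> hIJ.
have mo (I : set (measurableTypeR R)) : ocitv I -> measurable I.
  by move=> oI; exact: sub_sigma_algebra.
have key N (D0 := `]- N%:R, N%:R]%classic : set (measurableTypeR R)) :
    {ae leb2, forall x, (D0 `*` D0) x -> h x = 0}.
  have oD0 : ocitv D0 by exists (- N%:R, N%:R).
  have s1 J A : ocitv J -> measurable A ->
      \int[leb2]_(x in (D0 `*` J) `&` (fst @^-1` A)) h x = 0.
    move=> oJ; apply: (@dynkin_zero _ (measurableTypeR R) (@ocitv R)) => //.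
    - exact: ocitvI.
    - by apply: measurableX; exact: mo.
    - exact: (hIJ _ _ oD0 oJ).1.
    - exact: (hIJ _ _ oD0 oJ).2.
    - move=> S oS; rewrite (_ : _ `&` _ = (D0 `&` S) `*` J).
        by apply: (hIJ _ _ _ oJ).2; exact: ocitvI.
      by apply/seteqP; split => x [] /= => [[? ?] ?|[? ?] ?].
  have s2 A B : measurable A -> measurable B ->
      \int[leb2]_(x in ((D0 `*` D0) `&` (fst @^-1` A)) `&` (snd @^-1` B)) h x = 0.
    move=> mA; apply: (@dynkin_zero _ (measurableTypeR R) (@ocitv R)) => //.
    - exact: ocitvI.
    - apply: measurableI; first by apply: measurableX; exact: mo.
      by rewrite -[X in measurable X]setTI; exact: measurable_fst.
    - apply: (@integrableS _ _ _ leb2 (D0 `*` D0)) => //.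
      + by apply: measurableX; exact: mo.
      + apply: measurableI; first by apply: measurableX; exact: mo.
        by rewrite -[X in measurable X]setTI; exact: measurable_fst.
      + exact: (hIJ _ _ oD0 oD0).1.
    - exact: s1.
    - move=> S oS; rewrite (_ : _ `&` _ = (D0 `*` (D0 `&` S)) `&` (fst @^-1` A)).
        by apply: s1 => //; exact: ocitvI.
      by apply/seteqP; split => x [] /= => [[[? ?] ?] ?|[? [? ?]] ?].
  have s3 E : measurable E -> \int[leb2]_(x in (D0 `*` D0) `&` E) h x = 0.
    move=> mE.
    apply: (@dynkin_zero _ (plane R) [set A `*` B | A in measurable & B in measurable]
      id (D0 `*` D0)) => //.
    - exact: measurable_prod_measurableType.
    - move=> _ _ [A1 mA1 [A2 mA2 <-]] [B1 mB1 [B2 mB2 <-]].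
      exists (A1 `&` B1); first exact: measurableI.
      exists (A2 `&` B2); first exact: measurableI.
      by rewrite setXI.
    - by apply: measurableX; exact: mo.
    - exact: (hIJ _ _ oD0 oD0).1.
    - exact: (hIJ _ _ oD0 oD0).2.
    - move=> _ [A mA [B mB <-]].
      rewrite (_ : _ `&` _ = ((D0 `*` D0) `&` (fst @^-1` A)) `&` (snd @^-1` B)).
        exact: s2.
      by apply/seteqP; split => x [] /= => [[? ?] [? ?]|[[? ?] ?] ?].
  have iD : leb2.-integrable (D0 `*` D0) (EFin \o h) by exact: (hIJ _ _ oD0 oD0).1.
  have mD : measurable (D0 `*` D0) by apply: measurableX; exact: mo.
  have : ae_eq leb2 (D0 `*` D0) (EFin \o h) (cst 0%E).
    apply: (integral_ae_eq mD iD) => // E ED mE.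
    rewrite integral0; have := s3 E mE; rewrite setIidr// /Rintegral => h0.
    rewrite -[LHS]fineK ?h0//; apply: integrable_fin_num => //.
    exact: (@integrableS _ _ _ leb2 (D0 `*` D0)).
  by apply: filterS => x h0 /h0 /= [].
have := ae_foralln key; apply: filterS => x hx _.
pose N := (Num.trunc (`|x.1 : R| + `|x.2 : R|)).+1.
apply: (hx N).
have hN : `|x.1 : R| + `|x.2 : R| < N%:R.
  by rewrite /N; exact: truncnS_gt.
have := normr_ge0 (x.1 : R); have := normr_ge0 (x.2 : R).
have := ler_norm (x.1 : R); have := ler_norm (x.2 : R).
have := ler_norm (- (x.1 : R)); have := ler_norm (- (x.2 : R)); rewrite !normrN.
by split => /=; rewrite in_itv /=; apply/andP; split; lra.
Qed.

End vanishing_integrals.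

(** * Parseval's identity against boxes *)

Section inversion.
Context {R : realType}.
Implicit Types (f g h u : plane R -> R[i]) (x y xi : plane R).

Lemma cint_ae f g : (f = g %[ae leb2]) -> cmeas f -> cmeas g ->
  cint leb2 f = cint leb2 g.
Proof.
move=> fg [f1 f2] [g1 g2]; apply: complexP => /=; congr fine;
  apply: ae_eq_integral => //; try exact/measurable_EFinP;
  by apply: filterS fg => x h _ /=; rewrite h.
Qed.

Lemma cint_dominated_real (a_ : nat -> plane R -> R) (a : plane R -> R) (K : R) u :
  (forall n, measurable_fun setT (a_ n)) -> (forall n x, `|a_ n x| <= K) ->
  (forall x, a_ n x @[n --> \oo] --> a x) -> cintg leb2 u ->
  complex.Re (cint leb2 (fun x => (a_ n x)%:C * u x)) @[n --> \oo] -->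
    complex.Re (cint leb2 (fun x => (a x)%:C * u x)) /\
  complex.Im (cint leb2 (fun x => (a_ n x)%:C * u x)) @[n --> \oo] -->
    complex.Im (cint leb2 (fun x => (a x)%:C * u x)).
Proof.
move=> ma aK ac iu; have [u1 u2] := iu.
have key (v : plane R -> R) : rintg leb2 v ->
    \int[leb2]_x (a_ n x * v x) @[n --> \oo] --> \int[leb2]_x (a x * v x).
  move=> iv; apply: (@dominated_rint _ _ _ leb2 (fun n x => a_ n x * v x) _
    (fun x => K * `|v x|) _ _ _ _).2.
  - by move=> n; apply: measurable_funM => //; exact: rintg_meas iv.
  - by apply: rintgZ; exact: rintg_norm.
  - by move=> n x; rewrite normrM ler_wpM2r.
  - by move=> x; apply: cvgM; [exact: ac|exact: cvg_cst].
have ER (b : plane R -> R) : complex.Re (cint leb2 (fun x => (b x)%:C * u x)) =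
    \int[leb2]_x (b x * complex.Re (u x)).
  by apply: eq_Rintegral => x _; rewrite ReM /= mul0r subr0.
have EI (b : plane R -> R) : complex.Im (cint leb2 (fun x => (b x)%:C * u x)) =
    \int[leb2]_x (b x * complex.Im (u x)).
  by apply: eq_Rintegral => x _; rewrite ImM /= mul0r addr0.
split.
  by rewrite ER; under eq_fun do rewrite ER; exact: key.
by rewrite EI; under eq_fun do rewrite EI; exact: key.
Qed.

(** On the sides of a box, the limit of its Poisson integral differs from the
    multiple of the indicator that it is elsewhere. *)
Lemma ae_off_lines (a b : plane R) : {ae leb2, forall x : plane R,
  [/\ (x.1 : R) != a.1, (x.1 : R) != b.1, (x.2 : R) != a.2 & (x.2 : R) != b.2]}.
Proof.
have h1 (c : R) : {ae leb2, forall x : plane R, (x.1 : R) != c}.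
  exists (([set c] : set (measurableTypeR R)) `*` setT); split.
  - exact: measurableX.
  - by rewrite leb2_box// lebesgue_measure_set1 mul0e.
  - by move=> x /= /negP; rewrite negbK => /eqP.
have h2 (c : R) : {ae leb2, forall x : plane R, (x.2 : R) != c}.
  exists (setT `*` ([set c] : set (measurableTypeR R))); split.
  - exact: measurableX.
  - by rewrite leb2_box// lebesgue_measure_set1 mule0.
  - by move=> x /= /negP; rewrite negbK => /eqP.
near=> x; split; near: x; [exact: h1|exact: h1|exact: h2|exact: h2].
Unshelve. all: by end_near.
Qed.

(** The limit of [poisson_box] as the parameter tends to 0. *)
Definition sgbox (a b x : R) : R := pi * (Num.sg (b - x) - Num.sg (a - x)).

Lemma sgboxE (a b x : R) : a < b -> x != a -> x != b ->
  sgbox a b x = 2 * pi * \1_(`]a, b]) x.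
Proof.
move=> ab xa xb; rewrite /sgbox indicE.
have [x_a|x_a|e] := ltgtP x a; last by rewrite e eqxx in xa.
  rewrite !gtr0_sg ?subr_gt0//; last exact: lt_trans ab.
  rewrite memNset; first by rewrite subrr !mulr0.
  by rewrite /= in_itv /= => /andP[]; rewrite ltNge ltW.
have [x_b|x_b|e] := ltgtP x b; last by rewrite e eqxx in xb.
  rewrite gtr0_sg ?subr_gt0// ltr0_sg ?subr_lt0// mem_set; first by rewrite mulr1; ring.
  by rewrite /= in_itv /= x_a ltW.
rewrite !ltr0_sg ?subr_lt0// memNset; first by rewrite subrr !mulr0.
by rewrite /= in_itv /= => /andP[_]; rewrite leNgt x_b.
Qed.

(** Insert the Abel factor, apply the multiplication formula, and let the
    factor tend to 1. On the other side appears the Poisson integral of the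
    box, which is bounded, explicit, and converges to [c2pi] times the
    indicator off the sides. The limit is thus taken on the box and not on
    [f], which has no regularity. *)
Lemma parseval_box f (a b : plane R) : cintg leb2 f -> l2 f ->
  (a.1 : R) < b.1 -> (a.2 : R) < b.2 ->
  cint leb2 (fun xi => fourier1 f xi * conjc (fourier1 (cindic (box a b)) xi)) =
  c2pi%:C * cint leb2 (fun x => f x * cindic (box a b) x).
Proof.
move=> fi lf ab1 ab2.
pose chi := cindic (box a b).
have ci : cintg leb2 chi by exact: cintg_box.
have lchi : l2 chi by exact: l2_box.
have [lT _] := bessel ci lchi; have [lTf _] := bessel fi lf.
pose e n : R := n.+1%:R^-1.
have e0 n : 0 < e n by rewrite /e.
pose Q n x := poisson_box (e n) a.1 b.1 x.1 * poisson_box (e n) a.2 b.2 x.2.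
pose h n xi := conjc (fourier1 chi xi) * (abel2 (e n) xi)%:C.
have mab n : measurable_fun setT (abel2 (e n)) by exact: rintg_meas (rintg_abel2 (e0 n)).
have hi n : cintg leb2 (h n).
  apply: (cintg_abel2M (e0 n) (cmeas_conj lT.1)) => xi.
  by rewrite cmod_conj; exact: cmod_fourier1.
have Th n x : fourier1 (h n) x = (Q n x)%:C.
  have iA : cintg leb2 (fun xi => fourier1 chi xi * (cis (dot x xi) * (abel2 (e n) xi)%:C)).
    under eq_fun do rewrite mulrCA; apply: (cintg_cisM (measurable_dotl x)).
    by apply: (cintg_abel2M (e0 n) lT.1) => xi; exact: cmod_fourier1.
  transitivity (conjc (cint leb2 (fun xi => fourier1 chi xi *
      (cis (dot x xi) * (abel2 (e n) xi)%:C)))).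
    rewrite -cint_conj//; apply: eq_cint => xi.
    by rewrite /h !conjM conj_cis conj_real dotC; ring.
  rewrite abel_mean//.
  have [i1 e1] := rint_poisson_box x.1 (e0 n) ab1.
  have [i2 e2] := rint_poisson_box x.2 (e0 n) ab2.
  have [i12 e12] := leb2_tensor_rint i1 i2.
  have Ey y : chi y * (poisson2 (e n) (prefl x y))%:C =
    ((\1_(`]a.1, b.1]) (y.1 : R) * poisson (e n) ((y.1 : R) - x.1)) *
     (\1_(`]a.2, b.2]) (y.2 : R) * poisson (e n) ((y.2 : R) - x.2)))%:C.
    rewrite poisson2C /chi /cindic indic_box /poisson2 /prefl /=.
    by apply: complexP => /=; ring.
  rewrite (eq_cint _ Ey); apply: complexP => /=.
    by rewrite e12 e1 e2.
  by rewrite /Rintegral integral0 /= oppr0.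
pose u1 xi := fourier1 f xi * conjc (fourier1 chi xi).
have iu1 : cintg leb2 u1 by exact: (cintgM_l2 lTf (l2_conj lT)).1.
have E n : cint leb2 (fun xi => (abel2 (e n) xi)%:C * u1 xi) =
           cint leb2 (fun x => (Q n x)%:C * f x).
  transitivity (cint leb2 (fun xi => fourier1 f xi * h n xi)).
    by apply: eq_cint => xi; rewrite /u1 /h; ring.
  rewrite multiplication_formula//.
  by apply: eq_cint => x; rewrite Th mulrC.
have cL xi : abel2 (e n) xi @[n --> \oo] --> (1 : R) by exact: abel2_cvg.
pose Q0 x := sgbox a.1 b.1 x.1 * sgbox a.2 b.2 x.2.
have cQ x : Q n x @[n --> \oo] --> Q0 x.
  by apply: cvgM; exact: poisson_box_cvg.
have mQ n : measurable_fun setT (Q n).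
  have ma (c : R) : measurable_fun setT (fun t : R => atan ((c - t) / e n)).
    apply: (measurableT_comp (f := @atan R)).
      by apply: continuous_measurable_fun => t; exact: continuous_atan.
    apply: measurable_funM; last exact: measurable_cst.
    by apply: measurable_funB => //; exact: measurable_cst.
  have mp (c d : R) : measurable_fun setT (poisson_box (e n) c d).
    apply: measurable_funM; first exact: measurable_cst.
    by apply: measurable_funB; exact: ma.
  apply: measurable_funM.
    exact: (measurableT_comp (mp a.1 b.1) measurable_pfst).
  exact: (measurableT_comp (mp a.2 b.2) measurable_psnd).
have bQ n x : `|Q n x| <= (2 * pi) * (2 * pi).
  by rewrite normrM; apply: ler_pM => //; exact: poisson_box_le.
have bA n xi : `|abel2 (e n) xi| <= 1.
  by rewrite ger0_norm ?abel2_ge0// abel2_le1// ltW.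
have [LR LI] := cint_dominated_real mab bA cL iu1.
have [RR RI] := cint_dominated_real mQ bQ cQ fi.
have -> : cint leb2 (fun xi => fourier1 f xi * conjc (fourier1 chi xi)) =
          cint leb2 (fun xi => (1 : R)%:C * u1 xi).
  by apply: eq_cint => xi; rewrite /u1 mul1r.
have -> : cint leb2 (fun xi => (1 : R)%:C * u1 xi) = cint leb2 (fun x => (Q0 x)%:C * f x).
  apply: complexP.
    by move: LR; under eq_fun do rewrite E; move=> LR; exact: (cvg_unique _ LR RR).
  by move: LI; under eq_fun do rewrite E; move=> LI; exact: (cvg_unique _ LI RI).
rewrite -cintZ; last exact: (cintgM_l2 lf lchi).1.
have mf := lf.1; have mQ0 : measurable_fun setT Q0.
  by apply: (measurable_fun_cvg mQ) => x _; exact: cQ.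
apply: cint_ae.
- apply: filterS (ae_off_lines a b) => x [x1 x2 x3 x4] _.
  rewrite /Q0 !sgboxE// /cindic indic_box /c2pi.
  by move: (f x) => [p q]; apply: complexP => /=; ring.
- by apply: cmeasM => //; exact: cmeas_real.
- apply: cmeasM; first exact: cmeas_cst.
  by apply: cmeasM => //; exact: lchi.1.
Qed.

End inversion.

(** * Fourier inversion in L^2 *)

Section Fourier_inversion.
Context {R : realType}.
Implicit Types (f g h u : plane R -> R[i]) (x y xi : plane R).

(** [null_of_box_integrals], applied to the real and to the imaginary part.
    Degenerate boxes are empty. *)
Lemma null_of_box_cint h : l2 h ->
  (forall a b : plane R, (a.1 : R) < b.1 -> (a.2 : R) < b.2 ->
    cint leb2 (fun x => h x * cindic (box a b) x) = 0) ->
  h = (fun=> 0) %[ae leb2].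
Proof.
move=> lh hb.
have ER (p : R[i] -> R) (pm : forall z (c : R), p (z * c%:C) = p z * c) :
    (forall f, cintg leb2 f -> rintg leb2 (fun x => p (f x))) ->
    (forall a b : plane R, (a.1 : R) < b.1 -> (a.2 : R) < b.2 ->
      \int[leb2]_x p (h x * cindic (box a b) x) = 0) ->
    (fun x => p (h x)) = (fun=> 0) %[ae leb2].
  move=> pi0 p0; apply: null_of_box_integrals => _ _ [[a1 b1] _ <-] [[a2 b2] _ <-] /=.
  pose a : plane R := (a1, a2); pose b : plane R := (b1, b2).
  have mB : measurable (box a b) by exact: measurable_box.
  rewrite -[X in leb2.-integrable X _]/(box a b) -[X in Rintegral _ X]/(box a b).
  have E : (fun x => p (h x * cindic (box a b) x)) = (fun x => p (h x)) \_ (box a b).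
    by apply/funext => x; rewrite pm patchE indicE; case: (_ \in _); rewrite ?mulr1 ?mulr0.
  have ii : rintg leb2 (fun x => p (h x * cindic (box a b) x)).
    by apply: pi0; exact: (cintgM_l2 lh (l2_box a b)).1.
  split.
    apply/(integrable_mkcond _ mB); move: ii; rewrite /rintg E.
    by rewrite restrict_EFin.
  rewrite Rintegral_mkcond -E.
  have [ab1|ba1] := ltP a1 b1; last first.
    have -> : box a b = set0.
      by rewrite /box /= (@set_itv_ge _ _ (BRight a1)) ?set0X// bnd_simp -leNgt.
    rewrite /cindic; under eq_Rintegral do rewrite indic0 pm mulr0.
    by rewrite /Rintegral integral0.
  have [ab2|ba2] := ltP a2 b2; last first.
    have -> : box a b = set0.
      by rewrite /box /= (@set_itv_ge _ _ (BRight a2)) ?setX0// bnd_simp -leNgt.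
    rewrite /cindic; under eq_Rintegral do rewrite indic0 pm mulr0.
    by rewrite /Rintegral integral0.
  exact: p0.
have hR : (fun x => complex.Re (h x)) = (fun=> 0) %[ae leb2].
  apply: (ER (@complex.Re R)).
  - by move=> z c; rewrite ReM /= mulr0 subr0.
  - by move=> f [].
  - by move=> a b ab1 ab2; have := hb a b ab1 ab2 => /(congr1 (@complex.Re R)).
have hI : (fun x => complex.Im (h x)) = (fun=> 0) %[ae leb2].
  apply: (ER (@complex.Im R)).
  - by move=> z c; rewrite ImM /= mulr0 add0r.
  - by move=> f [].
  - by move=> a b ab1 ab2; have := hb a b ab1 ab2 => /(congr1 (@complex.Im R)).
by apply: filterS2 hR hI => x h1 h2 _; apply: complexP; [exact: h1|exact: h2].
Qed.

Lemma parseval_box_l2 f g (a b : plane R) : is_fourier f g ->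
  (a.1 : R) < b.1 -> (a.2 : R) < b.2 ->
  cint leb2 (fun xi => g xi * conjc (fourier1 (cindic (box a b)) xi)) =
  c2pi%:C * cint leb2 (fun x => f x * cindic (box a b) x).
Proof.
move=> /is_fourierP[lf lg [F [hF F1 F2]]] ab1 ab2.
have lT n : l2 (fourier1 (F n)) by exact: (bessel (hF n).1 (hF n).2).1.
have lchi := l2_conj (bessel (cintg_box a b) (l2_box a b)).1.
apply: (@cmod_lim_unique _ (fun n => cint leb2 (fun xi => fourier1 (F n) xi *
  conjc (fourier1 (cindic (box a b)) xi)))).
  exact: (cint_cvg_l2 lT lg lchi F2).
have h := cint_cvg_l2 (fun n => (hF n).2) lf (l2_box a b) F1.
under eq_fun do rewrite (parseval_box (hF _).1 (hF _).2 ab1 ab2) -mulrBr cmodM.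
by have := cvgM (cvg_cst (cmod c2pi%:C)) h; rewrite mulr0; exact.
Qed.

(** Up to conjugation and normalisation the transform is its own inverse: both
    sides have the same pairing with every box, by duality on the one hand and
    Parseval's identity on the other. *)
Lemma is_fourier_inversion f g : is_fourier f g ->
  is_fourier (fun xi => conjc (g xi)) (fun x => c2pi%:C * conjc (f x)).
Proof.
move=> fg; have [lf lg] := is_fourier_l2 fg.
have lcf := l2_conj lf; have lcg := l2_conj lg.
have [k hk] := is_fourier_exists lcg; have [_ lk] := is_fourier_l2 hk.
have lcc : l2 (fun x => c2pi%:C * conjc (f x)) by exact: l2Z.
apply: (is_fourier_ae hk) => //; first exact: aeW.
have : (fun x => k x - c2pi%:C * conjc (f x)) = (fun=> 0) %[ae leb2].
  apply: null_of_box_cint; first exact: l2B.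
  move=> a b ab1 ab2.
  have lb := l2_box a b.
  have i1 := (cintgM_l2 lk lb).1; have i2 := (cintgM_l2 lcc lb).1.
  have i3 := (cintgM_l2 lf lb).1.
  have -> : cint leb2 (fun x => (k x - c2pi%:C * conjc (f x)) * cindic (box a b) x) =
      cint leb2 (fun x => k x * cindic (box a b) x) -
      cint leb2 (fun x => c2pi%:C * conjc (f x) * cindic (box a b) x).
    by rewrite -cintB//; apply: eq_cint => x; rewrite mulrBl.
  have dual := is_fourier_duality hk (is_fourier_L1 (cintg_box a b) lb).
  have lT := (bessel (cintg_box a b) lb).1.
  have par := parseval_box_l2 fg ab1 ab2.
  have -> : cint leb2 (fun x => k x * cindic (box a b) x) =
      conjc (cint leb2 (fun xi => g xi * conjc (fourier1 (cindic (box a b)) xi))).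
    rewrite dual -cint_conj; last exact: (cintgM_l2 lg (l2_conj lT)).1.
    by apply: eq_cint => xi; rewrite conjM conjK.
  rewrite par conjM conj_real -cint_conj// -cintZ; last exact: cintg_conj.
  rewrite (@eq_cint _ _ _ _ _
    (fun x => c2pi%:C * conjc (f x) * cindic (box a b) x)) ?subrr//.
  by move=> x; rewrite conjM conj_real mulrA.
by apply: filterS => x h _; apply/eqP; rewrite -subr_eq0 h.
Qed.

Lemma c2pi_neq0 : (@c2pi R)%:C != 0 :> R[i].
Proof. by apply/eqP => /(congr1 (@complex.Re R)) /= /eqP; rewrite gt_eqF// c2pi_gt0. Qed.

Lemma is_fourier_surj g : l2 g -> exists f, is_fourier f g.
Proof.
move=> lg; have [k hk] := is_fourier_exists (l2_conj lg).
exists (fun x => (c2pi%:C)^-1 * conjc (k x)).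
have := is_fourierZ (c2pi%:C)^-1 (is_fourier_inversion hk).
rewrite (_ : (fun xi => _ * (_ * _)) = g)//.
by apply/funext => xi; rewrite conjK mulrA mulVf ?c2pi_neq0// mul1r.
Qed.

Lemma is_fourier_inj f f' g g' : is_fourier f g -> is_fourier f' g' ->
  (g = g' %[ae leb2]) -> f = f' %[ae leb2].
Proof.
move=> h h' gg'; have [lf lg] := is_fourier_l2 h; have [lf' lg'] := is_fourier_l2 h'.
have k := is_fourier_inversion h; have k' := is_fourier_inversion h'.
have k'' : is_fourier (fun xi => conjc (g xi)) (fun x => c2pi%:C * conjc (f' x)).
  apply: (is_fourier_ae k').
  - exact: l2_conj.
  - by apply: l2Z; exact: l2_conj.
  - by apply: filterS gg' => x e _; rewrite e.
  - exact: aeW.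
have := is_fourier_fun k k''; apply: filterS => x /(_ Logic.I) e _.
by rewrite -[f x]conjK -[f' x]conjK; congr conjc; exact: (mulfI c2pi_neq0 e).
Qed.

Lemma is_fourier_ge f g : is_fourier f g -> c2pi * sq f <= 4 * sq g.
Proof.
move=> h; have [lf lg] := is_fourier_l2 h.
have := is_fourier_le (is_fourier_inversion h).
rewrite sqZ ?sq_conj; last exact: l2_conj.
rewrite nsq_real expr2 -mulrA [4 * _]mulrC -[c2pi * 4 * _]mulrA.
by rewrite ler_pM2l ?c2pi_gt0.
Qed.

Lemma fourier_spec f : l2 f -> is_fourier f (fourier f).
Proof. by move=> lf; exact: (xgetPex _ (is_fourier_exists lf)). Qed.

Lemma ifourier_spec g : l2 g -> is_fourier (ifourier g) g.
Proof. by move=> lg; exact: (xgetPex _ (is_fourier_surj lg)). Qed.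

(** On integrable functions the inverse transform is given by an integral. *)
Definition invf g : plane R -> R[i] :=
  fun x => (c2pi%:C)^-1 * cint leb2 (fun xi => cis (dot x xi) * g xi).

Lemma is_fourier_invf g : cintg leb2 g -> l2 g -> is_fourier (invf g) g.
Proof.
move=> gi lg; have h := is_fourier_L1 (cintg_conj gi) (l2_conj lg).
have := is_fourierZ (c2pi%:C)^-1 (is_fourier_inversion h).
rewrite (_ : (fun xi => _ * (_ * _)) = g); last first.
  by apply/funext => xi; rewrite conjK mulrA mulVf ?c2pi_neq0// mul1r.
rewrite (_ : (fun xi => _ * conjc _) = invf g)//.
apply/funext => x; congr (_ * _).
rewrite -[X in conjc X]/(cint leb2 (fun xi => cis (- dot xi x) * conjc (g xi))).
rewrite -cint_conj; last by apply: cintg_fourier; exact: cintg_conj.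
by apply: eq_cint => xi; rewrite conjM conj_cis opprK conjK dotC.
Qed.

Lemma multiplier_spec (m : plane R -> R) f : l2 f -> l2 (symb_mul m f) ->
  is_fourier (multiplier m f) (symb_mul m f).
Proof. by move=> lf lm; exact: ifourier_spec. Qed.

End Fourier_inversion.

(** * Uniqueness for the linear evolution *)

Section energy_argument.
Context {R : realType}.

(** The even extension is differentiable with zero derivative on the whole
    line, which disposes of the one-sided derivative at 0. *)
Lemma constant_of_zero_deriv (E : R -> R) :
  (forall t : R, 0 <= t -> forall e : R, 0 < e -> exists2 d : R, 0 < d &
    forall h : R, `|h| < d -> 0 <= t + h -> `|E (t + h) - E t| <= e * `|h|) ->
  forall t : R, 0 <= t -> E t = E 0.
Proof.
move=> hE t t0.
pose F (s : R) : R := E `|s|.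
have hF (s : R) : is_derive s (1 : R) F 0.
  have hc : (h^-1 *: (F (h *: (1 : R) + s) - F s) : R) @[h --> 0^'] --> (0 : R).
    apply/cvgrPdist_le => e e0.
    have [d d0 hd] := hE `|s| (normr_ge0 s) e e0.
    near=> h.
    have hn0 : h != 0 by near: h; exact: nbhs_dnbhs_neq.
    have hd1 : `|h| < d.
      near: h; apply: nbhs_dnbhs; exists d => //= z /=.
      by rewrite /ball_ /= sub0r normrN.
    rewrite sub0r normrN /GRing.scale /= mulr1 normrM normfV.
    rewrite ler_pdivrMl ?normr_gt0// mulrC /F.
    pose k := `|h + s| - `|s|.
    have kh : `|k| <= `|h|.
      apply: (le_trans (ler_dist_dist _ _)).
      by rewrite addrK.
    have -> : `|h + s| = `|s| + k by rewrite /k; ring.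
    apply: (le_trans (hd k _ _)).
    - exact: le_lt_trans kh hd1.
    - by rewrite /k addrC subrK.
    - by rewrite ler_pM2l.
  by apply: DeriveDef; [apply/cvg_ex; exists 0|exact/cvg_lim].
have := @is_derive_0_is_cst _ F t 0 hF.
by rewrite /F normr0 ger0_norm.
Unshelve. all: by end_near. Qed.

Lemma L2_deriv_sq (v : R -> plane R -> R[i]) (t : R) (dv : plane R -> R[i]) :
  (forall s, 0 <= s -> l2 (v s)) -> 0 <= t -> l2 dv -> L2_deriv v t dv ->
  forall e : R, 0 < e -> exists2 d : R, 0 < d & forall h : R, `|h| < d -> h != 0 ->
    0 <= t + h -> sq (fun x => (h^-1)%:C * (v (t + h) x - v t x) - dv x) <= e.
Proof.
move=> lv t0 ldv hd e e0.
have e1 : 0 < Num.sqrt e by rewrite sqrtr_gt0.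
have hf : fine (L2norm (fun x => (h^-1)%:C * (v (t + h) x - v t x) - dv x))
    @[h --> within [set h | 0 <= t + h] 0^'] --> (0 : R) by exact: (fine_cvg hd).
move/cvgrPdist_le : hf => /(_ _ e1).
rewrite near_withinE => -[d /= d0 hd'].
exists d => // h hh hn0 th.
have := hd' h; rewrite /ball_ /= sub0r normrN => /(_ hh hn0 th).
have ll : l2 (fun x => (h^-1)%:C * (v (t + h) x - v t x) - dv x).
  by apply: l2B => //; apply: l2Z; apply: l2B; exact: lv.
rewrite L2normE// /= sub0r normrN ger0_norm ?sqrtr_ge0// => h1.
by rewrite -(@ler_sqrt _ _ e) ?sq_ge0// ltW.
Qed.

(** First-order expansion of the energy: the term linear in [h] vanishes
    because the velocity [B] is orthogonal to [D] pointwise. *)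
Lemma sq_re_bound (D B d : plane R -> R[i]) (h k : R) : l2 D -> l2 B -> l2 d ->
  0 < k -> (forall x, complex.Re (D x * conjc (B x)) = 0) ->
  `|sq (fun x => D x + h%:C * (B x + d x)) - sq D| <=
    `|h| * (k * sq D + k^-1 * sq d) + h ^+ 2 * (2 * sq B + 2 * sq d).
Proof.
move=> lD lB ld k0 orth.
have lBd := l2D lB ld.
have lS : l2 (fun x => D x + h%:C * (B x + d x)) by apply: l2D => //; exact: l2Z.
have [_ iD] := lD; have [_ iB] := lB; have [_ iid] := ld; have [_ iS] := lS.
have iN := rintgD iS (rintgZ (-1) iD).
have -> : sq (fun x => D x + h%:C * (B x + d x)) - sq D =
    \int[leb2]_x (nsq (D x + h%:C * (B x + d x)) + -1 * nsq (D x)).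
  by rewrite (rintD iS (rintgZ (-1) iD)) (rintZ (-1) iD) mulN1r.
have i1 := rintgD (rintgZ k iD) (rintgZ k^-1 iid).
have i2 := rintgD (rintgZ 2 iB) (rintgZ 2 iid).
have -> : `|h| * (k * sq D + k^-1 * sq d) + h ^+ 2 * (2 * sq B + 2 * sq d) =
    \int[leb2]_x (`|h| * (k * nsq (D x) + k^-1 * nsq (d x)) +
                  h ^+ 2 * (2 * nsq (B x) + 2 * nsq (d x))).
  rewrite (rintD (rintgZ `|h| i1) (rintgZ (h ^+ 2) i2)) (rintZ `|h| i1).
  rewrite (rintZ (h ^+ 2) i2) (rintD (rintgZ k iD) (rintgZ k^-1 iid)).
  by rewrite (rintD (rintgZ 2 iB) (rintgZ 2 iid)) !rintZ.
apply: (le_trans (le_normr_Rintegral measurableT iN)).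
apply: le_rint; first exact: rintg_norm.
  by apply: rintgD; apply: rintgZ.
move=> x; have ox := orth x.
have -> : nsq (D x + h%:C * (B x + d x)) + -1 * nsq (D x) =
    h * (2 * complex.Re (D x * conjc (d x))) + h ^+ 2 * nsq (B x + d x).
  move: ox; move: (D x) (B x) (d x) => [a b] [p q] [u w]; rewrite /nsq /= => ox.
  have -> : h * (2 * (a * u - b * - w)) =
    h * (2 * (a * u - b * - w)) + 2 * h * (a * p - b * - q) by rewrite ox; ring.
  ring.
apply: (le_trans (ler_normD _ _)); apply: lerD.
  rewrite normrM; apply: ler_wpM2l => //.
  rewrite normrM ger0_norm// mulrC -ler_pdivlMr//.
  apply: (le_trans (Re_le_cmod _)); rewrite cmodM cmod_conj.
  exact: cmodM_le.
rewrite ger0_norm; last by apply: mulr_ge0; [exact: sqr_ge0|exact: nsq_ge0].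
by apply: ler_wpM2l; [exact: sqr_ge0|exact: nsqD_le].
Qed.

Lemma l2_ae (f g : plane R -> R[i]) : l2 f -> cmeas g -> (f = g %[ae leb2]) -> l2 g.
Proof.
move=> /l2P[mf ff] mg fg; apply/l2P; split => //.
rewrite (_ : (\int[leb2]_x _ = \int[leb2]_x (nsq (f x))%:E)%E)//.
apply: ae_eq_integral => //.
- by apply/measurable_EFinP; exact: measurable_nsq.
- by apply/measurable_EFinP; exact: measurable_nsq.
- by apply: filterS fg => x h _ /=; rewrite h.
Qed.

(** The difference of two solutions solves the homogeneous equation, whose
    velocity on the Fourier side is [- i lam] times the unknown. As [lam] is
    real, this is pointwise orthogonal to the unknown, so the energy is
    constant. The derivative is controlled by applying [is_fourier_le] to the
    difference quotient. *)
Lemma evol_unique (lam : plane R -> R) (v1 v2 N1 N2 : R -> plane R -> R[i]) :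
  evol_eq lam v1 N1 -> evol_eq lam v2 N2 ->
  (forall t, 0 <= t -> N1 t = N2 t %[ae leb2]) ->
  (v1 0 = v2 0 %[ae leb2]) ->
  forall t, 0 <= t -> v1 t = v2 t %[ae leb2].
Proof.
move=> ev1 ev2 N12 v12.
have lv1 t : 0 <= t -> l2 (v1 t) by move=> /ev1[[/L2P]].
have lv2 t : 0 <= t -> l2 (v2 t) by move=> /ev2[[/L2P]].
pose D t xi := fourier (v1 t) xi - fourier (v2 t) xi.
have hD t : 0 <= t -> is_fourier (fun x => v1 t x - v2 t x) (D t).
  by move=> t0; apply: is_fourierB; apply: fourier_spec; [exact: lv1|exact: lv2].
have lD t : 0 <= t -> l2 (D t) by move=> /hD /is_fourier_l2[].
suff E0 t : 0 <= t -> sq (D t) = sq (D 0).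
  move=> t t0.
  have z0 : sq (D 0) = 0.
    apply/eqP; rewrite eq_le sq_ge0 andbT.
    apply: (le_trans (is_fourier_le (hD 0 (lexx 0)))).
    by rewrite (ae_sqB (lv1 0 (lexx 0)) (lv2 0 (lexx 0))).1// mulr0.
  apply/(ae_sqB (lv1 t t0) (lv2 t t0)); apply/eqP; rewrite eq_le sq_ge0 andbT.
  have := is_fourier_ge (hD t t0); rewrite E0// z0 mulr0.
  by rewrite pmulr_rle0 ?c2pi_gt0.
move: t; apply: (@constant_of_zero_deriv (fun t => sq (D t))) => t t0 e e0.
have [[/L2P l1 /L2P m1] [dv1 [/L2P ld1 d1 n1]]] := ev1 t t0.
have [[/L2P l2' /L2P m2] [dv2 [/L2P ld2 d2 n2]]] := ev2 t t0.
pose B xi := - 'i%C * ((lam xi)%:C * D t xi).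
have hB : is_fourier (fun x => dv1 x - dv2 x) B.
  have h1 := multiplier_spec l1 m1; have h2 := multiplier_spec l2' m2.
  have h3 := is_fourierZ (- 'i%C) (is_fourierB h1 h2).
  apply: (is_fourier_ae h3).
  - exact: l2B.
  - rewrite (_ : B = fun xi => - 'i%C * (symb_mul lam (v1 t) xi - symb_mul lam (v2 t) xi)).
      by apply: l2Z; exact: l2B.
    by apply/funext => xi; rewrite /B /D /symb_mul; ring.
  - have n12 := N12 t t0.
    apply: filterS3 n1 n2 n12 => x a1 a2 a3 _.
    have := a1 Logic.I; rewrite (a3 Logic.I) -(a2 Logic.I).
    move: (dv1 x) (dv2 x) (multiplier lam (v1 t) x) (multiplier lam (v2 t) x).
    move=> p q r s prqs.
    have -> : p = q + 'i%C * s - 'i%C * r by rewrite -prqs addrK.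
    by ring.
  - by apply/aeW => xi _; rewrite /B /D /symb_mul; ring.
have [_ lB] := is_fourier_l2 hB.
have orth xi : complex.Re (D t xi * conjc (B xi)) = 0.
  by rewrite /B; move: (D t xi) => [p q] /=; ring.
have ED := sq_ge0 (D t); have EB := sq_ge0 B.
pose k := e / 4 / (sq (D t) + 1).
have k0 : 0 < k by rewrite !divr_gt0// ltr_wpDl.
have kE : k * sq (D t) <= e / 4.
  rewrite /k mulrAC ler_pdivrMr ?ltr_wpDl//; apply: ler_wpM2l; last by rewrite lerDl.
  by rewrite divr_ge0// ltW.
(* The energy remainder is at most |h| e / 2 from the terms linear in |h|, by
   the choice of k and of eta, and |h| e / 2 from the quadratic ones, by that
   of d3; eta' absorbs the constant of is_fourier_le. *)
pose eta := Num.min (k * (e / 4)) 1.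
have eta0 : 0 < eta by rewrite lt_min ltr01 andbT mulr_gt0// divr_gt0.
pose eta' := eta / (16 * c2pi).
have c0 := @c2pi_gt0 R.
have eta'0 : 0 < eta' by rewrite divr_gt0// mulr_gt0.
have [d1' d10 hd1] := L2_deriv_sq lv1 t0 ld1 d1 eta'0.
have [d2' d20 hd2] := L2_deriv_sq lv2 t0 ld2 d2 eta'0.
pose d3 := e / 2 / (2 * sq B + 2).
have d30 : 0 < d3 by rewrite !divr_gt0// ltr_wpDl// mulr_ge0.
exists (Num.min d1' (Num.min d2' d3)); first by rewrite !lt_min d10 d20.
move=> h; rewrite !lt_min => /and3P[h1 h2 h3] th.
have [->|hn0] := eqVneq h 0; first by rewrite addr0 subrr normr0 mulr0.
pose del xi := (h^-1)%:C * (D (t + h) xi - D t xi) - B xi.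
have hdel : is_fourier (fun x =>
    (h^-1)%:C * ((v1 (t + h) x - v2 (t + h) x) - (v1 t x - v2 t x)) - (dv1 x - dv2 x)) del.
  by apply: is_fourierB => //; apply: is_fourierZ; apply: is_fourierB; exact: hD.
have [_ ldel] := is_fourier_l2 hdel.
have Sdel : sq del <= eta.
  apply: (le_trans (is_fourier_le hdel)).
  rewrite (_ : (fun x => _) = fun x => ((h^-1)%:C * (v1 (t + h) x - v1 t x) - dv1 x) -
      ((h^-1)%:C * (v2 (t + h) x - v2 t x) - dv2 x)); last by apply/funext => x; ring.
  have la : l2 (fun x => (h^-1)%:C * (v1 (t + h) x - v1 t x) - dv1 x).
    by apply: l2B => //; apply: l2Z; apply: l2B => //; exact: lv1.
  have lb : l2 (fun x => (h^-1)%:C * (v2 (t + h) x - v2 t x) - dv2 x).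
    by apply: l2B => //; apply: l2Z; apply: l2B => //; exact: lv2.
  have := sqB_le la lb; have := hd1 h h1 hn0 th; have := hd2 h h2 hn0 th.
  set s1 := sq _; set s2 := sq _; set s3 := sq _ => a1 a2 a3.
  have : s3 <= 4 * eta' by lra.
  have -> : eta = 4 * c2pi * (4 * eta') by rewrite /eta'; field; rewrite gt_eqF.
  by move=> a4; rewrite ler_wpM2l// mulr_ge0// ltW.
have -> : D (t + h) = fun xi => D t xi + h%:C * (B xi + del xi).
  apply/funext => xi; rewrite /del [B xi + _]addrC subrK mulrA.
  have -> : h%:C * h^-1%:C = 1 :> R[i].
    by apply: complexP => /=; rewrite ?mulr0 ?mul0r ?subr0 ?addr0// mulfV.
  by ring.
apply: (le_trans (sq_re_bound h (lD t t0) lB ldel k0 orth)).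
have S1 : k^-1 * sq del <= e / 4.
  rewrite ler_pdivrMl//; apply: (le_trans Sdel).
  by rewrite /eta ge_min lexx.
have S2 : sq del <= 1 by apply: (le_trans Sdel); rewrite /eta ge_min lexx orbT.
have -> : h ^+ 2 = `|h| * `|h| by rewrite -expr2 real_normK ?num_real.
rewrite -[`|h| * `|h| * _]mulrA -mulrDr [leRHS]mulrC; apply: ler_wpM2l => //.
have S3 : `|h| * (2 * sq B + 2 * sq del) <= e / 2.
  apply: (@le_trans _ _ (d3 * (2 * sq B + 2))); last first.
    by rewrite /d3 mulfVK// gt_eqF// ltr_wpDl// mulr_ge0.
  apply: ler_pM => //; [|exact: ltW|by lra].
  by have := sq_ge0 del; lra.
by lra.
Qed.

End energy_argument.

(** * Existence for the linear evolution *)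

Section evolution_of_symbols.
Context {R : realType}.

Lemma dominated_L1L2 (f : plane R -> R[i]) (G : plane R -> R) (M : R) :
  cmeas f -> rintg leb2 G -> rintg leb2 (fun x => G x ^+ 2) ->
  (forall x, cmod (f x) <= M * G x) -> cintg leb2 f /\ l2 f.
Proof.
move=> mf iG iG2 fG; split; first exact: (cintg_le mf fG (rintgZ M iG)).
apply: (l2_le mf _ (rintgZ (M ^+ 2) iG2)) => x; rewrite -exprMn.
by apply: cmod_ge => //; apply: le_trans (fG x); exact: cmod_ge0.
Qed.

(** A curve of symbols [A] that is differentiable in time uniformly with
    respect to a fixed profile [G], with derivative [B = - i lam A + Nh],
    transforms to a solution: the remainder of order [h ^ 2] becomes an L^2
    estimate of the difference quotient through [is_fourier_ge]. *)
Lemma evol_of_symbol (lam G : plane R -> R) (Lam : R)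
    (A B Nh N : R -> plane R -> R[i]) :
  measurable_fun setT lam -> rintg leb2 G -> rintg leb2 (fun x => G x ^+ 2) ->
  (forall xi, `|lam xi| * G xi <= Lam * G xi) ->
  (forall t, cmeas (A t)) ->
  (forall t, exists2 M, 0 <= M & forall xi, cmod (A t xi) <= M * G xi) ->
  (forall t, exists M, forall h xi,
    cmod (A (t + h) xi - A t xi - h%:C * B t xi) <= M * h ^+ 2 * G xi) ->
  (forall t xi, B t xi = - 'i%C * ((lam xi)%:C * A t xi) + Nh t xi) ->
  (forall t, is_fourier (N t) (Nh t)) ->
  evol_eq lam (fun t => invf (A t)) N.
Proof.
move=> mlam iG iG2 lamG mA AM AB BE hN t t0.
have hA s : cintg leb2 (A s) /\ l2 (A s).
  by have [M _ hM] := AM s; exact: dominated_L1L2 (mA s) iG iG2 hM.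
have lamA s : cintg leb2 (fun xi => (lam xi)%:C * A s xi) /\
    l2 (fun xi => (lam xi)%:C * A s xi).
  have [M M0 hM] := AM s; apply: (@dominated_L1L2 _ G (M * Lam)) => //.
    by apply: cmeasM => //; exact: cmeas_real.
  move=> xi; rewrite cmodM cmod_real.
  apply: (le_trans (ler_wpM2l (normr_ge0 _) (hM xi))).
  by rewrite mulrCA -mulrA; apply: ler_wpM2l.
have fA s := is_fourier_invf (hA s).1 (hA s).2.
have lv s : l2 (invf (A s)) by have [] := is_fourier_l2 (fA s).
have flam := is_fourier_invf (lamA t).1 (lamA t).2.
have fae : symb_mul lam (invf (A t)) = (fun xi => (lam xi)%:C * A t xi) %[ae leb2].
  have := is_fourier_fun (fourier_spec (lv t)) (fA t).
  by apply: filterS => xi e _; rewrite /symb_mul e.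
have lsym : l2 (symb_mul lam (invf (A t))).
  apply: (l2_ae (lamA t).2).
    apply: cmeasM; first exact: cmeas_real.
    by have [_ []] := is_fourier_l2 (fourier_spec (lv t)).
  by apply: filterS fae => xi e _; rewrite e.
have [lN lNh] := is_fourier_l2 (hN t).
have lB : l2 (B t).
  rewrite (_ : B t = fun xi => - 'i%C * ((lam xi)%:C * A t xi) + Nh t xi).
    by apply: l2D => //; apply: l2Z; exact: (lamA t).2.
  by apply/funext => xi; rewrite BE.
have [dv fdv] := is_fourier_surj lB; have [ldv _] := is_fourier_l2 fdv.
split; first by split; exact/L2P.
exists dv; split; first exact/L2P.
- have lw h : l2 (fun x => (h^-1)%:C * (invf (A (t + h)) x - invf (A t) x) - dv x).
    by apply: l2B => //; apply: l2Z; exact: l2B.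
  apply/L2norm_cvg0 => //.
  have [M hM] := AB t.
  (* the constant of is_fourier_ge, applied to the remainder M |h| G *)
  pose K := c2pi^-1 * (4 * (M ^+ 2 * \int[leb2]_x (G x ^+ 2))).
  apply: (@squeeze_cvgr _ _ _ _ (fun=> 0) (fun h : R => K * h ^+ 2)).
  + rewrite near_withinE; near=> h => th; rewrite sq_ge0 /=.
    have hn0 : h != 0 by near: h; exact: nbhs_dnbhs_neq.
    have fr := is_fourierB (is_fourierZ (h^-1)%:C (is_fourierB (fA (t + h)) (fA t))) fdv.
    rewrite -(@ler_pM2l _ c2pi) ?c2pi_gt0//.
    apply: (le_trans (is_fourier_ge fr)).
    have -> : c2pi * (K * h ^+ 2) = 4 * (M ^+ 2 * h ^+ 2 * \int[leb2]_x (G x ^+ 2)).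
      by rewrite /K; field; rewrite gt_eqF ?c2pi_gt0.
    rewrite ler_pM2l// -(rintZ _ iG2).
    have [_ lr] := is_fourier_l2 fr; have [_ ir] := lr.
    apply: le_rint => //; first exact: rintgZ.
    move=> xi.
    have -> : M ^+ 2 * h ^+ 2 * G xi ^+ 2 = (M * `|h| * G xi) ^+ 2.
      by rewrite !exprMn real_normK ?num_real.
    have bd : cmod ((h^-1)%:C * (A (t + h) xi - A t xi) - B t xi) <= M * `|h| * G xi.
      have -> : (h^-1)%:C * (A (t + h) xi - A t xi) - B t xi =
          (h^-1)%:C * (A (t + h) xi - A t xi - h%:C * B t xi).
        have hh : (h^-1)%:C * h%:C = 1 :> R[i].
          by apply: complexP => /=; rewrite ?mulr0 ?mul0r ?subr0 ?addr0// mulVf.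
        by rewrite [RHS]mulrBr [in RHS](mulrA _ h%:C) hh mul1r.
      rewrite cmodM cmod_real normfV mulrC ler_pdivrMr ?normr_gt0//.
      apply: (le_trans (hM h xi)).
      by rewrite -(real_normK (num_real h)) expr2; rewrite le_eqVlt; apply/orP; left; apply/eqP; ring.
    by apply: cmod_ge => //; apply: le_trans bd; exact: cmod_ge0.
  + exact: cvg_cst.
  + have h2 : K * h ^+ 2 @[h --> 0] --> K * 0 ^+ 2.
      by apply: cvgM; [exact: cvg_cst|exact: exprn_continuous].
    rewrite expr0n mulr0 in h2.
    by do 2 apply: cvg_within_filter.
- have fsum : is_fourier (fun x => dv x + 'i%C * multiplier lam (invf (A t)) x)
      (fun xi => B t xi + 'i%C * symb_mul lam (invf (A t)) xi).
    exact: is_fourier_lin fdv (multiplier_spec (lv t) lsym).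
  apply: (is_fourier_inj fsum (hN t)).
  apply: filterS fae => xi e _; rewrite (e Logic.I) BE.
  by move: (A t xi) (Nh t xi) ((lam xi)%:C) => p q r; ring.
Unshelve. all: by end_near. Qed.

End evolution_of_symbols.

(** * The oscillating kernel *)

Section oscillatory_kernel.
Context {R : realType}.
Implicit Types (t h w L W x d : R) (z : R[i]).

Lemma cmodD z1 z2 : cmod (z1 + z2 : R[i]) <= cmod z1 + cmod z2.
Proof.
apply: cmod_le; first by rewrite addr_ge0 ?cmod_ge0.
have := le_trans (ler_norm _) (Re_le_cmod (z1 * conjc z2)).
rewrite cmodM cmod_conj sqrrD !cmod_sqr.
case: z1 => a b; case: z2 => p q; rewrite /nsq /= => h.
have -> : (a + p) ^+ 2 + (b + q) ^+ 2 =
  (a ^+ 2 + b ^+ 2) + (a * p - b * - q) *+ 2 + (p ^+ 2 + q ^+ 2) by ring.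
by rewrite lerD2r lerD2l lerMn2r.
Qed.

Lemma MVT_le (f df : R -> R) x (M : R) :
  (forall s : R, is_derive s 1 f (df s)) -> (forall s : R, `|s| <= `|x| -> `|df s| <= M) ->
  `|f x - f 0| <= M * `|x|.
Proof.
move=> hd hM.
have cf : continuous f by move=> s; exact: (is_derive_continuous (hd s)).
have [x0|x0|->] := ltgtP x 0.
- have [c] := @MVT R f df x 0 x0 (fun s _ => hd s) (continuous_subspaceT cf).
  rewrite in_itv /= => /andP[c1 c2] e.
  rewrite distrC e normrM sub0r normrN ler_wpM2r//; apply: hM.
  by rewrite !ltr0_norm// lerN2 ltW.
- have [c] := @MVT R f df 0 x x0 (fun s _ => hd s) (continuous_subspaceT cf).
  rewrite in_itv /= => /andP[c1 c2] e.
  rewrite e normrM subr0 ler_wpM2r//; apply: hM.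
  by rewrite !gtr0_norm// ltW.
- by rewrite subrr normr0 mulr0.
Qed.

Lemma sin_abs_le x : `|sin x| <= `|x|.
Proof.
have := @MVT_le sin cos x 1 (fun s => is_derive_sin s) (fun s _ => cos_max s).
by rewrite sin0 subr0 mul1r.
Qed.

Lemma cosB1 x : 1 - cos x = 2 * sin (x / 2) ^+ 2.
Proof.
have {1}-> : x = x / 2 + x / 2 by field.
by rewrite cosD -!expr2 cos2sin2; ring.
Qed.

Lemma cosB1_le x : `|cos x - 1| <= `|x|.
Proof.
rewrite distrC cosB1 normrM ger0_norm// normrX.
have h1 := sin_abs_le (x / 2); have h2 := @sin_max R (x / 2).
rewrite normrM [`|2^-1|]ger0_norm// in h1.
have h3 : `|sin (x / 2)| ^+ 2 <= `|x| / 2.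
  rewrite expr2; apply: (@le_trans _ _ (`|sin (x / 2)| * 1)).
    by rewrite ler_wpM2l.
  by rewrite mulr1.
by lra.
Qed.

Lemma cosB1_sqr_le x : `|cos x - 1| <= x ^+ 2.
Proof.
rewrite distrC cosB1 normrM ger0_norm// normrX.
have h1 := sin_abs_le (x / 2).
have h2 : `|sin (x / 2)| ^+ 2 <= `|x / 2| ^+ 2 by apply: lerXn2r; rewrite ?nnegrE.
rewrite (real_normK (num_real (x / 2))) in h2.
have := sqr_ge0 x; have : (x / 2) ^+ 2 = x ^+ 2 / 4 by field.
by lra.
Qed.

Lemma sinBid_le x : `|sin x - x| <= x ^+ 2.
Proof.
have hd (s : R) : is_derive s 1 (fun s : R => sin s + -1 * s) (cos s + -1).
  exact: is_derive_fD (is_derive_sin s) (is_derive_lin (-1) s).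
have := @MVT_le _ _ x `|x| hd.
rewrite sin0 mulr0 addr0 subr0 mulN1r -expr2 real_normK ?num_real//; apply.
by move=> s sx; apply: le_trans sx; exact: cosB1_le.
Qed.

Lemma cisB1_le x : cmod (cis x - 1) <= 2 * `|x|.
Proof.
apply: (le_trans (cmod_le_ReIm _)) => /=; rewrite subr0.
by have := cosB1_le x; have := sin_abs_le x; lra.
Qed.

Lemma cis_taylor x : cmod (cis x - 1 - 'i%C * x%:C) <= 2 * x ^+ 2.
Proof.
apply: (le_trans (cmod_le_ReIm _)) => /=.
have -> : cos x - 1 - (0 * x - 1 * 0) = cos x - 1 by ring.
have -> : sin x - 0 - (0 * 0 + 1 * x) = sin x - x by ring.
by have := cosB1_sqr_le x; have := sinBid_le x; lra.
Qed.

(** The integral of [cis (s * w)] over s in [0, t]; the term with [w == 0]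
    restores the value at w = 0, where division returns 0. *)
Definition osc t w : R[i] :=
  (sin (t * w) / w + t * (w == 0)%:R) +i* ((1 - cos (t * w)) / w).

Lemma osc0 t : osc t 0 = t%:C.
Proof. by rewrite /osc eqxx invr0 !mulr0 add0r mulr1. Qed.

Lemma oscE t w : 'i%C * w%:C * osc t w = cis (t * w) - 1.
Proof.
have [->|w0] := eqVneq w 0; first by rewrite osc0 mulr0 mulr0 mul0r cis0 subrr.
by rewrite /osc (negbTE w0); apply: complexP => /=; field; rewrite w0.
Qed.

Lemma iw_inj w : w != 0 -> injective (fun z => 'i%C * w%:C * z).
Proof.
move=> w0; apply: mulfI; apply/eqP => /(congr1 (@complex.Im R)) /= /eqP.
by rewrite mul0r add0r mul1r (negbTE w0).
Qed.

Lemma oscD t h w : osc (t + h) w = osc t w + cis (t * w) * osc h w.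
Proof.
have [->|w0] := eqVneq w 0.
  by rewrite !osc0 mulr0 cis0 mul1r; apply: complexP => //=; rewrite addr0.
apply: (iw_inj w0); rewrite /= mulrDr mulrCA !oscE mulrDl cisD; ring.
Qed.

Lemma osc_taylor h w : cmod (osc h w - h%:C) <= 2 * h ^+ 2 * `|w|.
Proof.
have [->|w0] := eqVneq w 0; first by rewrite osc0 subrr cmod0 normr0 mulr0.
have wp : 0 < `|w| by rewrite normr_gt0.
have := cis_taylor (h * w); rewrite -oscE.
have -> : 'i%C * w%:C * osc h w - 'i%C * (h * w)%:C = ('i%C * w%:C) * (osc h w - h%:C).
  rewrite mulrBr; congr (_ - _); apply: complexP => /=; ring.
rewrite cmodM; have -> : cmod ('i%C * w%:C) = `|w|.
  by rewrite cmodM cmod_real /cmod /= expr0n expr1n add0r sqrtr1 mul1r.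
rewrite exprMn -{1}(real_normK (num_real w)) => h1.
rewrite -(ler_pM2l wp); apply: (le_trans h1).
by rewrite le_eqVlt; apply/orP; left; apply/eqP; ring.
Qed.

Lemma osc_le t w : cmod (osc t w) <= 2 * t ^+ 2 * `|w| + `|t|.
Proof.
have -> : osc t w = (osc t w - t%:C) + t%:C by rewrite subrK.
by apply: (le_trans (cmodD _ _)); rewrite cmod_real lerD2r; exact: osc_taylor.
Qed.

(** There is no cancellation in the integral as long as the accumulated phase
    [t * w] is small. *)
Lemma osc_re_ge t w : 0 <= t -> t * `|w| <= 4^-1 -> t / 2 <= complex.Re (osc t w).
Proof.
move=> t0 tw.
have := le_trans (Re_le_cmod _) (osc_taylor t w).
have -> : complex.Re (osc t w - t%:C) = complex.Re (osc t w) - t by rewrite ReD ReN.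
move: (complex.Re (osc t w)) => r.
have -> : 2 * t ^+ 2 * `|w| = 2 * t * (t * `|w|) by ring.
have : 2 * t * (t * `|w|) <= 2 * t * 4^-1 by rewrite ler_wpM2l// mulr_ge0.
move=> h1 h2; have : `|r - t| <= t / 2 by lra.
by rewrite ler_norml => /andP[h3 _]; lra.
Qed.

(** The integral of [cis (- ((t - s) * L)) * cis (s * (w - L))] over s in [0,
    t]: Duhamel's integral for a forcing that oscillates at frequency [w - L]. *)
Definition propagator t L w : R[i] := cis (- (t * L)) * osc t w.

Lemma cmod_propagator t L w : cmod (propagator t L w) = cmod (osc t w).
Proof. by rewrite cmodM cmod_cis mul1r. Qed.

(** The propagator solves [y' = - i L y + cis (t * (w - L))], with a remainder
    that is uniform in [L] and [w] on bounded sets; the uniformity allows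
    integration over the frequencies. *)
Lemma propagator_taylor t h L w W : `|L| <= W -> `|w| <= W ->
  cmod (propagator (t + h) L w - propagator t L w -
    h%:C * (- 'i%C * (L%:C * propagator t L w) + cis (t * (w - L)))) <=
  (2 * W ^+ 2 * (2 * t ^+ 2 * W + `|t|) + 4 * W) * h ^+ 2.
Proof.
move=> LW wW; have W0 : 0 <= W by exact: le_trans (normr_ge0 L) LW.
have E1 : propagator (t + h) L w =
    cis (- (h * L)) * propagator t L w + cis (t * (w - L)) * (cis (- (h * L)) * osc h w).
  rewrite /propagator oscD.
  have -> : cis (- ((t + h) * L)) = cis (- (t * L)) * cis (- (h * L)) :> R[i].
    by rewrite -cisD; congr cis; ring.
  have -> : cis (t * (w - L)) = cis (t * w) * cis (- (t * L)) :> R[i].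
    by rewrite -cisD; congr cis; ring.
  by move: (cis _) (cis _) (cis _) (osc _ _) (osc _ _) => a b c u v; ring.
have hL : (- (h * L))%:C = - (h%:C * L%:C) :> R[i].
  by apply: complexP => /=; ring.
have -> : propagator (t + h) L w - propagator t L w -
    h%:C * (- 'i%C * (L%:C * propagator t L w) + cis (t * (w - L))) =
  (cis (- (h * L)) - 1 - 'i%C * (- (h * L))%:C) * propagator t L w +
  cis (t * (w - L)) * ((osc h w - h%:C) * cis (- (h * L)) +
                       h%:C * (cis (- (h * L)) - 1)).
  rewrite E1 hL.
  by move: (cis _) (cis _) (osc _ _) (propagator _ _ _) => a b u v; ring.
apply: (le_trans (cmodD _ _)); rewrite [leRHS]mulrDl; apply: lerD.
  rewrite cmodM cmod_propagator.
  have h1 : cmod (cis (- (h * L)) - 1 - 'i%C * (- (h * L))%:C) <= 2 * W ^+ 2 * h ^+ 2.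
    apply: (le_trans (cis_taylor _)).
    have -> : 2 * (- (h * L)) ^+ 2 = 2 * h ^+ 2 * L ^+ 2 by ring.
    have -> : 2 * W ^+ 2 * h ^+ 2 = 2 * h ^+ 2 * W ^+ 2 by ring.
    apply: ler_wpM2l; first by rewrite mulr_ge0// sqr_ge0.
    by rewrite -(real_normK (num_real L)); apply: lerXn2r; rewrite ?nnegrE.
  have h2 : cmod (osc t w) <= 2 * t ^+ 2 * W + `|t|.
    apply: (le_trans (osc_le _ _)); rewrite lerD2r; apply: ler_wpM2l => //.
    by rewrite mulr_ge0// sqr_ge0.
  apply: (le_trans (ler_pM (cmod_ge0 _) (cmod_ge0 _) h1 h2)).
  by rewrite le_eqVlt; apply/orP; left; apply/eqP; ring.
rewrite cmodM cmod_cis mul1r; apply: (le_trans (cmodD _ _)).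
have -> : 4 * W * h ^+ 2 = 2 * h ^+ 2 * W + `|h| * (2 * (`|h| * W)).
  by rewrite -(real_normK (num_real h)); ring.
apply: lerD.
  rewrite cmodM cmod_cis mulr1; apply: (le_trans (osc_taylor _ _)).
  by apply: ler_wpM2l => //; rewrite mulr_ge0// sqr_ge0.
rewrite cmodM cmod_real; apply: ler_wpM2l => //.
apply: (le_trans (cisB1_le _)); rewrite normrN normrM ler_pM2l//.
exact: ler_wpM2l.
Qed.

(** The inverse, with value 0 at 0, is the pointwise limit of the continuous
    functions x / (x ^ 2 + e). *)
Lemma measurable_inv : measurable_fun [set: R] (@GRing.inv R).
Proof.
apply: (@measurable_fun_cvg _ _ _ _ (fun n x => x / (x ^+ 2 + n.+1%:R^-1))).
- move=> n; apply: continuous_measurable_fun => x.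
  apply: cvgM; first exact: cvg_id.
  apply: (cvg_comp (fun x => x ^+ 2 + n.+1%:R^-1) GRing.inv); last first.
    by apply: inv_continuous; rewrite gt_eqF// ltr_wpDl// sqr_ge0.
  by apply: cvgD; [exact: exprn_continuous|exact: cvg_cst].
- move=> x _; have [->|x0] := eqVneq x 0.
    by rewrite invr0; under eq_fun do rewrite mul0r; exact: cvg_cst.
  have h : x ^+ 2 + n.+1%:R^-1 @[n --> \oo] --> x ^+ 2 + 0.
    by apply: cvgD; [exact: cvg_cst|exact: cvg_harmonic].
  rewrite addr0 in h.
  have -> : x^-1 = x * (x ^+ 2)^-1 by field; rewrite x0.
  apply: cvgM; first exact: cvg_cst.
  by apply: (cvg_comp _ _ h); apply: inv_continuous; rewrite expf_neq0.
Qed.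

Lemma cmeas_osc t : cmeas (osc t).
Proof.
have mt : measurable_fun [set: R] (fun w => t * w).
  by apply: measurable_funM => //; exact: measurable_cst.
split => /=.
  apply: measurable_funD.
    apply: measurable_funM; last exact: measurable_inv.
    by apply: (measurableT_comp _ mt); apply: continuous_measurable_fun; exact: continuous_sin.
  apply: measurable_funM; first exact: measurable_cst.
  rewrite (_ : (fun w => _) = \1_[set 0]); first exact: measurable_indic.
  apply/funext => w; rewrite indicE; have [->|w0] := eqVneq w 0.
    by rewrite mem_set.
  by rewrite memNset//; apply/eqP.
apply: measurable_funM; last exact: measurable_inv.
apply: measurable_funB; first exact: measurable_cst.
by apply: (measurableT_comp _ mt); apply: continuous_measurable_fun; exact: continuous_cos.
Qed.

End oscillatory_kernel.

(** * Products of inverse transforms *)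

Section convolution.
Context {R : realType}.
Implicit Types (f : plane R -> R[i]) (x y z xi : plane R).

Lemma prefl_transl z xi : prefl z xi = prefl (0, 0) (prefl xi z).
Proof. by rewrite /prefl /=; congr pair; ring. Qed.

Lemma rint_transl xi (h : plane R -> R) : rintg leb2 h ->
  rintg leb2 (fun z => h (prefl z xi)) /\
  \int[leb2]_z h (prefl z xi) = \int[leb2]_z h z.
Proof.
move=> ih; have [i1 e1] := rint_refl (0, 0) ih; have [i2 e2] := rint_refl xi i1.
rewrite (_ : (fun z => h (prefl z xi)) = (fun z => h (prefl (0, 0) (prefl xi z)))).
  by rewrite e2 e1.
by apply/funext => z; rewrite -prefl_transl.
Qed.

Lemma measurable_transl xi : measurable_fun setT (fun z : plane R => prefl z xi).
Proof.
rewrite (_ : (fun z => prefl z xi) = prefl (0, 0) \o prefl xi).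
  exact: (measurableT_comp (measurable_prefl _) (measurable_prefl _)).
by apply/funext => z; rewrite /= -prefl_transl.
Qed.

Lemma l2_transl xi f : l2 f -> l2 (fun z => f (prefl z xi)).
Proof.
move=> [mf fi]; split; first by apply: cmeas_comp => //; exact: measurable_transl.
exact: (rint_transl xi fi).1.
Qed.

Lemma measurable_prefl2 :
  measurable_fun setT (fun z : plane R * plane R => prefl z.2 z.1).
Proof.
apply/measurable_fun_pairP; split; apply: measurable_funB.
- exact: (measurableT_comp measurable_pfst measurable_snd).
- exact: (measurableT_comp measurable_pfst measurable_fst).
- exact: (measurableT_comp measurable_psnd measurable_snd).
- exact: (measurableT_comp measurable_psnd measurable_fst).
Qed.

(** The normalised correlation of two symbols; [prefl z xi] is z - xi. *)
Definition corr (f2 f1 : plane R -> R[i]) : plane R -> R[i] :=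
  fun xi => (c2pi%:C)^-1 * cint leb2 (fun z => f2 z * conjc (f1 (prefl z xi))).

(** Fubini's theorem and the change of variables y = z - xi, as for the
    transform of a convolution; the conjugation turns the convolution into a
    correlation. *)
Lemma invf_corr (f2 f1 : plane R -> R[i]) x : cintg leb2 f2 -> l2 f2 ->
  cintg leb2 f1 -> l2 f1 ->
  invf f2 x * conjc (invf f1 x) = invf (corr f2 f1) x.
Proof.
move=> i2 l2_2 i1 l2_1; have m2 := cintg_meas i2; have m1 := cintg_meas i1.
pose k (z : plane R * plane R) :=
  cis (dot x z.1) * (f2 z.2 * conjc (f1 (prefl z.2 z.1))).
have mk : cmeas k.
  apply: cmeasM.
    apply: cmeas_cis; apply: measurable_dot; [exact: measurable_cst|exact: measurable_fst].
  apply: cmeasM; first by apply: cmeas_comp => //; exact: measurable_snd.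
  apply: cmeas_conj; apply: (cmeas_comp _ m1); exact: measurable_prefl2.
have ck (z : plane R * plane R) : cmod (k z) = cmod (f2 z.2) * cmod (f1 (prefl z.2 z.1)).
  by rewrite /k !cmodM cmod_cis mul1r cmod_conj.
have s1 xi : cintg leb2 (fun z => f2 z * conjc (f1 (prefl z xi))).
  by apply: (cintgM_l2 l2_2 (l2_conj (l2_transl xi l2_1))).1.
have s2 z : cintg leb2 (fun xi => cis (dot x xi) * conjc (f1 (prefl z xi))).
  apply: cintg_cisM; last exact: cintg_conj (cint_refl z i1).1.
  exact: measurable_dotl.
have k1 xi : cintg leb2 (fun z => k (xi, z)) by have h := cintgZ (cis (dot x xi)) (s1 xi); rewrite /k /=; exact: h.
have k2 z : cintg leb2 (fun xi => k (xi, z)).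
  rewrite (_ : (fun xi => k (xi, z)) = (fun xi => f2 z * (cis (dot x xi) * conjc (f1 (prefl z xi))))).
    by have h := cintgZ (f2 z) (s2 z); exact: h.
  by apply/funext => xi; rewrite /k /= mulrCA.
have fin : (\int[leb2]_xi \int[leb2]_z (cmod (k (xi, z)))%:E < +oo)%E.
  have mcf := measurable_cmod mk.
  rewrite (leb2_Tonelli mcf (fun p => cmod_ge0 _)).
  have c1 := cintg_cmod i1; have c2 := cintg_cmod i2.
  rewrite (eq_integral (fun z : plane R => ((\int[leb2]_y cmod (f1 y)) * cmod (f2 z))%:E)).
    by rewrite -rintg_fin ?ltry//; exact: rintgZ.
  move=> z _; have [j1 e1] := rint_refl z c1.
  under eq_integral do rewrite ck /=.
  by rewrite -(rintg_fin (rintgZ (cmod (f2 z)) j1)) (rintZ _ j1) e1 mulrC.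
have [_ E] := leb2_Fubini mk fin k1 k2.
rewrite /invf /corr.
have -> : cint leb2 (fun xi => cis (dot x xi) * ((c2pi%:C)^-1 *
      cint leb2 (fun z => f2 z * conjc (f1 (prefl z xi))))) =
    (c2pi%:C)^-1 * cint leb2 (fun xi => cint leb2 (fun z => k (xi, z))).
  have iF : cintg leb2 (fun xi => cint leb2 (fun z => k (xi, z))).
    by have [] := leb2_Fubini mk fin k1 k2.
  rewrite -(cintZ _ iF); apply: eq_cint => xi; rewrite mulrCA; congr (_ * _).
  by rewrite -(cintZ _ (s1 xi)).
rewrite E.
have -> : cint leb2 (fun z => cint leb2 (fun xi => k (xi, z))) =
    cint leb2 (fun z => conjc (cint leb2 (fun y => cis (dot x y) * f1 y)) *
                        (cis (dot x z) * f2 z)).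
  apply: eq_cint => z.
  transitivity (f2 z * cint leb2 (fun xi => cis (dot x xi) * conjc (f1 (prefl z xi)))).
    by rewrite -(cintZ _ (s2 z)); apply: eq_cint => xi; rewrite /k /= mulrCA.
  have iy' : cintg leb2 (fun y => cis (dot x y) * f1 y).
    exact: (cintg_cisM (measurable_dotl x) i1).
  have iy : cintg leb2 (fun y => cis (- dot x y) * conjc (f1 y)).
    apply: cintg_cisM; last exact: cintg_conj.
    by apply: measurable_funN; exact: measurable_dotl.
  have [ir er] := cint_refl z iy.
  have -> : cint leb2 (fun xi => cis (dot x xi) * conjc (f1 (prefl z xi))) =
      cis (dot x z) * cint leb2 (fun y => cis (- dot x y) * conjc (f1 y)).
    rewrite -er -(cintZ _ ir); apply: eq_cint => xi; rewrite mulrA -cisD.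
    by congr (cis _ * _); rewrite /dot /prefl /=; ring.
  have -> : cint leb2 (fun y => cis (- dot x y) * conjc (f1 y)) =
      conjc (cint leb2 (fun y => cis (dot x y) * f1 y)).
    rewrite -(cint_conj iy'); apply: eq_cint => y.
    by rewrite conjM conj_cis.
  by rewrite mulrC -mulrA mulrC -mulrA [f2 z * _]mulrC mulrA mulrC.
have iz : cintg leb2 (fun z => cis (dot x z) * f2 z).
  exact: (cintg_cisM (measurable_dotl x) i2).
rewrite (cintZ _ iz).
have -> : conjc ((c2pi%:C)^-1 * cint leb2 (fun xi => cis (dot x xi) * f1 xi)) =
   (c2pi%:C)^-1 * conjc (cint leb2 (fun xi => cis (dot x xi) * f1 xi)).
  rewrite conjM; congr (_ * _); rewrite -(fmorphV (@real_complex R)).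
  exact: conj_real.
by move: (cint _ _) (conjc _) => p q; ring.
Qed.

End convolution.

(** * A profile with a spike at the origin *)

Section profile.
Context {R : realType}.
Notation mu := (@lebesgue_measure R).
Implicit Types (x r : R).

(** Square-integrable because 2 * 3 / 8 < 1. At frequencies of size r the
    interaction of two spikes with exponent p has a squared norm of order r ^
    (2 - 8 p) at the time r ^ (- 2), which is unbounded as soon as p > 1 / 4. *)
Definition spike x : R := \1_(`]0, 1]) x * x `^ (- (3 / 8)).

Lemma spike_ge0 x : 0 <= spike x.
Proof. by rewrite mulr_ge0 ?powR_ge0. Qed.

Lemma spike_out x : ~~ (0 < x <= 1) -> spike x = 0.
Proof. by move=> h; rewrite /spike indicE memNset ?mul0r//= in_itv; exact/negP. Qed.

Lemma spikeE x : 0 < x <= 1 -> spike x = x `^ (- (3 / 8)).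
Proof. by move=> h; rewrite /spike indicE mem_set ?mul1r//= in_itv. Qed.

Lemma spike_ge x r : 0 < x -> x <= r -> r <= 1 -> r `^ (- (3 / 8)) <= spike x.
Proof.
move=> x0 xr r1; have r0 : 0 < r by exact: lt_le_trans xr.
rewrite spikeE ?x0 ?(le_trans xr)// !powRN lef_pV2 ?posrE ?powR_gt0//.
by apply: ge0_ler_powR => //; rewrite nnegrE ltW.
Qed.

Lemma measurable_spike : measurable_fun setT spike.
Proof. by apply: measurable_funM; [exact: measurable_indic|exact: measurable_powR]. Qed.

(** The bound does not depend on [e], so that Fatou's lemma yields
    integrability up to the singularity. *)
Lemma integral_powR_itv (e : R) : 0 < e -> e < 1 ->
  (\int[mu]_(x in `[e, 1%R]) ((x `^ (- (3 / 4)))%R)%:E <= 4%:E)%E.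
Proof.
move=> e0 e1.
have dF (x : R) : 0 < x -> is_derive x 1 (fun y : R => 4 * y `^ 4^-1) (x `^ (- (3 / 4))).
  move=> x0; apply: (is_derive_congr (is_derive_fZ 4 (@is_derive1_powR R 4^-1 x x0))) => //.
  by rewrite mulrA mulfV// mul1r; congr (_ `^ _); field.
have df (s : R) : 0 < s -> {for s, continuous (fun y : R => y `^ (- (3 / 4)))}.
  by move=> s0; exact: (is_derive_continuous (@is_derive1_powR R _ s s0)).
rewrite (@continuous_FTC2 _ _ (fun x => 4 * x `^ 4^-1))//.
- rewrite -EFinB lee_fin powR1 mulr1 lerBlDr lerDl.
  by rewrite mulr_ge0 ?powR_ge0.
- apply: continuous_in_subspaceT => x; rewrite inE /= in_itv /= => /andP[ex _].
  by apply: df; exact: lt_le_trans ex.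
- split.
  + move=> x; rewrite in_itv /= => /andP[ex _].
    by have [] := dF x (lt_trans e0 ex).
  + by apply: cvg_at_right_filter; exact: (is_derive_continuous (dF e e0)).
  + by apply: cvg_at_left_filter; exact: (is_derive_continuous (dF 1 ltr01)).
- move=> x; rewrite in_itv /= => /andP[ex _].
  by rewrite derive1E (@derive_val _ _ _ _ _ _ _ (dF x (lt_trans e0 ex))).
Qed.

Lemma rintg_spike2 : rintg mu (fun x => spike x ^+ 2).
Proof.
have m2 : measurable_fun setT (fun x => spike x ^+ 2).
  by apply: measurable_funX; exact: measurable_spike.
apply/rintgP; split => //.
apply: (@le_lt_trans _ _ (4%:E)); last exact: ltry.
under eq_integral do rewrite ger0_norm ?sqr_ge0//.
apply: (@fatou_le _ _ _ mu
  (fun n x => \1_(`[n.+2%:R^-1, 1]) x * x `^ (- (3 / 4)))).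
- move=> n; apply: measurable_funM; [exact: measurable_indic|exact: measurable_powR].
- by move=> n x; rewrite mulr_ge0 ?powR_ge0.
- move=> x; have [h|h] := boolP (0 < x <= 1).
    have /andP[x0 x1] := h; apply: cvg_near_cst; near=> n.
    rewrite spikeE// -powR_mulrn ?powR_ge0// -powRrM indicE mem_set.
      by rewrite mul1r (_ : - (3 / 8) * 2 = - (3 / 4) :> R)//; lra.
    rewrite /= in_itv /= x1 andbT invf_ple ?posrE//.
    apply: (@le_trans _ _ n%:R); last by rewrite ler_nat; do 2!apply: leqW.
    by near: n; exact: nbhs_infty_ger.
  rewrite spike_out// expr0n; apply: cvg_near_cst; apply: nearW => n.
  rewrite indicE memNset ?mul0r//= in_itv /= => /andP[h1 h2].
  by move/negP : h; apply; rewrite h2 andbT (lt_le_trans _ h1).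
- move=> n; rewrite (_ : (\int[mu]_x _ = \int[mu]_(x in `[(n.+2%:R^-1)%R, 1%R])
      ((x `^ (- (3 / 4)))%R)%:E)%E).
    by apply: integral_powR_itv => //; rewrite invf_lt1// ltr1n.
  rewrite [RHS]integral_mkcond; apply: eq_integral => x _.
  by rewrite patchE indicE; case: (_ \in _); rewrite ?mul1r ?mul0r.
Unshelve. all: by end_near. Qed.

Lemma rintg_spike : rintg mu spike.
Proof.
have i1 : rintg mu (\1_(`]0, 1]%classic)) by exact: integrable_indic_itv.
apply: (@rintg_le _ _ _ mu spike (fun x => \1_(`]0, 1]%classic) x + spike x ^+ 2));
  [exact: measurable_spike| |exact: (rintgD i1 rintg_spike2)].
move=> x; rewrite ger0_norm ?spike_ge0//=.
have [h|h] := boolP (0 < x <= 1).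
  rewrite indicE mem_set /=; last by rewrite in_itv.
  by have := sqr_ge0 (spike x - 1); have := spike_ge0 x; nra.
by rewrite spike_out// expr0n addr0.
Qed.

Definition profile (x : plane R) : R := spike x.1 * spike x.2.

Lemma profile_ge0 (x : plane R) : 0 <= profile x.
Proof. by rewrite mulr_ge0 ?spike_ge0. Qed.

Lemma rintg_profile : rintg leb2 profile.
Proof. exact: (leb2_tensor_rint rintg_spike rintg_spike).1. Qed.

Lemma rintg_profile2 : rintg leb2 (fun x : plane R => profile x ^+ 2).
Proof.
have [+ _] := leb2_tensor_rint rintg_spike2 rintg_spike2.
by under eq_fun do rewrite -exprMn.
Qed.

Lemma measurable_profile : measurable_fun setT profile.
Proof. exact: rintg_meas rintg_profile. Qed.

Lemma profile_support (x : plane R) : profile x != 0 ->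
  (0 < (x.1 : R) <= 1) /\ (0 < (x.2 : R) <= 1).
Proof.
rewrite mulf_eq0 negb_or => /andP[h1 h2]; split.
  by apply: contraNT h1 => /spike_out ->.
by apply: contraNT h2 => /spike_out ->.
Qed.

End profile.

(** * Symbols, free waves and Duhamel's formula *)

Section symbols.
Context {R : realType}.
Implicit Types (x y z xi : plane R).

Lemma dot_ge0 x : 0 <= dot x x.
Proof. by rewrite /dot addr_ge0// -expr2 sqr_ge0. Qed.

Lemma enorm_sqr x : enorm x ^+ 2 = dot x x.
Proof. by rewrite /enorm sqr_sqrtr// dot_ge0. Qed.

(** The concave function sqrt lies below its tangent at [a ^ 2]. *)
Lemma sqrt_tangent (a s : R) : 0 < a -> 0 <= s ->
  a <= Num.sqrt (a ^+ 2 + s) <= a + s / (2 * a).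
Proof.
move=> a0 s0; have ha : a = Num.sqrt (a ^+ 2) by rewrite sqrtr_sqr gtr0_norm.
apply/andP; split; first by rewrite {1}ha ler_wsqrtr// lerDl.
have b0 : 0 <= a + s / (2 * a) by rewrite addr_ge0 ?divr_ge0 ?mulr_ge0// ltW.
rewrite -[leRHS](ger0_norm b0) -sqrtr_sqr ler_wsqrtr//.
have -> : (a + s / (2 * a)) ^+ 2 = a ^+ 2 + s + (s / (2 * a)) ^+ 2.
  by field; rewrite gt_eqF.
by rewrite lerDl sqr_ge0.
Qed.

Lemma lam1_bounds xi : 1 <= lam1 xi <= 1 + dot xi xi / 2.
Proof.
rewrite /lam1 enorm_sqr addrC.
by have := sqrt_tangent ltr01 (dot_ge0 xi); rewrite expr1n mulr1.
Qed.

Lemma lam2_bounds xi : 2 <= lam2 xi <= 2 + dot xi xi / 2.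
Proof.
rewrite /lam2 enorm_sqr addrC.
have d0 : 0 <= 2 * dot xi xi by rewrite mulr_ge0 ?dot_ge0.
have := @sqrt_tangent 2 _ (ltr0Sn R 1) d0.
rewrite (_ : 2 ^+ 2 = 4 :> R); last by ring.
by rewrite (_ : 2 * dot xi xi / (2 * 2) = dot xi xi / 2)//; field.
Qed.

Lemma measurable_dotxx : measurable_fun setT (fun x => dot x x).
Proof. by apply: measurable_dot; exact: measurable_id. Qed.

Lemma measurable_enorm : measurable_fun setT (@enorm R).
Proof. exact: (measurableT_comp measurable_sqrt measurable_dotxx). Qed.

Lemma measurable_lam1 : measurable_fun setT (@lam1 R).
Proof.
apply: (measurableT_comp measurable_sqrt); apply: measurable_funD; last exact: measurable_cst.
by apply: measurable_funX; exact: measurable_enorm.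
Qed.

Lemma measurable_lam2 : measurable_fun setT (@lam2 R).
Proof.
apply: (measurableT_comp measurable_sqrt); apply: measurable_funD; last exact: measurable_cst.
apply: measurable_funM; first exact: measurable_cst.
by apply: measurable_funX; exact: measurable_enorm.
Qed.

Lemma measurable_lam3 : measurable_fun setT (@lam3 R).
Proof.
apply: (measurableT_comp measurable_sqrt); apply: measurable_funD; last exact: measurable_cst.
apply: measurable_funM; first exact: measurable_cst.
by apply: measurable_funX; exact: measurable_enorm.
Qed.

Lemma lam1_even y z : lam1 (prefl y z) = lam1 (prefl z y).
Proof. by rewrite /lam1 !enorm_sqr /dot /prefl /=; congr Num.sqrt; ring. Qed.

End symbols.

Section linear_evolution.
Context {R : realType}.
Implicit Types (lam a : plane R -> R) (x y z xi : plane R).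

(** The symbol at time [t] of the free wave with initial symbol [a]. *)
Definition free lam a t : plane R -> R[i] :=
  fun xi => cis (- (t * lam xi)) * (a xi)%:C.

Lemma cmod_free lam a t xi : cmod (free lam a t xi) = `|a xi|.
Proof. by rewrite cmodM cmod_cis mul1r cmod_real. Qed.

Lemma cmeas_free lam a t : measurable_fun setT lam -> measurable_fun setT a ->
  cmeas (free lam a t).
Proof.
move=> ml ma; apply: cmeasM; last exact: cmeas_real.
by apply: cmeas_cis; apply: measurable_funN; apply: measurable_funM.
Qed.

Lemma free_L1L2 lam a t : measurable_fun setT lam -> (forall xi, 0 <= a xi) ->
  rintg leb2 a -> rintg leb2 (fun xi => a xi ^+ 2) ->
  cintg leb2 (free lam a t) /\ l2 (free lam a t).
Proof.
move=> ml a0 ia ia2; apply: (@dominated_L1L2 R (free lam a t) a 1) => //.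
  by apply: cmeas_free => //; exact: rintg_meas ia.
by move=> xi; rewrite cmod_free ger0_norm// mul1r.
Qed.

(** A first-order Taylor expansion of [cis] is uniform because [lam] is
    bounded on the support of [a]. *)
Lemma evol_free lam a Lam : measurable_fun setT lam -> (forall xi, 0 <= a xi) ->
  rintg leb2 a -> rintg leb2 (fun xi => a xi ^+ 2) -> 0 <= Lam ->
  (forall xi, `|lam xi| * a xi <= Lam * a xi) ->
  evol_eq lam (fun t => invf (free lam a t)) (fun _ _ => 0).
Proof.
move=> ml a0 ia ia2 L0 la.
apply: (@evol_of_symbol _ lam a Lam _
  (fun t xi => - 'i%C * ((lam xi)%:C * free lam a t xi)) (fun _ _ => 0)) => //.
- by move=> t; apply: cmeas_free => //; exact: rintg_meas ia.
- move=> t; exists 1; first exact: ler01.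
  by move=> xi; rewrite cmod_free ger0_norm// mul1r.
- move=> t; exists (2 * Lam ^+ 2) => h xi.
  have -> : free lam a (t + h) xi - free lam a t xi -
      h%:C * (- 'i%C * ((lam xi)%:C * free lam a t xi)) =
      free lam a t xi * (cis (h * - lam xi) - 1 - 'i%C * (h * - lam xi)%:C).
    rewrite /free (_ : - ((t + h) * lam xi) = - (t * lam xi) + h * - lam xi); last by ring.
    rewrite cisD (_ : (h * - lam xi)%:C = - (h%:C * (lam xi)%:C)); last first.
      by rewrite mulrN rmorphN rmorphM.
    by move: (cis _) (cis _) (a xi)%:C (h%:C) ((lam xi)%:C) => p q r s l; ring.
  rewrite cmodM cmod_free ger0_norm//.
  apply: (le_trans (ler_wpM2l (a0 xi) (cis_taylor _))).
  have h1 : `|lam xi| * (`|lam xi| * a xi) <= Lam * (Lam * a xi).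
    apply: (le_trans (ler_wpM2l (normr_ge0 _) (la xi))).
    by rewrite mulrCA; apply: ler_wpM2l => //; rewrite mulrC la.
  have h2 : lam xi ^+ 2 = `|lam xi| ^+ 2 by rewrite real_normK ?num_real.
  rewrite exprMn sqrrN h2.
  have -> : a xi * (2 * (h ^+ 2 * `|lam xi| ^+ 2)) =
     2 * h ^+ 2 * (`|lam xi| * (`|lam xi| * a xi)) by ring.
  have -> : 2 * Lam ^+ 2 * h ^+ 2 * a xi = 2 * h ^+ 2 * (Lam * (Lam * a xi)) by ring.
  by apply: ler_wpM2l => //; rewrite mulr_ge0 ?sqr_ge0.
- by move=> t xi; rewrite addr0.
- by move=> t; exact: is_fourier0.
Qed.

Lemma invf0 : invf (fun _ : plane R => 0 : R[i]) = (fun=> 0).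
Proof.
apply/funext => x; rewrite /invf.
by under eq_cint do rewrite mulr0; rewrite cint0 mulr0.
Qed.

Lemma evol_zero lam : measurable_fun setT lam ->
  evol_eq lam (fun _ _ => 0) (fun _ _ => 0).
Proof.
move=> ml; have e : (fun _ => 0 : plane R -> R[i]) = (fun t => invf (free lam (fun=> 0) t)).
  apply/funext => t; rewrite (_ : free _ _ _ = (fun=> 0)) ?invf0//.
  by apply/funext => xi; rewrite /free mulr0.
rewrite {1}[X in evol_eq _ X _]e; apply: (@evol_free _ _ 0) => //.
- exact: rintg0.
- by under eq_fun do rewrite expr0n; exact: rintg0.
- by move=> xi; rewrite !mulr0.
Qed.

End linear_evolution.

Section duhamel.
Context {R : realType}.
Variables (L : plane R -> R) (w beta : plane R * plane R -> R) (W c : R).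
Hypotheses (mL : measurable_fun setT L) (mw : measurable_fun setT w)
  (mb : measurable_fun setT beta) (b0 : forall p, 0 <= beta p)
  (bW : forall p, beta p != 0 -> `|L p.1| <= W /\ `|w p| <= W)
  (W0 : 0 <= W) (c0 : 0 <= c).
Let G xi := \int[leb2]_z beta (xi, z).
Hypotheses (ib : forall xi, rintg leb2 (fun z => beta (xi, z)))
  (iG : rintg leb2 G) (iG2 : rintg leb2 (fun xi => G xi ^+ 2)).
Implicit Types (x y z xi : plane R).

(** The solution with zero initial value of the equation [y' = - i L y +
    forcing], on the Fourier side. *)
Definition duhamel t : plane R -> R[i] := fun xi =>
  c%:C * cint leb2 (fun z => propagator t (L xi) (w (xi, z)) * (beta (xi, z))%:C).

Definition forcing t : plane R -> R[i] := fun xi =>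
  c%:C * cint leb2 (fun z => cis (t * (w (xi, z) - L xi)) * (beta (xi, z))%:C).

Let bt0 (t : R) : 0 <= 2 * t ^+ 2 * W + `|t|.
Proof.
apply: addr_ge0; last exact: normr_ge0.
by apply: mulr_ge0 => //; apply: mulr_ge0 => //; exact: sqr_ge0.
Qed.

Let mk t : cmeas (fun p => propagator t (L p.1) (w p) * (beta p)%:C).
Proof.
apply: cmeasM; last exact: cmeas_real.
apply: cmeasM; last by apply: (cmeas_comp mw); exact: cmeas_osc.
apply: cmeas_cis; apply: measurable_funN; apply: measurable_funM; first exact: measurable_cst.
exact: (measurableT_comp mL measurable_fst).
Qed.

Let mk2 t : cmeas (fun p => cis (t * (w p - L p.1)) * (beta p)%:C).
Proof.
apply: cmeasM; last exact: cmeas_real.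
apply: cmeas_cis; apply: measurable_funM; first exact: measurable_cst.
by apply: measurable_funB => //; exact: (measurableT_comp mL measurable_fst).
Qed.

Let bound (k : plane R -> R[i]) xi M : cmeas k -> 0 <= M ->
  (forall z, beta (xi, z) != 0 -> cmod (k z) <= M) ->
  cintg leb2 (fun z => k z * (beta (xi, z))%:C) /\
  cmod (cint leb2 (fun z => k z * (beta (xi, z))%:C)) <= 2 * M * G xi.
Proof.
move=> mkz M0 kM.
have mbz : cmeas (fun z => (beta (xi, z))%:C).
  apply: cmeas_real; exact: rintg_meas (ib xi).
have le z : cmod (k z * (beta (xi, z))%:C) <= M * beta (xi, z).
  rewrite cmodM cmod_real (ger0_norm (b0 _)).
  by have [->|h] := eqVneq (beta (xi, z)) 0; [rewrite !mulr0|exact: ler_wpM2r (kM _ h)].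
have ci : cintg leb2 (fun z => k z * (beta (xi, z))%:C).
  by apply: (cintg_le (cmeasM mkz mbz) le); exact: rintgZ.
split=> //; apply: (le_trans (cmod_cint ci)); rewrite -mulrA ler_wpM2l//.
by rewrite -(rintZ _ (ib xi)); apply: le_rint => //; [exact: cintg_cmod|exact: rintgZ].
Qed.

Let cprop t xi : cintg leb2 (fun z => propagator t (L xi) (w (xi, z)) * (beta (xi, z))%:C) /\
  cmod (cint leb2 (fun z => propagator t (L xi) (w (xi, z)) * (beta (xi, z))%:C)) <=
    2 * (2 * t ^+ 2 * W + `|t|) * G xi.
Proof.
apply: bound.
- apply: cmeasM; first exact: cmeas_cst.
  have mwx : measurable_fun setT (fun z => w (xi, z)).
    exact: (measurableT_comp mw (measurable_pair1 xi)).
  exact: (cmeas_comp mwx (cmeas_osc t)).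
- exact: bt0.
- move=> z /bW[_ h]; rewrite cmod_propagator; apply: (le_trans (osc_le _ _)).
  by rewrite lerD2r; apply: ler_wpM2l h; rewrite mulr_ge0// ?sqr_ge0.
Qed.

Let cforc t xi : cintg leb2 (fun z => cis (t * (w (xi, z) - L xi)) * (beta (xi, z))%:C) /\
  cmod (cint leb2 (fun z => cis (t * (w (xi, z) - L xi)) * (beta (xi, z))%:C)) <=
    2 * G xi.
Proof.
rewrite -[2 in leRHS]mulr1.
have mwx : measurable_fun setT (fun z => w (xi, z)).
  exact: (measurableT_comp mw (measurable_pair1 xi)).
apply: (@bound (fun z => cis (t * (w (xi, z) - L xi))) xi 1 _ _ _) => //.
  apply: cmeas_cis; apply: measurable_funM; first exact: measurable_cst.
  by apply: measurable_funB => //; exact: measurable_cst.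
by move=> z _; rewrite cmod_cis.
Qed.

Lemma symbol_marginal_le xi : `|L xi| * G xi <= W * G xi.
Proof.
rewrite -!(rintZ _ (ib xi)); apply: le_rint; [exact: rintgZ|exact: rintgZ|move=> z].
by have [->|/bW[h _]] := eqVneq (beta (xi, z)) 0; [rewrite !mulr0|exact: ler_wpM2r h].
Qed.

Lemma duhamel_L1L2 t : cintg leb2 (duhamel t) /\ l2 (duhamel t).
Proof.
apply: (@dominated_L1L2 R _ G (c * (2 * (2 * t ^+ 2 * W + `|t|)))) => //.
- by apply: cmeasM; [exact: cmeas_cst|exact: (cmeas_cint_section (mk t))].
- move=> xi; rewrite cmodM cmod_real (ger0_norm c0) -[leRHS]mulrA.
  by apply: ler_wpM2l => //; exact: (cprop t xi).2.
Qed.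

Lemma forcing_L1L2 t : cintg leb2 (forcing t) /\ l2 (forcing t).
Proof.
apply: (@dominated_L1L2 R _ G (c * 2)) => //.
- by apply: cmeasM; [exact: cmeas_cst|exact: (cmeas_cint_section (mk2 t))].
- move=> xi; rewrite cmodM cmod_real (ger0_norm c0) -[leRHS]mulrA.
  by apply: ler_wpM2l => //; exact: (cforc t xi).2.
Qed.

(** Integrate [propagator_taylor] over [z] against [beta]: the bounds on [L]
    and [w] hold on the support of [beta]. *)
Lemma evol_duhamel N : (forall t, is_fourier (N t) (forcing t)) ->
  evol_eq L (fun t => invf (duhamel t)) N.
Proof.
move=> hN; apply: (@evol_of_symbol _ L G W _
  (fun t xi => - 'i%C * ((L xi)%:C * duhamel t xi) + forcing t xi) forcing) => //.
- exact: symbol_marginal_le.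
- by move=> t; apply: cmeasM; [exact: cmeas_cst|exact: (cmeas_cint_section (mk t))].
- move=> t; exists (c * (2 * (2 * t ^+ 2 * W + `|t|))).
    by rewrite !mulr_ge0// bt0.
  move=> xi; rewrite cmodM cmod_real (ger0_norm c0) -[leRHS]mulrA.
  by apply: ler_wpM2l => //; exact: (cprop t xi).2.
- move=> t; pose K := 2 * W ^+ 2 * (2 * t ^+ 2 * W + `|t|) + 4 * W.
  have K0 : 0 <= K.
    apply: addr_ge0; last exact: mulr_ge0.
    apply: mulr_ge0; last exact: bt0.
    by apply: mulr_ge0 => //; exact: sqr_ge0.
  exists (c * (2 * K)) => h xi.
  (* the remainder of propagator_taylor *)
  pose k z := propagator (t + h) (L xi) (w (xi, z)) - propagator t (L xi) (w (xi, z)) -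
    h%:C * (- 'i%C * ((L xi)%:C * propagator t (L xi) (w (xi, z))) +
            cis (t * (w (xi, z) - L xi))).
  have -> : duhamel (t + h) xi - duhamel t xi -
      h%:C * (- 'i%C * ((L xi)%:C * duhamel t xi) + forcing t xi) =
      c%:C * cint leb2 (fun z => k z * (beta (xi, z))%:C).
    have i1 := (cprop (t + h) xi).1; have i2 := (cprop t xi).1; have i3 := (cforc t xi).1.
    have i4 := cintgZ (- 'i%C * (L xi)%:C) i2.
    rewrite (_ : (fun z => k z * (beta (xi, z))%:C) = (fun z =>
        propagator (t + h) (L xi) (w (xi, z)) * (beta (xi, z))%:C -
        propagator t (L xi) (w (xi, z)) * (beta (xi, z))%:C -
        h%:C * (- 'i%C * (L xi)%:C * (propagator t (L xi) (w (xi, z)) * (beta (xi, z))%:C) +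
          cis (t * (w (xi, z) - L xi)) * (beta (xi, z))%:C))); last first.
      by apply/funext => z; rewrite /k; move: (propagator _ _ _) (propagator _ _ _) (cis _) => p q r; ring.
    rewrite (cintB (cintgB i1 i2) (cintgZ _ (cintgD i4 i3))) (cintB i1 i2).
    rewrite (cintZ _ (cintgD i4 i3)) (cintD i4 i3) (cintZ _ i2) /duhamel /forcing.
    by move: (cint _ _) (cint _ _) (cint _ _) => p q r; ring.
  rewrite cmodM cmod_real (ger0_norm c0).
  have mwx : measurable_fun setT (fun z => w (xi, z)).
    exact: (measurableT_comp mw (measurable_pair1 xi)).
  have mp s : cmeas (fun z => propagator s (L xi) (w (xi, z))).
    by apply: cmeasM; [exact: cmeas_cst|exact: (cmeas_comp mwx (cmeas_osc s))].
  have mkz : cmeas k.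
    apply: cmeasB; first exact: cmeasB.
    apply: cmeasM; first exact: cmeas_cst.
    apply: cmeasD.
      apply: cmeasM; first exact: cmeas_cst.
      by apply: cmeasM; first exact: cmeas_cst.
    apply: cmeas_cis; apply: measurable_funM; first exact: measurable_cst.
    by apply: measurable_funB => //; exact: measurable_cst.
  have Kh0 : 0 <= K * h ^+ 2 by apply: mulr_ge0 => //; exact: sqr_ge0.
  have kle z : beta (xi, z) != 0 -> cmod (k z) <= K * h ^+ 2.
    by move=> /bW[h1 h2]; exact: propagator_taylor.
  have := (bound mkz Kh0 kle).2; move: (cmod _) => m hm.
  have -> : c * (2 * K) * h ^+ 2 * G xi = c * (2 * (K * h ^+ 2) * G xi) by ring.
  exact: ler_wpM2l.
Qed.

End duhamel.

(** * The resonant interaction *)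

Section interaction.
Context {R : realType}.
Implicit Types (x y z xi : plane R) (p : plane R * plane R) (t r eps : R).

Lemma dot_le (a : R) x : `|x.1 : R| <= a -> `|x.2 : R| <= a -> dot x x <= 2 * a ^+ 2.
Proof.
move=> h1 h2; have a0 : 0 <= a by exact: le_trans (normr_ge0 _) h1.
rewrite /dot -!expr2 -(real_normK (num_real (x.1 : R))) -(real_normK (num_real (x.2 : R))).
have := lerXn2r 2 (normr_ge0 _ : `|x.1 : R| \in Num.nneg) (a0 : a \in Num.nneg) h1.
have := lerXn2r 2 (normr_ge0 _ : `|x.2 : R| \in Num.nneg) (a0 : a \in Num.nneg) h2.
by lra.
Qed.

(** The first wave enters the interaction conjugated, which reflects its
    frequencies; the reflected profile compensates for this. *)
Definition datum1 eps xi : R := eps * profile (prefl (0, 0) xi).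
Definition datum2 eps xi : R := eps * profile xi.

Lemma datum1_ge0 eps xi : 0 <= eps -> 0 <= datum1 eps xi.
Proof. by move=> e0; rewrite mulr_ge0 ?profile_ge0. Qed.
Lemma datum2_ge0 eps xi : 0 <= eps -> 0 <= datum2 eps xi.
Proof. by move=> e0; rewrite mulr_ge0 ?profile_ge0. Qed.

Lemma rintg_datum1 eps : rintg leb2 (datum1 eps).
Proof. exact: rintgZ (rint_refl _ rintg_profile).1. Qed.
Lemma rintg_datum2 eps : rintg leb2 (datum2 eps).
Proof. exact: rintgZ rintg_profile. Qed.

Lemma rint_datum1_sqr eps : rintg leb2 (fun xi => datum1 eps xi ^+ 2) /\
  \int[leb2]_xi (datum1 eps xi ^+ 2) = eps ^+ 2 * \int[leb2]_xi (profile xi ^+ 2).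
Proof.
have [i e] := rint_refl (0, 0) (@rintg_profile2 R).
rewrite (_ : (fun xi => datum1 eps xi ^+ 2) =
    fun xi => eps ^+ 2 * profile (prefl (0, 0) xi) ^+ 2); last first.
  by apply/funext => xi; rewrite exprMn.
by split; [exact: rintgZ|rewrite -e -(rintZ _ i)].
Qed.

Lemma rint_datum2_sqr eps : rintg leb2 (fun xi => datum2 eps xi ^+ 2) /\
  \int[leb2]_xi (datum2 eps xi ^+ 2) = eps ^+ 2 * \int[leb2]_xi (profile xi ^+ 2).
Proof.
have i := @rintg_profile2 R.
rewrite (_ : (fun xi => datum2 eps xi ^+ 2) = fun xi => eps ^+ 2 * profile xi ^+ 2).
  by split; [exact: rintgZ|rewrite -(rintZ _ i)].
by apply/funext => xi; rewrite exprMn.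
Qed.

Lemma lam1_datum1 eps xi : 0 <= eps -> `|lam1 xi| * datum1 eps xi <= 2 * datum1 eps xi.
Proof.
move=> e0; rewrite /datum1.
have [->|/profile_support[]] := eqVneq (profile (prefl (0, 0) xi)) 0.
  by rewrite !mulr0.
rewrite /= !sub0r => /andP[h1 h2] /andP[h3 h4].
apply: ler_wpM2r; first exact: datum1_ge0.
have /andP[l1 l2] := lam1_bounds xi.
have d : dot xi xi <= 2 * 1 ^+ 2.
  by apply: dot_le; rewrite ler_norml; apply/andP; split; lra.
by rewrite ger0_norm; lra.
Qed.

Lemma lam2_datum2 eps xi : 0 <= eps -> `|lam2 xi| * datum2 eps xi <= 3 * datum2 eps xi.
Proof.
move=> e0; rewrite /datum2.
have [->|/profile_support[/andP[h1 h2] /andP[h3 h4]]] := eqVneq (profile xi) 0.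
  by rewrite !mulr0.
apply: ler_wpM2r; first exact: datum2_ge0.
have /andP[l1 l2] := lam2_bounds xi.
have d : dot xi xi <= 2 * 1 ^+ 2.
  by apply: dot_le; rewrite ler_norml; apply/andP; split; lra.
by rewrite ger0_norm; lra.
Qed.

(** The interaction of the frequency [z] of the second wave with the frequency
    [z - xi] of the conjugated first wave produces the frequency [xi]. *)
Definition phase p : R := lam1 p.1 + lam1 (prefl p.1 p.2) - lam2 p.2.
Definition overlap p : R := profile p.2 * profile (prefl p.1 p.2).

Lemma measurable_prefl1 :
  measurable_fun setT (fun p : plane R * plane R => prefl p.1 p.2).
Proof.
apply/measurable_fun_pairP; split; apply: measurable_funB.
- exact: (measurableT_comp measurable_pfst measurable_fst).
- exact: (measurableT_comp measurable_pfst measurable_snd).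
- exact: (measurableT_comp measurable_psnd measurable_fst).
- exact: (measurableT_comp measurable_psnd measurable_snd).
Qed.

Lemma measurable_phase : measurable_fun setT phase.
Proof.
apply: measurable_funB; last exact: (measurableT_comp measurable_lam2 measurable_snd).
apply: measurable_funD; first exact: (measurableT_comp measurable_lam1 measurable_fst).
exact: (measurableT_comp measurable_lam1 measurable_prefl1).
Qed.

Lemma measurable_overlap : measurable_fun setT overlap.
Proof.
apply: measurable_funM; first exact: (measurableT_comp measurable_profile measurable_snd).
exact: (measurableT_comp measurable_profile measurable_prefl1).
Qed.

Lemma overlap_ge0 p : 0 <= overlap p.
Proof. by rewrite mulr_ge0 ?profile_ge0. Qed.

Lemma overlap_support p : overlap p != 0 ->
  [/\ 0 < (p.2.1 : R) <= 1, 0 < (p.2.2 : R) <= 1,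
      0 < (p.1.1 : R) - p.2.1 <= 1 & 0 < (p.1.2 : R) - p.2.2 <= 1].
Proof.
by rewrite mulf_eq0 negb_or => /andP[/profile_support[h1 h2] /profile_support[h3 h4]].
Qed.

(** The three symbols take the values 1, 1 and 2 at the origin, where the
    phase vanishes since 1 + 1 = 2, and their next terms are quadratic. All
    frequencies that contribute to [xi] lie in the rectangle between 0 and
    [xi], hence are as small as [xi]. *)
Lemma phase_le p (r : R) : overlap p != 0 -> (p.1.1 : R) <= r -> (p.1.2 : R) <= r ->
  `|phase p| <= 2 * r ^+ 2 /\ `|lam1 p.1| <= 1 + r ^+ 2.
Proof.
case: p => xi z /overlap_support /= [/andP[a1 a2] /andP[b1 b2] /andP[c1 c2] /andP[d1 d2]].
move=> x1 x2.
have /andP[l1 l2] := lam1_bounds xi.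
have /andP[m1 m2] := lam1_bounds (prefl xi z).
have /andP[n1 n2] := lam2_bounds z.
have d : dot xi xi <= 2 * r ^+ 2.
  by apply: dot_le; rewrite ler_norml; apply/andP; split; lra.
have d' : dot (prefl xi z) (prefl xi z) <= 2 * r ^+ 2.
  by apply: dot_le; rewrite /= ler_norml; apply/andP; split; lra.
have d'' : dot z z <= 2 * r ^+ 2.
  by apply: dot_le; rewrite ler_norml; apply/andP; split; lra.
rewrite /phase /=; split; last by rewrite ger0_norm; lra.
by rewrite ler_norml; apply/andP; split; lra.
Qed.

Lemma overlap_bounded p : overlap p != 0 -> `|lam1 p.1| <= 8 /\ `|phase p| <= 8.
Proof.
move=> h; have [/andP[_ a] /andP[_ b] /andP[_ c] /andP[_ d]] := overlap_support h.
have [|| h1 h2] := @phase_le p 2 h; [lra|lra|].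
by split; lra.
Qed.

Let kappa : R := \int[leb2]_z (profile z ^+ 2).

Lemma rint_overlap_section xi : rintg leb2 (fun z => overlap (xi, z)) /\
  \int[leb2]_z overlap (xi, z) <= 2 * kappa.
Proof.
have i1 := @rintg_profile2 R; have [i2 e2] := rint_refl xi i1.
have le z : `|overlap (xi, z)| <= profile z ^+ 2 + profile (prefl xi z) ^+ 2.
  rewrite ger0_norm ?overlap_ge0// /overlap /=.
  have := sqr_ge0 (profile z - profile (prefl xi z)).
  by move: (profile z) (profile_ge0 z) (profile _) (profile_ge0 (prefl xi z)) => a a0 b b0; nra.
have mo : measurable_fun setT (fun z => overlap (xi, z)).
  exact: (measurableT_comp measurable_overlap (measurable_pair1 xi)).
have io := rintg_le mo le (rintgD i1 i2); split=> //.
have := le_rint io (rintgD i1 i2) (fun z => le_trans (ler_norm _) (le z)).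
by rewrite (rintD i1 i2) e2 mulr2n mulrDl !mul1r.
Qed.

Lemma rint_overlap :
  rintg leb2 (fun xi => \int[leb2]_z overlap (xi, z)) /\
  rintg leb2 (fun xi => (\int[leb2]_z overlap (xi, z)) ^+ 2).
Proof.
have s2 z : rintg leb2 (fun xi => overlap (xi, z)) /\
    \int[leb2]_xi overlap (xi, z) = profile z * \int[leb2]_xi profile xi.
  have [i e] := rint_transl z (@rintg_profile R).
  have h := rintgZ (profile z) i.
  by split; [exact: h|rewrite -e -(rintZ _ i)].
have is2 : rintg leb2 (fun z => \int[leb2]_xi overlap (xi, z)).
  rewrite (_ : (fun z => _) = fun z => (\int[leb2]_xi profile xi) * profile z).
    exact: rintgZ rintg_profile.
  by apply/funext => z; rewrite (s2 z).2 mulrC.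
have [iG _] := leb2_Tonelli_rint measurable_overlap overlap_ge0
  (fun xi => (rint_overlap_section xi).1) (fun z => (s2 z).1) is2.
split=> //; apply: (rintg_le _ _ (rintgZ (2 * kappa) iG)).
  by apply: measurable_funX; exact: rintg_meas iG.
move=> xi; rewrite ger0_norm ?sqr_ge0// expr2; apply: ler_wpM2r.
  by apply: Rintegral_ge0 => z _; exact: overlap_ge0.
exact: (rint_overlap_section xi).2.
Qed.

(** The conjugate phase of the first wave adds to that of the second; [lam1]
    is even. *)
Lemma corr_free eps t : corr (free (@lam2 R) (datum2 eps) t) (free (@lam1 R) (datum1 eps) t) =
  forcing (@lam1 R) phase overlap (c2pi^-1 * eps ^+ 2) t.
Proof.
apply/funext => xi; rewrite /corr /forcing.
have ci : cintg leb2 (fun z => cis (t * (phase (xi, z) - lam1 xi)) * (overlap (xi, z))%:C).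
  apply: cintg_cisM.
    apply: measurable_funM; first exact: measurable_cst.
    apply: measurable_funB; last exact: measurable_cst.
    exact: (measurableT_comp measurable_phase (measurable_pair1 xi)).
  apply: (cintg_le _ _ (rint_overlap_section xi).1).
    by apply: cmeas_real; exact: rintg_meas (rint_overlap_section xi).1.
  by move=> z; rewrite cmod_real ger0_norm ?overlap_ge0.
have cE (a : R) : (a^-1 * eps ^+ 2)%:C = (a%:C)^-1 * (eps%:C * eps%:C) :> R[i].
  by rewrite expr2 !(rmorphM (@real_complex R)) (fmorphV (@real_complex R)).
rewrite cE -[RHS]mulrA; congr (_ * _).
rewrite -(cintZ _ ci); apply: eq_cint => z.
rewrite /free conjM conj_real conj_cis opprK lam1_even /datum1 -prefl_transl /datum2.
rewrite /overlap /phase /=.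
rewrite (_ : t * (lam1 xi + lam1 (prefl xi z) - lam2 z - lam1 xi) =
  - (t * lam2 z) + t * lam1 (prefl xi z)); last by ring.
move: (profile z) (profile (prefl xi z)) => q s.
rewrite cisD !(rmorphM (@real_complex R)).
by move: (cis _) (cis _) => a b; ring.
Qed.

Definition wave1 eps t : plane R -> R[i] := invf (free (@lam1 R) (datum1 eps) t).
Definition wave2 eps t : plane R -> R[i] := invf (free (@lam2 R) (datum2 eps) t).
Definition wave4 eps t : plane R -> R[i] :=
  invf (duhamel (@lam1 R) phase overlap (c2pi^-1 * eps ^+ 2) t).

Lemma evol_wave1 eps : 0 <= eps -> evol_eq (@lam1 R) (wave1 eps) (fun _ _ => 0).
Proof.
move=> e0; apply: (@evol_free _ _ _ 2) => //.
- exact: measurable_lam1.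
- by move=> xi; exact: datum1_ge0.
- exact: rintg_datum1.
- exact: (rint_datum1_sqr eps).1.
- by move=> xi; exact: lam1_datum1.
Qed.

Lemma evol_wave2 eps : 0 <= eps -> evol_eq (@lam2 R) (wave2 eps) (fun _ _ => 0).
Proof.
move=> e0; apply: (@evol_free _ _ _ 3) => //.
- exact: measurable_lam2.
- by move=> xi; exact: datum2_ge0.
- exact: rintg_datum2.
- exact: (rint_datum2_sqr eps).1.
- by move=> xi; exact: lam2_datum2.
Qed.

Lemma free1_L1L2 eps t : 0 <= eps ->
  cintg leb2 (free (@lam1 R) (datum1 eps) t) /\ l2 (free (@lam1 R) (datum1 eps) t).
Proof.
move=> e0; apply: free_L1L2.
- exact: measurable_lam1.
- by move=> xi; exact: datum1_ge0.
- exact: rintg_datum1.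
- exact: (rint_datum1_sqr eps).1.
Qed.

Lemma free2_L1L2 eps t : 0 <= eps ->
  cintg leb2 (free (@lam2 R) (datum2 eps) t) /\ l2 (free (@lam2 R) (datum2 eps) t).
Proof.
move=> e0; apply: free_L1L2.
- exact: measurable_lam2.
- by move=> xi; exact: datum2_ge0.
- exact: rintg_datum2.
- exact: (rint_datum2_sqr eps).1.
Qed.

Lemma coupling_ge0 eps : 0 <= c2pi^-1 * eps ^+ 2.
Proof. by rewrite mulr_ge0 ?sqr_ge0// invr_ge0 ltW// c2pi_gt0. Qed.

(** This identifies the quadratic term of the system with the forcing in
    Duhamel's formula. *)
Lemma wave_product eps t : 0 <= eps ->
  is_fourier (fun x => wave2 eps t x * conjc (wave1 eps t x))
    (forcing (@lam1 R) phase overlap (c2pi^-1 * eps ^+ 2) t).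
Proof.
move=> e0; have [i1 l1] := free1_L1L2 t e0; have [i2 l2] := free2_L1L2 t e0.
rewrite (_ : (fun x => _) = invf (forcing (@lam1 R) phase overlap (c2pi^-1 * eps ^+ 2) t)).
  have [h1 h2] := forcing_L1L2 measurable_lam1 measurable_phase measurable_overlap
    overlap_ge0 (coupling_ge0 eps) (fun xi => (rint_overlap_section xi).1)
    rint_overlap.1 rint_overlap.2 t.
  exact: is_fourier_invf.
by rewrite -corr_free; apply/funext => x; exact: invf_corr.
Qed.

Lemma evol_wave4 eps : 0 <= eps ->
  evol_eq (@lam1 R) (wave4 eps) (fun t x => wave2 eps t x * conjc (wave1 eps t x)).
Proof.
move=> e0; apply: (evol_duhamel measurable_lam1 measurable_phase measurable_overlap
    overlap_ge0 overlap_bounded _ (coupling_ge0 eps)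
    (fun xi => (rint_overlap_section xi).1) rint_overlap.1 rint_overlap.2) => //.
by move=> t; exact: wave_product.
Qed.

Lemma is_fourier_wave4 eps t :
  is_fourier (wave4 eps t) (duhamel (@lam1 R) phase overlap (c2pi^-1 * eps ^+ 2) t).
Proof.
have [|h1 h2] := duhamel_L1L2 measurable_lam1 measurable_phase measurable_overlap
    overlap_ge0 overlap_bounded _ (coupling_ge0 eps)
    (fun xi => (rint_overlap_section xi).1) rint_overlap.1 rint_overlap.2 t => //.
exact: is_fourier_invf.
Qed.

End interaction.

(** * Growth at low frequencies *)

Section growth.
Context {R : realType}.
Implicit Types (x y z xi : plane R) (p : plane R * plane R) (t r c : R).

Lemma rint_box (a b : plane R) : (a.1 : R) <= b.1 -> (a.2 : R) <= b.2 ->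
  \int[leb2]_x (\1_(box a b) x : R) = ((b.1 : R) - a.1) * ((b.2 : R) - a.2).
Proof.
move=> h1 h2.
have l (u v : R) : u <= v -> \int[lebesgue_measure]_x (\1_(`]u, v]%classic) x : R) = v - u.
  move=> uv; rewrite /Rintegral integral_indic ?setIT//= lebesgue_measure_itv /=.
  by rewrite lte_fin; case: ltrgtP uv => //= -> _; rewrite subrr.
have i (u v : R) : rintg (@lebesgue_measure R) (\1_(`]u, v]%classic)) by exact: integrable_indic_itv.
rewrite -(l _ _ h1) -(l _ _ h2) -(leb2_tensor_rint (i _ _) (i _ _)).2.
by congr Rintegral; apply/funext => x; exact: indic_box.
Qed.

Lemma in_box (a b : plane R) x : \1_(box a b) x = 1 :> R \/ \1_(box a b) x = 0 :> R.
Proof. by rewrite indicE; case: (_ \in _); [left|right]. Qed.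

Lemma boxP (a b : plane R) x : \1_(box a b) x != 0 :> R ->
  ((a.1 : R) < x.1 <= b.1) /\ ((a.2 : R) < x.2 <= b.2).
Proof.
rewrite indic_box !indicE mulf_eq0 negb_or => /andP[].
by rewrite !mem_setE !in_itv /=; case: (_ && _) => //; case: (_ && _); rewrite ?eqxx.
Qed.

(** On the quarter of the rectangle between 0 and [xi] next to the origin, all
    four factors of the overlap are at least the value of the spike at [r]. *)
Lemma overlap_ge r xi : 0 < r -> r <= 1 -> r / 2 <= (xi.1 : R) <= r -> r / 2 <= (xi.2 : R) <= r ->
  (r `^ (- (3 / 8))) ^+ 4 * (r ^+ 2 / 16) <= \int[leb2]_z overlap (xi, z).
Proof.
move=> r0 r1 /andP[a1 a2] /andP[b1 b2]; set k := r `^ _.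
have k0 : 0 <= k by exact: powR_ge0.
have [io _] := rint_overlap_section xi.
pose h : plane R := ((xi.1 : R) / 2, (xi.2 : R) / 2).
have ib := rintgZ (k ^+ 4) (@rintg_indic_box R (0, 0) h).
have : \int[leb2]_z (k ^+ 4 * \1_(box (0, 0) h) z) <= \int[leb2]_z overlap (xi, z).
  apply: le_rint => // z.
  have [->|hz] := eqVneq (\1_(box (0, 0) h) z : R) 0.
    by rewrite mulr0 overlap_ge0.
  have [/= /andP[c1 c2] /andP[d1 d2]] := boxP hz.
  have [->|e] := in_box (0, 0) h z; last by rewrite e eqxx in hz.
  rewrite mulr1 /overlap /profile /=.
  have s1 : k <= spike (z.1 : R) by apply: spike_ge => //; lra.
  have s2 : k <= spike (z.2 : R) by apply: spike_ge => //; lra.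
  have s3 : k <= spike ((xi.1 : R) - z.1) by apply: spike_ge => //; lra.
  have s4 : k <= spike ((xi.2 : R) - z.2) by apply: spike_ge => //; lra.
  rewrite (_ : k ^+ 4 = (k * k) * (k * k)); last by ring.
  by do 2?[apply: ler_pM; rewrite ?mulr_ge0//].
rewrite (rintZ _ (@rintg_indic_box R (0, 0) h)) rint_box /=; [|lra|lra].
apply: le_trans; apply: ler_wpM2l; first exact: exprn_ge0.
by rewrite !subr0; nra.
Qed.

(** Frequencies below [r] do not oscillate before the time 1 / (8 r ^ 2), so
    the integrand has real part at least t / 2 times the overlap. *)
Lemma nsq_duhamel_ge c t r xi : 0 <= c -> 0 <= t -> t * (2 * r ^+ 2) <= 4^-1 ->
  (xi.1 : R) <= r -> (xi.2 : R) <= r ->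
  (c * (t / 2 * \int[leb2]_z overlap (xi, z))) ^+ 2 <=
    nsq (duhamel (@lam1 R) phase overlap c t xi).
Proof.
move=> c0 t0 tr x1 x2; have [io _] := rint_overlap_section xi.
pose f z := osc t (phase (xi, z)) * (overlap (xi, z))%:C.
have fi : cintg leb2 f.
  have mw : measurable_fun setT (fun z => phase (xi, z)).
    exact: (measurableT_comp measurable_phase (measurable_pair1 xi)).
  apply: (cintg_le _ _ (rintgZ (2 * t ^+ 2 * 8 + `|t|) io)).
    by apply: cmeasM; [exact: (cmeas_comp mw (cmeas_osc t))|apply: cmeas_real; exact: rintg_meas io].
  move=> z; rewrite cmodM cmod_real (ger0_norm (overlap_ge0 _)).
  have [->|h] := eqVneq (overlap (xi, z)) 0; first by rewrite !mulr0.
  apply: ler_wpM2r; first exact: overlap_ge0.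
  apply: (le_trans (osc_le _ _)); rewrite lerD2r.
  apply: ler_wpM2l (overlap_bounded h).2.
  by apply: mulr_ge0 => //; exact: sqr_ge0.
have -> : duhamel (@lam1 R) phase overlap c t xi =
    (c%:C * cis (- (t * lam1 xi))) * cint leb2 f.
  rewrite /duhamel -mulrA; congr (_ * _); rewrite -(cintZ _ fi).
  by apply: eq_cint => z; rewrite /f /propagator mulrA.
rewrite !nsqM nsq_real nsq_cis mulr1 exprMn; apply: ler_wpM2l; first exact: sqr_ge0.
have G0 : 0 <= \int[leb2]_z overlap (xi, z).
  by apply: Rintegral_ge0 => z _; exact: overlap_ge0.
have h : t / 2 * \int[leb2]_z overlap (xi, z) <= complex.Re (cint leb2 f).
  rewrite -(rintZ _ io); apply: le_rint; [exact: rintgZ|exact: fi.1|move=> z].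
  rewrite /f ReM /= mulr0 subr0.
  have [->|h] := eqVneq (overlap (xi, z)) 0; first by rewrite !mulr0.
  apply: ler_wpM2r; first exact: overlap_ge0.
  apply: osc_re_ge => //; apply: le_trans tr; apply: ler_wpM2l => //.
  exact: (phase_le h x1 x2).1.
have g0 : 0 <= t / 2 * \int[leb2]_z overlap (xi, z) by rewrite mulr_ge0// divr_ge0.
apply: (@le_trans _ _ (complex.Re (cint leb2 f) ^+ 2)).
  by apply: lerXn2r => //; rewrite nnegrE// (le_trans g0).
by rewrite /nsq lerDl sqr_ge0.
Qed.

Lemma spike_power r : 0 < r -> (r `^ (- (3 / 8))) ^+ 8 * r ^+ 3 = 1.
Proof.
move=> r0; rewrite -powR_mulrn ?powR_ge0// -powRrM (_ : - (3 / 8) * 8%:R = - (3%:R)); last by field.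
by rewrite powRN powR_mulrn ?ltW// mulVf// expf_neq0 ?gt_eqF.
Qed.

(** Integrate the two preceding bounds over the square of the frequencies
    between r / 2 and r. With the time 1 / (8 r ^ 2) the powers of [r] are -4
    from the squared time, 4 from the squared area of integration in [z], -3
    from the spikes and 2 from the area of the square: the total is -1. *)
Lemma sq_duhamel_ge c r : 0 <= c -> 0 < r -> r <= 1 ->
  c ^+ 2 / (2 ^+ 18 * r) <= sq (duhamel (@lam1 R) phase overlap c (8 * r ^+ 2)^-1).
Proof.
move=> c0 r0 r1; set t := (8 * r ^+ 2)^-1; have r2 : 0 < r ^+ 2 by exact: exprn_gt0.
have t0 : 0 <= t by rewrite invr_ge0 mulr_ge0// ltW.
have tr : t * (2 * r ^+ 2) <= 4^-1.
  by rewrite /t (_ : _ * _ = 4^-1) //; field; rewrite gt_eqF.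
have [|_ [_ iA]] := duhamel_L1L2 measurable_lam1 measurable_phase measurable_overlap
    overlap_ge0 overlap_bounded _ c0
    (fun xi => (rint_overlap_section xi).1) rint_overlap.1 rint_overlap.2 t => //.
pose a : plane R := (r / 2, r / 2); pose b : plane R := (r, r).
set k := r `^ (- (3 / 8)); have k0 : 0 <= k by exact: powR_ge0.
pose m := (c * (t / 2 * (k ^+ 4 * (r ^+ 2 / 16)))) ^+ 2.
have ib := rintgZ m (@rintg_indic_box R a b).
have : \int[leb2]_xi (m * \1_(box a b) xi) <=
    sq (duhamel (@lam1 R) phase overlap c t).
  apply: le_rint => // xi.
  have [->|hz] := eqVneq (\1_(box a b) xi : R) 0; first by rewrite mulr0 nsq_ge0.
  have [/= /andP[c1 c2] /andP[d1 d2]] := boxP hz.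
  have [->|e] := in_box a b xi; last by rewrite e eqxx in hz.
  rewrite mulr1; apply: le_trans (nsq_duhamel_ge c0 t0 tr c2 d2).
  have m0 : 0 <= c * (t / 2 * (k ^+ 4 * (r ^+ 2 / 16))).
    by rewrite !mulr_ge0// ?exprn_ge0// ltW.
  have h : c * (t / 2 * (k ^+ 4 * (r ^+ 2 / 16))) <=
      c * (t / 2 * \int[leb2]_z overlap (xi, z)).
    apply: ler_wpM2l => //; apply: ler_wpM2l; first exact: divr_ge0.
    by apply: overlap_ge => //; apply/andP; split => //; exact: ltW.
  by apply: lerXn2r => //; rewrite nnegrE// (le_trans m0).
rewrite (rintZ _ (@rintg_indic_box R a b)) rint_box /=; [|lra|lra].
apply: le_trans; rewrite /m /t.
have hk : k ^+ 8 = (r ^+ 3)^-1.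
  have r3 : r ^+ 3 != 0 by rewrite expf_neq0 ?gt_eqF.
  by apply: (mulIf r3); rewrite spike_power// mulVf.
have -> : (c * ((8 * r ^+ 2)^-1 / 2 * (k ^+ 4 * (r ^+ 2 / 16)))) ^+ 2 =
    c ^+ 2 * k ^+ 8 * (2 ^+ 16)^-1 by field; rewrite gt_eqF.
rewrite hk le_eqVlt; apply/orP; left; apply/eqP.
by field; rewrite gt_eqF.
Qed.

End growth.

(** * The solution of the system *)

Section vector_norm.
Context {R : realType}.

Lemma rint_sum n (h : 'I_n -> plane R -> R) : (forall j, rintg leb2 (h j)) ->
  rintg leb2 (fun x => \sum_(j < n) h j x) /\
  \int[leb2]_x (\sum_(j < n) h j x) = \sum_(j < n) \int[leb2]_x h j x.
Proof.
elim: n h => [|n IH] h hi.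
  rewrite big_ord0 (_ : (fun x => _) = fun=> 0); last by apply/funext => x; rewrite big_ord0.
  by split; [exact: rintg0|rewrite /Rintegral integral0].
have [i e] := IH (fun j => h (widen_ord (leqnSn n) j)) (fun j => hi _).
rewrite (_ : (fun x => _) = fun x =>
  \sum_(j < n) h (widen_ord (leqnSn n) j) x + h ord_max x); last first.
  by apply/funext => x; rewrite big_ord_recr.
by split; [exact: rintgD|rewrite rintD// e big_ord_recr].
Qed.

Lemma L2vnormE n (u : 'I_n -> plane R -> R[i]) : (forall j, l2 (u j)) ->
  L2vnorm u = (Num.sqrt (\sum_(j < n) sq (u j)))%:E.
Proof.
move=> lu; have [i e] := rint_sum (fun j => (lu j).2).
rewrite /L2vnorm unlock.
rewrite (eq_integral (fun x => (\sum_(j < n) nsq (u j x))%:E)); last first.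
  move=> x _ /=; rewrite powR_mulrn// ger0_norm ?sqrtr_ge0//.
  rewrite sqr_sqrtr; last by apply: sumr_ge0 => j _; exact: sqr_ge0.
  by congr (_%:E); apply: eq_bigr => j _; rewrite cmod_sqr.
rewrite -(rintg_fin i) e poweR_EFin powR12_sqrt//.
by apply: sumr_ge0 => j _; exact: sq_ge0.
Qed.

Lemma L2vnorm_ge n (u : 'I_n -> plane R -> R[i]) j : (forall j, l2 (u j)) ->
  ((Num.sqrt (sq (u j)))%:E <= L2vnorm u)%E.
Proof.
move=> lu; rewrite L2vnormE// lee_fin ler_wsqrtr// (bigD1 j)//= lerDl.
by apply: sumr_ge0 => k _; exact: sq_ge0.
Qed.

End vector_norm.

Section example.
Context {R : realType}.
Implicit Types (eps t : R).

(** Only the first two components have nonzero data. The third, fifth and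
    sixth ones stay zero, and the fourth one is forced by the product of the
    free waves. *)
Definition flow eps t (j : 'I_6) : plane R -> R[i] :=
  nth (fun=> 0) [:: wave1 eps t; wave2 eps t; fun=> 0; wave4 eps t; fun=> 0; fun=> 0] j.

Lemma cpt_flow eps k : (0 < k <= 6)%N -> cpt (flow eps) k =
  fun t => nth (fun=> 0) [:: wave1 eps t; wave2 eps t; fun=> 0; wave4 eps t; fun=> 0; fun=> 0] k.-1.
Proof.
by case: k => // k /= hk; apply/funext => t; rewrite /cpt /flow inordK.
Qed.

Lemma flow_solution eps : 0 <= eps -> solution (flow eps 0) (flow eps).
Proof.
move=> e0; rewrite /solution !cpt_flow//=; split; first by move=> j; exact: ae_eq_refl.
have z0 (v : R -> plane R -> R[i]) : prod_conj (fun _ _ => 0) v = (fun _ _ => 0).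
  by apply/funext => t; apply/funext => x; rewrite /prod_conj mul0r.
rewrite !z0; split; split.
- exact: evol_wave1.
- exact: evol_wave2.
- exact: evol_zero measurable_lam3.
- exact: evol_wave4.
- exact: evol_zero measurable_lam2.
- exact: evol_zero measurable_lam1.
Qed.

Lemma wave4_0 eps : wave4 eps 0 = (fun=> 0 : R[i]).
Proof.
rewrite /wave4 (_ : duhamel _ _ _ _ _ = fun=> 0) ?invf0//.
apply/funext => xi; rewrite /duhamel (_ : (fun z => _) = fun=> 0) ?cint0 ?mulr0//.
apply/funext => z; rewrite /propagator (_ : osc 0 _ = 0) ?mulr0 ?mul0r//.
by rewrite /osc !mul0r sin0 cos0 subrr mul0r addr0.
Qed.

Lemma l2_solution (u0 : 'I_6 -> plane R -> R[i]) u t : solution u0 u -> 0 <= t ->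
  forall j, l2 (u t j).
Proof.
move=> [_ [[e1 e2 e3] [e4 e5 e6]]] t0 j.
have h : forall k, (k < 6)%N -> l2 (cpt u k.+1 t).
  by do 6?[case]; rewrite //= => _; apply/L2P; [have := e1 t t0|have := e2 t t0|have := e3 t t0|
    have := e4 t t0|have := e5 t t0|have := e6 t t0] => -[[]].
by have := h j (ltn_ord j); rewrite /cpt /= inord_val.
Qed.

(** Any solution has the same first and second components by uniqueness for
    the free equations, hence the same forcing of the fourth one, hence the
    same fourth one. *)
Lemma flow_unique eps u : 0 <= eps -> solution (flow eps 0) u ->
  forall t, 0 <= t -> cpt u 4 t = wave4 eps t %[ae leb2].
Proof.
move=> e0 [u0 [[e1 e2 _] [e4 _ _]]].
have E k : cpt u k 0 = cpt (flow eps) k 0 %[ae leb2] by exact: u0.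
have h1 : forall t, 0 <= t -> cpt u 1 t = wave1 eps t %[ae leb2].
  apply: (evol_unique e1 (evol_wave1 e0)); first by move=> t _; exact: ae_eq_refl.
  by have := E 1%N; rewrite (@cpt_flow eps 1).
have h2 : forall t, 0 <= t -> cpt u 2 t = wave2 eps t %[ae leb2].
  apply: (evol_unique e2 (evol_wave2 e0)); first by move=> t _; exact: ae_eq_refl.
  by have := E 2%N; rewrite (@cpt_flow eps 2).
apply: (evol_unique e4 (evol_wave4 e0)).
  move=> t t0; rewrite /prod_conj.
  by apply: filterS2 (h1 t t0) (h2 t t0) => x a b _; rewrite a// b.
by have := E 4%N; rewrite (@cpt_flow eps 4).
Qed.

Lemma sq_wave4_ge eps t : 8^-1 <= t ->
  (c2pi^-1 * eps ^+ 2) ^+ 2 / (2 ^+ 20 * c2pi) * Num.sqrt (8 * t) <= sq (wave4 eps t).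
Proof.
move=> t1; have t8 : 1 <= 8 * t by lra.
have s1 : 1 <= Num.sqrt (8 * t) by rewrite -[leLHS]sqrtr1 ler_wsqrtr.
have s0 : 0 < Num.sqrt (8 * t) by lra.
have sE : Num.sqrt (8 * t) ^+ 2 = 8 * t by rewrite sqr_sqrtr//; lra.
have := is_fourier_le (is_fourier_wave4 eps t).
set c := c2pi^-1 * eps ^+ 2.
have c0 : 0 <= c by exact: coupling_ge0.
have r0 : 0 < (Num.sqrt (8 * t))^-1 by rewrite invr_gt0.
have r1 : (Num.sqrt (8 * t))^-1 <= 1 by rewrite invf_le1.
have := sq_duhamel_ge c0 r0 r1.
have -> : (8 * (Num.sqrt (8 * t))^-1 ^+ 2)^-1 = t.
  by rewrite exprVn sE; field; lra.
move=> h1 h2; have := le_trans h1 h2.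
have p0 := @c2pi_gt0 R.
move: (Num.sqrt _) s0 => s s0.
have -> : c ^+ 2 / (2 ^+ 18 * s^-1) = 4 * c2pi * (c ^+ 2 / (2 ^+ 20 * c2pi) * s).
  by field; rewrite !gt_eqF.
by rewrite ler_pM2l// mulr_gt0.
Qed.

Lemma wave_sq0 eps : 0 <= eps ->
  c2pi * (sq (wave1 eps 0) + sq (wave2 eps 0)) <=
    8 * (eps ^+ 2 * \int[leb2]_xi (profile xi ^+ 2)).
Proof.
move=> e0; have [i1 l1] := free1_L1L2 0 e0; have [i2 l2] := free2_L1L2 0 e0.
have key (a b p q : R) : p * b <= 4 * q -> p * a <= 4 * q -> p * (a + b) <= 8 * q.
  by move=> ? ?; rewrite mulrDr; lra.
have := is_fourier_ge (is_fourier_invf i1 l1).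
have := is_fourier_ge (is_fourier_invf i2 l2).
have -> : sq (free (@lam1 R) (datum1 eps) 0) = eps ^+ 2 * \int[leb2]_xi (profile xi ^+ 2).
  rewrite -(rint_datum1_sqr eps).2 /sq; congr Rintegral; apply/funext => xi.
  by rewrite nsqM nsq_cis nsq_real mul1r.
have -> : sq (free (@lam2 R) (datum2 eps) 0) = eps ^+ 2 * \int[leb2]_xi (profile xi ^+ 2).
  rewrite -(rint_datum2_sqr eps).2 /sq; congr Rintegral; apply/funext => xi.
  by rewrite nsqM nsq_cis nsq_real mul1r.
exact: key.
Qed.

Lemma l2_flow0 eps : 0 <= eps -> forall j, l2 (flow eps 0 j).
Proof. by move=> e0; exact: (l2_solution (flow_solution e0)). Qed.

Lemma sqrt_data_bound (a b p eps S : R) : 0 < p -> 0 <= eps -> 0 <= S ->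
  p * (a + b) <= 8 * (eps ^+ 2 * S) ->
  Num.sqrt (\sum_(j < 6) nth 0 [:: a; b; 0; 0; 0; 0] j) <= Num.sqrt (8 * S / p) * eps.
Proof.
move=> p0 e0 S0 h; rewrite !big_ord_recl big_ord0 /= !addr0.
rewrite -[X in _ * X](ger0_norm e0) -[`|eps|]sqrtr_sqr -sqrtrM; last first.
  by rewrite divr_ge0 ?mulr_ge0// ltW.
apply: ler_wsqrtr; rewrite -(ler_pM2l p0); apply: (le_trans h).
rewrite le_eqVlt; apply/orP; left; apply/eqP.
by field; rewrite gt_eqF.
Qed.

Lemma L2vnorm_flow0 eps : 0 <= eps ->
  (L2vnorm (flow eps 0) <=
   (Num.sqrt (8 * \int[leb2]_xi (profile xi ^+ 2 : R) / c2pi) * eps)%:E)%E.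
Proof.
move=> e0; rewrite (L2vnormE (l2_flow0 e0)) lee_fin.
have F (j : 'I_6) : sq (flow eps 0 j) =
    nth 0 [:: sq (wave1 eps 0); sq (wave2 eps 0); 0; 0; 0; 0] j.
  by case: j => -[|[|[|[|[|[|//]]]]]] j6; rewrite /flow /nth ?wave4_0 ?sq0.
rewrite (eq_bigr _ (fun j _ => F j)).
have S0 : 0 <= \int[leb2]_xi (profile xi ^+ 2 : R).
  by apply: Rintegral_ge0 => x _; exact: sqr_ge0.
exact: (sqrt_data_bound (@c2pi_gt0 R) e0 S0 (wave_sq0 e0)).
Qed.

(** The time [t] is 1 / (8 r ^ 2) for r = 1 / sqrt (8 t), so [sq_duhamel_ge]
    bounds the fourth component below by a multiple of [t ^ (1 / 4)] in norm. *)
Lemma growth_cvg eps u : 0 < eps -> solution (flow eps 0) u ->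
  L2vnorm (u t) @[t --> +oo] --> +oo%E.
Proof.
move=> e0 hu; have p0 := @c2pi_gt0 R.
pose a : R := (c2pi^-1 * eps ^+ 2) ^+ 2 / (2 ^+ 20 * c2pi).
have a0 : 0 < a.
  apply: divr_gt0; last by apply: mulr_gt0 => //; exact: exprn_gt0.
  by apply: exprn_gt0; apply: mulr_gt0; [rewrite invr_gt0|exact: exprn_gt0].
apply/cvgeyPge => M; near=> t.
have t0 : 0 <= t by near: t; apply: nbhs_pinfty_ge; exact: num_real.
have t1 : 8^-1 <= t by near: t; apply: nbhs_pinfty_ge; exact: num_real.
(* beyond this time a * sqrt (8 t) exceeds M ^ 2 *)
have t2 : (M ^+ 2 / a) ^+ 2 / 8 <= t by near: t; apply: nbhs_pinfty_ge; exact: num_real.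
have lu := l2_solution hu t0.
apply: le_trans (L2vnorm_ge (inord 3) lu); rewrite lee_fin.
have -> : sq (u t (inord 3)) = sq (wave4 eps t).
  apply: ae_sq; [exact: flow_unique (ltW e0) hu t t0|exact: (lu _).1|].
  by have [[]] := evol_wave4 (ltW e0) t0 => /L2P[].
apply: (le_trans (ler_norm M)); rewrite -sqrtr_sqr ler_wsqrtr//.
apply: le_trans (sq_wave4_ge eps t1); rewrite -/a mulrC -ler_pdivrMr//.
have q0 : 0 <= M ^+ 2 / a by rewrite divr_ge0 ?sqr_ge0// ltW.
rewrite -[leLHS](ger0_norm q0) -sqrtr_sqr ler_wsqrtr//; lra.
Unshelve. all: by end_near. Qed.

Variable (phi : R -> R).
Hypothesis hphi : is_cutoff phi.

Lemma phi_bound l x : `|phi_ phi l x| <= 1.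
Proof.
case: hphi => _ _ p01 _ _; rewrite /phi_.
have := p01 (enorm x / 2 ^ l); have := p01 (enorm x / 2 ^ (l - 1)).
by move=> /andP[a b] /andP[c d]; rewrite ler_norml; apply/andP; split; lra.
Qed.

Lemma measurable_phi l : measurable_fun setT (phi_ phi l).
Proof.
case: hphi => _ d _ _ _.
have mp : measurable_fun setT phi.
  apply: continuous_measurable_fun => x.
  by apply/differentiable_continuous/derivable1_diffP; exact: (d 0%N x).
have m1 (s : R) : measurable_fun setT (fun x : plane R => phi (enorm x / s)).
  apply: (measurableT_comp mp); apply: measurable_funM; first exact: measurable_enorm.
  exact: measurable_cst.
by apply: measurable_funB; exact: m1.
Qed.

(** The coordinates are between 1 / 2 and 7 / 10 of 2 ^ l, so the norm is
    between 6 / 10 and 11 / 10 of it: there the outer cutoff is 1 and the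
    inner one 0. *)
Lemma phi_eq1 (l : int) (x : plane R) :
  (2 ^ l / 2 : R) < x.1 <= 7 / 10 * 2 ^ l -> (2 ^ l / 2 : R) < x.2 <= 7 / 10 * 2 ^ l ->
  phi_ phi l x = 1.
Proof.
case: hphi => _ _ _ p0 p1; have s0 : 0 < (2 : R) ^ l by exact: exprz_gt0.
have -> : phi_ phi l x = phi (enorm x / 2 ^ l) - phi (2 * (enorm x / 2 ^ l)).
  rewrite /phi_ expfzDr ?pnatr_eq0// exprN1; congr (_ - phi _).
  by field; rewrite gt_eqF.
move: (2 ^ l : R) s0 => s s0 /andP[a1 a2] /andP[b1 b2].
have e0 : 0 <= enorm x by exact: sqrtr_ge0.
have h1 : enorm x <= 11 / 10 * s.
  rewrite -(@ler_pXn2r _ 2) ?nnegrE//; last by rewrite mulr_ge0// ltW.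
  by rewrite enorm_sqr /dot; nra.
have h2 : 6 / 10 * s < enorm x.
  rewrite -(@ltr_pXn2r _ 2) ?nnegrE//; last by rewrite mulr_ge0// ltW.
  by rewrite enorm_sqr /dot; nra.
have q0 : 0 <= enorm x / s by rewrite divr_ge0// ltW.
rewrite p1; last by rewrite ger0_norm// ler_pdivrMr.
have q1 : 6 / 10 < enorm x / s by rewrite ltr_pdivlMr.
rewrite p0 ?subr0// ger0_norm; lra.
Qed.

(** The frequencies of [phi_eq1] form a box of positive area inside the unit
    square, on which the profile is at least 1. *)
Lemma LP_flow0 eps (l : int) : 0 < eps -> l <= 0 ->
  ~ (fourier (LP phi l (wave2 eps 0)) = (fun=> 0) %[ae leb2]).
Proof.
move=> e0 l0 F0; have [i2 lA2] := free2_L1L2 0 (ltW e0).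
have fw := is_fourier_invf i2 lA2; rewrite -/(wave2 eps 0) in fw.
have [lw _] := is_fourier_l2 fw.
have ff := fourier_spec lw; have [_ lf] := is_fourier_l2 ff.
have mphi : cmeas (fun xi => (phi_ phi l xi)%:C).
  by apply: cmeas_real; exact: measurable_phi.
have bphi xi : nsq (phi_ phi l xi)%:C <= 1.
  by rewrite nsq_real -(real_normK (num_real _)) expr_le1//; exact: phi_bound.
have ls : l2 (symb_mul (phi_ phi l) (wave2 eps 0)) by exact: (l2M mphi bphi lf).
have fs := multiplier_spec lw ls.
have [lLP _] := is_fourier_l2 fs.
have E := is_fourier_fun fs (fourier_spec lLP).
pose A xi := (phi_ phi l xi)%:C * free (@lam2 R) (datum2 eps) 0 xi.
have lA : l2 A by exact: (l2M mphi bphi lA2).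
have A0 : A = (fun=> 0) %[ae leb2].
  have F := is_fourier_fun ff fw.
  apply: filterS3 E F0 F => xi h1 h2 h3 _.
  by rewrite /A -h3//; exact: etrans (h1 I) (h2 I).
have := ae_sq A0 lA.1 (cmeas_cst _); rewrite sq0 => sA.
pose s : R := 2 ^ l.
have s0 : 0 < s by exact: exprz_gt0.
have s1 : s <= 1 by rewrite /s -(expr0z 2) ler_weXz2l// ler1n.
pose a : plane R := (s / 2, s / 2); pose b : plane R := (7 / 10 * s, 7 / 10 * s).
have ib := rintgZ (eps ^+ 2) (@rintg_indic_box R a b).
have : \int[leb2]_xi (eps ^+ 2 * \1_(box a b) xi) <= sq A.
  apply: le_rint => //; first exact: lA.2.
  move=> xi; have [->|hz] := eqVneq (\1_(box a b) xi : R) 0.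
    by rewrite mulr0 nsq_ge0.
  have [/= h1 h2] := boxP hz.
  have [->|e] := in_box a b xi; last by rewrite e eqxx in hz.
  rewrite mulr1 /A phi_eq1// mul1r nsqM nsq_cis mul1r nsq_real.
  have k1 (x : R) : s / 2 < x <= 7 / 10 * s -> 1 <= spike x.
    move=> /andP[x1 x2]; have := @spike_ge R x 1; rewrite powR1; apply; lra.
  have g1 : 1 <= profile xi by rewrite -[leLHS]mulr1; apply: ler_pM => //; exact: k1.
  have g2 : eps <= datum2 eps xi by apply: ler_peMr g1; exact: ltW.
  by apply: lerXn2r => //; rewrite nnegrE// ?(le_trans _ g2)// ltW.
rewrite sA (rintZ _ (@rintg_indic_box R a b)) rint_box /=; [|lra|lra].
apply/negP; rewrite -ltNge mulr_gt0 ?exprn_gt0// mulr_gt0//; lra.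
Qed.

End example.

Theorem theorem1p1 (R : realType) (phi : R -> R) (hphi : is_cutoff phi) :
  exists C : R, forall eps : R, 0 < eps ->
    exists u0 : 'I_6 -> plane R -> R[i],
      [/\ forall j, L2 (u0 j),
          forall l : int, l <= 0 ->
            exists j, ~ (fourier (LP phi l (u0 j)) = (fun=> 0) %[ae leb2]),
          (L2vnorm u0 <= (C * eps)%:E)%E,
          exists u, solution u0 u &
          forall u, solution u0 u -> L2vnorm (u t) @[t --> +oo] --> +oo%E].
Proof.
exists (Num.sqrt (8 * \int[leb2]_xi (profile xi ^+ 2 : R) / c2pi)) => eps e0.
have e0' := ltW e0; exists (flow eps 0); split.
- by move=> j; apply/L2P; exact: l2_flow0.
- move=> l l0; exists (inord 1); rewrite /flow inordK//=; exact: LP_flow0.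
- exact: L2vnorm_flow0.
- by exists (flow eps); exact: flow_solution.
- by move=> u; exact: growth_cvg.
Qed.
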